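(* Let $\Lambda=K\Gamma/I$ be a monomial relation algebra (i.e. $I$ is generated by paths). The following statements are equivalent and left-right symmetric (i.e. each holds for $\Lambda$ if and only if it holds for right instead of left modules): (1) $\Lambda$ has finite uniserial type. (2) For each sequence $\mathbb S$ of simple left $\Lambda$-modules, there is at most one uniserial left $\Lambda$-module with composition series $\mathbb S$, up to isomorphism. (3) Each mast $p$ of positive length of a uniserial left $\Lambda$-module satisfies the following condition, where $e$ denotes the starting vertex of $p$: whenever $(\alpha,u)$ is a slack halyard on $p$ and $X_r(\alpha,u)$ is a slack variable, there exists a right subpath $w_r(\alpha,u):e\to e$ of $p$ such that $v_r(\alpha,u)=\alpha u\,w_r(\alpha,u)$ in $K\Gamma$. (4) Condition (N) holds, and for each path $p\in K\Gamma\setminus I$ through a sequence of vertices $(e(0),\dots,e(l))$ in $\Gamma$, the following is true: if $e(i)=e(j)$ and $e(i+1)\ne e(j+1)$ for some $i<j<l$, but $K\Gamma\setminus I$ contains a path through $(e(0),\dots,e(i),e(j+1))$, then the sequence $(e(0),\dots,e(i))$ is a right segment of $(e(0),\dots,e(i),\dots,e(j))$, i.e. $(e(j-i),e(j-i+1),\dots,e(j))=(e(0),e(1),\dots,e(i))$.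
   Context: **Setting.** $K$ is an infinite field, $\Gamma$ a finite quiver, $I$ an admissible ideal of the path algebra $K\Gamma$ generated by paths, $\Lambda=K\Gamma/I$, and $J$ its Jacobson radical. Vertices of $\Gamma$ are identified with the corresponding primitive idempotents of $\Lambda$. Paths are composed so that $qp$ means ''$q$ after $p$''; vertices are the paths of length $0$. A right subpath of a path $p$ is a path $u$ with $p=u'u$ in $K\Gamma$ for some path $u'$ (lengths $0$ allowed). A path through a sequence of vertices $(e(0),\dots,e(l))$ is a path $\alpha_l\cdots\alpha_1$ of length $l$ where each $\alpha_i$ is an arrow $e(i-1)\to e(i)$. Modules are finitely generated left modules unless stated otherwise. **Uniserial modules, masts.** A module is uniserial if its submodules form a chain. A uniserial module $U$ of composition length $l+1$ has composition series $\mathbb S=(S(0),\dots,S(l))$ if $J^iU/J^{i+1}U\cong S(i)$ for all $i$. A mast of $U$ is a path $p$ in $K\Gamma$ of length $l$ with $pU\neq 0$; a path is called a mast if it is a mast of some uniserial left $\Lambda$-module. A top element of $U$ is an element $x\in U\setminus JU$ with $x=ex$ for a vertex $e$. $\Lambda$ has finite uniserial type if there are only finitely many isomorphism classes of uniserial left $\Lambda$-modules. **Condition (N).** Whenever $\alpha:e\to e'$ is an arrow in $\Gamma$ and $p:e\to e'$ is a mast of positive length, then $p\in K\Gamma\alpha\cup\alpha K\Gamma$ (i.e. $p$ starts or ends with the arrow $\alpha$). **Detours and $V_p$.** Let $p$ be a path. A detour on $p$ is a pair $(\alpha,u)$ with $u$ a right subpath of $p$ (possibly of length $0$) and $\alpha$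 an arrow such that $\alpha u$ is a path which is not a right subpath of $p$, but there is a right subpath of $p$ strictly longer than $u$ ending in the same vertex as $\alpha$. All right subpaths of $p$ that are longer than $u$ and end in the same vertex as $\alpha$ are denoted $v_i(\alpha,u)$, $i\in I(\alpha,u)$. Let $D$ be the set of triples $(\alpha,u,i)$ with $(\alpha,u)$ a detour on $p$ and $i\in I(\alpha,u)$, with corresponding independent variables $X_i(\alpha,u)$. $V_p\subseteq K^D$ is the set of all points $k=(k_i(\alpha,u))$ for which there are a uniserial left $\Lambda$-module $U$ with mast $p$ and a top element $x$ of $U$ with $\alpha ux=\sum_{i\in I(\alpha,u)}k_i(\alpha,u)v_i(\alpha,u)x$ for all detours $(\alpha,u)$ on $p$; this set is known to be Zariski closed. $A_p$ is the coordinate ring of $V_p$, i.e. the polynomial ring in the $X_i(\alpha,u)$ modulo the ideal of polynomials vanishing on $V_p$. **Halyards.** Let $p$ be a mast. A detour $(\alpha,u)$ on $p$ is a halyard on $p$ if some $X_j(\alpha,u)$ has nonzero image in $A_p$ (equivalently, $\alpha ux\neq0$ for some uniserial module with mast $p$ and some top element $x$ of it). A variable $X_j(\alpha,u)$ of a halyard $(\alpha,u)$ is slack if its image in $A_p$ is transcendental over $K$ (equivalently, the coordinate $k_j(\alpha,u)$ takes infinitely many values on $V_p$). A halyard is slack if it has at least one slack variable. *)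

(* Defs.v *)
From HB Require Import structures.
From mathcomp Require Import all_boot all_algebra.
From mathcomp Require Import generic_quotient ring_quotient finmap.
From mathcomp Require Import boolp classical_sets cardinality.
From mathcomp Require Import mpoly.
From mathcomp Require Import monalg.

Set Implicit Arguments.
Unset Strict Implicit.
Unset Printing Implicit Defensive.

Import GRing.Theory.
Local Open Scope ring_scope.
Local Open Scope quotient_scope.

(* [ring_quotient] quotients commutative rings only, so the two-sided
   noncommutative case is set up here on top of its quotient [Z]-modules.
   Rings are allowed to be zero ([pzRingType]). *)

Section Ideals.
Variable A : pzRingType.

Definition two_sided (S : {pred A}) : Prop :=
  [/\ 0 \in S,
      forall x y, x \in S -> y \in S -> x - y \in S,
      forall a x, x \in S -> a * x \in S &
      forall a x, x \in S -> x * a \in S].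

Record ideal := Ideal { ideal_mem :> {pred A}; idealP : two_sided ideal_mem }.

Lemma ideal_zmod_closed (I : ideal) : zmod_closed (ideal_mem I).
Proof. by case: (idealP I) => I0 IB _ _; split=> // x y; apply: IB. Qed.

HB.instance Definition _ (I : ideal) :=
  GRing.isZmodClosed.Build A (ideal_mem I) (ideal_zmod_closed I).

Definition gen_pred (S : A -> Prop) : {pred A} :=
  [pred x | `[< forall J : ideal, (forall y, S y -> y \in ideal_mem J) ->
                x \in ideal_mem J >]].

Lemma gen_pred_two_sided S : two_sided (gen_pred S).
Proof.
split=> [|x y|a x|a x]; rewrite ?inE.
- by move=> J _; case: (idealP J).
- move=> Sx Sy J SJ.
  by case: (idealP J) => _ IB _ _; apply: IB; [apply: Sx|apply: Sy].
- by move=> Sx J SJ; case: (idealP J) => _ _ IM _; apply: IM; apply: Sx.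
- by move=> Sx J SJ; case: (idealP J) => _ _ _ IM; apply: IM; apply: Sx.
Qed.

Definition ideal_gen (S : A -> Prop) : ideal := Ideal (gen_pred_two_sided S).

Definition ideal_mul (I J : ideal) : ideal :=
  ideal_gen (fun z => exists x y,
    [/\ x \in ideal_mem I, y \in ideal_mem J & z = x * y]).

Fixpoint ideal_exp (I : ideal) (n : nat) : ideal :=
  if n is n'.+1 then ideal_mul I (ideal_exp I n') else ideal_gen (fun _ => True).

End Ideals.

Section Quotient.
Variables (A : pzRingType) (I : ideal A).

Definition quo : Type := Quotient.quot (ideal_mem I).

HB.instance Definition _ := Choice.on quo.
HB.instance Definition _ := GRing.Zmodule.on quo.
HB.instance Definition _ := EqQuotient.on quo.

Definition toquo (x : A) : quo := \pi_quo x.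

Lemma toquoB : {morph toquo : x y / x - y}.
Proof. by move=> x y; rewrite /toquo !piE. Qed.

Lemma toquo_eq x y : (toquo x = toquo y) <-> (x - y \in ideal_mem I).
Proof. by rewrite /toquo Quotient.idealrBE; split=> [->|/eqP]. Qed.

Lemma toquo_eq0 x : (toquo x = 0) <-> (x \in ideal_mem I).
Proof.
have <- : toquo 0 = 0 by rewrite -[0 in LHS](subrr 0) toquoB subrr.
by rewrite toquo_eq subr0.
Qed.

Lemma toquo_reprK (u : quo) : toquo (repr u) = u.
Proof. exact: reprK. Qed.

Definition quo_one : quo := toquo 1.
Definition quo_mul (u v : quo) : quo := toquo (repr u * repr v).

Lemma toquo_mul x y : toquo (x * y) = quo_mul (toquo x) (toquo y).
Proof.
apply/toquo_eq; set x' := repr _; set y' := repr _.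
have Ix : x - x' \in ideal_mem I by apply/toquo_eq; rewrite toquo_reprK.
have Iy : y - y' \in ideal_mem I by apply/toquo_eq; rewrite toquo_reprK.
have -> : x * y - x' * y' = (x - x') * y - x' * (- (y - y')).
  by rewrite mulrBl mulrN opprK mulrBr addrA subrK.
case: (idealP I) => I0 IB Il Ir; apply: (IB); first exact: Ir.
by apply: Il; rewrite -[- _]sub0r; exact: (IB 0 _ I0 Iy).
Qed.

Lemma toquo_add x y : toquo (x + y) = toquo x + toquo y.
Proof.
have t0 : toquo 0 = 0 by rewrite -[0 in LHS](subrr 0) toquoB subrr.
by rewrite -[y in LHS]opprK toquoB -[- y]sub0r toquoB t0 sub0r opprK.
Qed.

Lemma quo_mulA : associative quo_mul.
Proof.
move=> x y z; rewrite -[x]toquo_reprK -[y]toquo_reprK -[z]toquo_reprK.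
by rewrite -!toquo_mul mulrA.
Qed.

Lemma quo_mul1 : left_id quo_one quo_mul.
Proof. by move=> x; rewrite -[x]toquo_reprK -toquo_mul mul1r. Qed.

Lemma quo_mulr1 : right_id quo_one quo_mul.
Proof. by move=> x; rewrite -[x]toquo_reprK -toquo_mul mulr1. Qed.

Lemma quo_mulDl : left_distributive quo_mul +%R.
Proof.
move=> x y z; rewrite -[x]toquo_reprK -[y]toquo_reprK -[z]toquo_reprK.
by rewrite -toquo_add -!toquo_mul -toquo_add mulrDl.
Qed.

Lemma quo_mulDr : right_distributive quo_mul +%R.
Proof.
move=> x y z; rewrite -[x]toquo_reprK -[y]toquo_reprK -[z]toquo_reprK.
by rewrite -toquo_add -!toquo_mul -toquo_add mulrDr.
Qed.

HB.instance Definition _ := GRing.Zmodule_isPzRing.Build quo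
  quo_mulA quo_mul1 quo_mulr1 quo_mulDl quo_mulDr.

HB.instance Definition _ := GRing.isZmodMorphism.Build A quo toquo toquoB.
HB.instance Definition _ := GRing.isMonoidMorphism.Build A quo toquo
  (erefl, toquo_mul).

End Quotient.

Record quiver := Quiver {
  vertex : finType;
  arrow : finType;
  src : arrow -> vertex;
  tgt : arrow -> vertex
}.

Definition opquiver (G : quiver) : quiver := Quiver (@tgt G) (@src G).

Section Paths.
Variable G : quiver.
Implicit Types (e : vertex G) (a : arrow G) (s : seq (arrow G)).

Fixpoint walk e s : bool :=
  if s is a :: s' then (src a == e) && walk (tgt a) s' else true.

Definition walk_end e s : vertex G := last e (map (@tgt G) s).

(* A path is its starting vertex together with its arrows in the order in which
   they are traversed: the path written a_l ... a_1 is [:: a_1; ...; a_l]. *)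
Record qpath := QPath {
  qpath_val : vertex G * seq (arrow G);
  _ : walk qpath_val.1 qpath_val.2
}.
HB.instance Definition _ := [isSub for qpath_val].
HB.instance Definition _ := [Choice of qpath by <:].
Implicit Types p q r u v w : qpath.

Definition pstart p : vertex G := (qpath_val p).1.
Definition parrows p : seq (arrow G) := (qpath_val p).2.
Definition pend p : vertex G := walk_end (pstart p) (parrows p).
Definition plen p : nat := size (parrows p).

Lemma qpath_walk p : walk (pstart p) (parrows p).
Proof. exact: (valP p). Qed.

(* the sequence (e(0), ..., e(l)) of vertices that p passes through *)
Definition pverts p : seq (vertex G) := pstart p :: map (@tgt G) (parrows p).

Definition vpath e : qpath := @QPath (e, [::]) isT.

Lemma apath_subproof a : walk (src a) [:: a].
Proof. by rewrite /= eqxx. Qed.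
Definition apath a : qpath := @QPath (src a, [:: a]) (apath_subproof a).

(* The path "q after p", when it is defined. *)
Definition pcomp q p : option qpath :=
  if pend p == pstart q then insub (pstart p, parrows p ++ parrows q) else None.

Lemma walk_cat e s1 s2 :
  walk e (s1 ++ s2) = walk e s1 && walk (walk_end e s1) s2.
Proof. by elim: s1 e => //= a s IH e; rewrite IH andbA. Qed.

Lemma walk_end_cat e s1 s2 :
  walk_end e (s1 ++ s2) = walk_end (walk_end e s1) s2.
Proof. by rewrite /walk_end map_cat last_cat. Qed.

Lemma pcompP q p r : reflect
  [/\ pend p = pstart q, pstart r = pstart p & parrows r = parrows p ++ parrows q]
  (pcomp q p == Some r).
Proof.
rewrite /pcomp; case: (pend p =P pstart q) => [pq|pq]; last by constructor; case.
case: insubP => [r' _ /= r'E|].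
  apply: (iffP eqP) => [[<-]|[_ r0 rs]].
    by rewrite /pstart /parrows r'E.
  by congr Some; apply: val_inj; rewrite /= r'E -r0 -rs -surjective_pairing.
by rewrite /= walk_cat -/(pend p) pq !qpath_walk.
Qed.

Lemma pcompS q p : pend p = pstart q -> {r | pcomp q p = Some r}.
Proof.
move=> pq; rewrite /pcomp pq eqxx; case: insubP => [r _ _|]; first by exists r.
by rewrite /= walk_cat -/(pend p) pq !qpath_walk.
Qed.

(* The right subpaths of p are its initial segments [ptake n p]; see
   [right_subpathP] for the agreement with the definition as right factors. *)
Lemma ptake_subproof n p : walk (pstart p) (take n (parrows p)).
Proof.
case: p => [[e s] /=]; rewrite /pstart /parrows /= => es.
by move: es; rewrite -{1}(cat_take_drop n s) walk_cat => /andP[].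
Qed.
Definition ptake n p : qpath :=
  @QPath (pstart p, take n (parrows p)) (ptake_subproof n p).

Definition right_subpaths p : seq qpath := [seq ptake n p | n <- iota 0 (plen p).+1].

Lemma right_subpathP u p :
  reflect (exists u', pcomp u' u = Some p) (u \in right_subpaths p).
Proof.
apply: (iffP mapP) => [[n _ ->]|[u' /eqP /pcompP [uu' p0 ps]]].
  have W : walk (pend (ptake n p)) (drop n (parrows p)).
    move: (valP p); rewrite -/(pstart p) -/(parrows p) -{1}(cat_take_drop n (parrows p)).
    by rewrite walk_cat => /andP[].
  exists (@QPath (pend (ptake n p), drop n (parrows p)) W); apply/eqP/pcompP.
  by split=> //; rewrite /parrows /= cat_take_drop.
exists (plen u); first by rewrite mem_iota /= add0n ltnS /plen ps size_cat leq_addr.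
apply: val_inj => /=; rewrite ps /plen take_size_cat // p0.
by rewrite -surjective_pairing.
Qed.

Definition defined_and (P : pred qpath) (o : option qpath) : bool :=
  if o is Some r then P r else false.

(* v is one of the v_i(a,u), among all paths *)
Definition bypass a u v : bool := (plen u < plen v)%N && (pend v == tgt a).

Definition detour p a u : bool :=
  [&& u \in right_subpaths p,
      defined_and [pred w | w \notin right_subpaths p] (pcomp (apath a) u) &
      has (bypass a u) (right_subpaths p)].

(* The set D of triples (a,u,v_i(a,u)); the index i of I(a,u) is taken to be the
   right subpath v_i(a,u) itself. *)
Definition detour_index p : finType :=
  {d : arrow G * seq_sub (right_subpaths p) * seq_sub (right_subpaths p)
   | detour p d.1.1 (ssval d.1.2) && bypass d.1.1 (ssval d.1.2) (ssval d.2)}.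

Definition darrow p (d : detour_index p) : arrow G := (val d).1.1.
Definition dsub p (d : detour_index p) : qpath := ssval (val d).1.2.
Definition dbypass p (d : detour_index p) : qpath := ssval (val d).2.

End Paths.

Section OppositePath.
Variable G : quiver.

Lemma walk_rev (e : vertex G) (s : seq (arrow G)) : @walk (opquiver G) e s ->
  @walk G (@walk_end (opquiver G) e s) (rev s) /\
  @walk_end G (@walk_end (opquiver G) e s) (rev s) = e.
Proof.
elim: s e => //= a s IH e /andP[/eqP <- /IH[W E]].
rewrite rev_cons -cats1 walk_cat walk_end_cat.
rewrite [@walk_end (opquiver G) _ (a :: s)](_ : _ = @walk_end (opquiver G) (src a) s) //.
by rewrite W E /walk_end /= eqxx.
Qed.

(* the path of G obtained by traversing a path of the opposite quiver backwards *)
Definition unop (p : qpath (opquiver G)) : qpath G :=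
  @QPath G (pend p, rev (parrows p)) (proj1 (walk_rev (qpath_walk p))).

Lemma pend_unop p : pend (unop p) = pstart p.
Proof. exact: (proj2 (walk_rev (qpath_walk p))). Qed.

End OppositePath.

Section LinearExtension.
Variables (K : fieldType) (T : choiceType) (V : lmodType K).

Definition linext (f : T -> V) (g : {malg K[T]}) : V :=
  \sum_(x <- msupp g) mcoeff x g *: f x.

Lemma linextw f (d : {fset T}) g :
  (msupp g `<=` d)%fset -> linext f g = \sum_(x <- d) mcoeff x g *: f x.
Proof.
move=> gd; rewrite /linext (big_fset_incl _ gd) // => x _ /mcoeff_outdom ->.
by rewrite scale0r.
Qed.

Lemma linext_is_linear f : linear (linext f).
Proof.
move=> c g h; set d := (msupp g `|` msupp h)%fset.
have gd : (msupp g `<=` d)%fset by apply: fsubsetUl.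
have hd : (msupp h `<=` d)%fset by apply: fsubsetUr.
have cd : (msupp (c *: g + h) `<=` d)%fset.
  by apply: fsubset_trans (msuppD_le _ _) _; rewrite fsetSU // msuppZ_le.
rewrite (linextw f gd) (linextw f hd) (linextw f cd) scaler_sumr -big_split /=.
by apply: eq_bigr => x _; rewrite mcoeffD mcoeffZ scalerDl scalerA.
Qed.
HB.instance Definition _ f :=
  GRing.isLinear.Build K {malg K[T]} V _ (linext f) (linext_is_linear f).

Lemma linextU f x : linext f << x >> = f x.
Proof. by rewrite (linextw f (@msuppU_le _ _ _ _)) big_seq_fset1 mcoeffUU scale1r. Qed.

Lemma linextC c f g : linext (fun x => c *: f x) g = c *: linext f g.
Proof.
by rewrite /linext scaler_sumr; apply: eq_bigr => x _; rewrite !scalerA mulrC.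
Qed.

Lemma linextD f1 f2 g :
  linext (fun x => f1 x + f2 x) g = linext f1 g + linext f2 g.
Proof. by rewrite /linext -big_split; apply: eq_bigr => x _; rewrite scalerDr. Qed.

End LinearExtension.

Section PathAlgebraModule.
Variables (K : fieldType) (G : quiver).

Definition palg : Type := {malg K[qpath G]}.
HB.instance Definition _ := GRing.Lmodule.on palg.

End PathAlgebraModule.

HB.lock Definition pbase (K : fieldType) (G : quiver) (p : qpath G) : palg K G :=
  << p >>.
Arguments pbase K {G} p.

Definition pbase_opt (K : fieldType) (G : quiver) (o : option (qpath G)) :
  palg K G := if o is Some r then pbase K r else 0.
Arguments pbase_opt K {G} o.

(* the bilinear extension of: q * p is the composite "q after p", or 0 *)
HB.lock Definition palg_mul (K : fieldType) (G : quiver) (g h : palg K G) :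
    palg K G :=
  linext (fun q => linext (fun p => pbase_opt K (pcomp q p)) h : palg K G) g.

Section PathAlgebra.
Variables (K : fieldType) (G : quiver).
Local Notation palg := (palg K G).
Local Notation pbase := (pbase K).
Local Notation pbase_opt := (pbase_opt K).
Local Notation palg_mul := (@palg_mul K G).

Definition palg_one : palg := \sum_(e : vertex G) pbase (vpath e).

Lemma linext_pbase (V : lmodType K) (f : qpath G -> V) p :
  linext f (pbase p) = f p.
Proof. by rewrite pbase.unlock linextU. Qed.

Lemma palg_ind (P : palg -> Prop) :
    (forall p, P (pbase p)) -> P 0 ->
    (forall c x y, P x -> P y -> P (c *: x + y)) ->
  forall g : palg, P g.
Proof.
move=> Pb P0 Plin g; rewrite [g]monalgE; elim/big_ind: _ => //.
  by move=> x y Px Py; rewrite -[x]scale1r; apply: Plin.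
move=> p _; have -> : << mcoeff p g *g p >> = mcoeff p g *: pbase p + 0.
  rewrite addr0; apply/malgP => q.
  by rewrite pbase.unlock [LHS]mcoeffU [RHS]mcoeffZ [in RHS]mcoeffU mulrnAr mulr1.
exact: Plin.
Qed.

Lemma palg_mulbb (q p : qpath G) : palg_mul (pbase q) (pbase p) = pbase_opt (pcomp q p).
Proof. by rewrite palg_mul.unlock !linext_pbase. Qed.

Lemma palg_mulDZl c (x y h : palg) :
  palg_mul (c *: x + y) h = c *: palg_mul x h + palg_mul y h.
Proof. by rewrite palg_mul.unlock linearP. Qed.

Lemma palg_mulDZr c (x y g : palg) :
  palg_mul g (c *: x + y) = c *: palg_mul g x + palg_mul g y.
Proof.
rewrite palg_mul.unlock -linextC -linextD; congr (linext _ g).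
by apply: funext => q; rewrite linearP.
Qed.

Lemma palg_mul0g h : palg_mul 0 h = 0.
Proof. by rewrite palg_mul.unlock linear0. Qed.

Lemma palg_mulg0 g : palg_mul g 0 = 0.
Proof. by have := palg_mulDZr (-1) 0 0 g; rewrite scaler0 addr0 scaleN1r addNr. Qed.

Lemma palg_mulDl : left_distributive palg_mul +%R.
Proof. by move=> x y h; rewrite -[x]scale1r palg_mulDZl !scale1r. Qed.

Lemma palg_mulDr : right_distributive palg_mul +%R.
Proof. by move=> g x y; rewrite -[x]scale1r palg_mulDZr !scale1r. Qed.

Lemma palg_mul_optl o (p : qpath G) :
  palg_mul (pbase_opt o) (pbase p) = pbase_opt (obind (fun r' => pcomp r' p) o).
Proof. by case: o => [r|] /=; rewrite ?palg_mulbb ?palg_mul0g. Qed.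

Lemma palg_mul_optr (q : qpath G) o :
  palg_mul (pbase q) (pbase_opt o) = pbase_opt (obind (pcomp q) o).
Proof. by case: o => [r|] /=; rewrite ?palg_mulbb ?palg_mulg0. Qed.

Lemma qpath_eq (p q : qpath G) :
  pstart p = pstart q -> parrows p = parrows q -> p = q.
Proof.
move=> pq0 pqs; apply: val_inj => /=.
by rewrite [qpath_val p]surjective_pairing [RHS]surjective_pairing; congr pair.
Qed.

Lemma pcomp_end (q p r : qpath G) : pcomp q p = Some r -> pend r = pend q.
Proof.
move=> /eqP /pcompP [pq r0 rs].
by rewrite /pend rs r0 walk_end_cat -/(pend p) pq.
Qed.

Lemma pcompN (q p : qpath G) : pend p <> pstart q -> pcomp q p = None.
Proof. by rewrite /pcomp; case: eqP. Qed.

Lemma pcompA (q r p : qpath G) :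
  obind (pcomp q) (pcomp r p) = obind (fun r' => pcomp r' p) (pcomp q r).
Proof.
case: (pend p =P pstart r) => [pr|npr]; last first.
  rewrite pcompN //=; case E: (pcomp q r) => [t|] //=; rewrite pcompN //.
  by move/eqP/pcompP: E => [_ -> _].
have [t tE] := pcompS pr; rewrite tE /=.
case: (pend r =P pstart q) => [rq|nrq]; last first.
  by rewrite (pcompN nrq) /= pcompN // (pcomp_end tE).
have [t' t'E] := pcompS rq; rewrite t'E /=.
have tq : pend t = pstart q by rewrite (pcomp_end tE).
have [w wE] := pcompS tq; rewrite wE.
apply/esym/eqP/pcompP.
move/eqP/pcompP: tE => [_ t0 ts]; move/eqP/pcompP: t'E => [_ t'0 t's].
move/eqP/pcompP: wE => [_ w0 ws].
by split; rewrite ?pr ?w0 ?ws ?ts ?t's ?catA.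
Qed.

Lemma palg_mulA : associative palg_mul.
Proof.
move=> f g h; elim/palg_ind: f => [q||c x y Hx Hy]; first last.
- by rewrite !palg_mulDZl Hx Hy.
- by rewrite !palg_mul0g.
elim/palg_ind: g => [r||c x y Hx Hy]; first last.
- by rewrite !(palg_mulDZl, palg_mulDZr) Hx Hy.
- by rewrite !(palg_mul0g, palg_mulg0).
elim/palg_ind: h => [p||c x y Hx Hy]; first last.
- by rewrite !palg_mulDZr Hx Hy.
- by rewrite !palg_mulg0.
by rewrite !palg_mulbb palg_mul_optl palg_mul_optr pcompA.
Qed.

Lemma palg_mul_suml (J : finType) (F : J -> palg) h :
  palg_mul (\sum_j F j) h = \sum_j palg_mul (F j) h.
Proof.
by apply: (big_morph (palg_mul^~ h)) => [x y|]; rewrite ?palg_mulDl ?palg_mul0g.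
Qed.

Lemma palg_mul_sumr (J : finType) (F : J -> palg) g :
  palg_mul g (\sum_j F j) = \sum_j palg_mul g (F j).
Proof.
by apply: (big_morph (palg_mul g)) => [x y|]; rewrite ?palg_mulDr ?palg_mulg0.
Qed.

Lemma palg_mul1 : left_id palg_one palg_mul.
Proof.
move=> g; elim/palg_ind: g => [p||c x y Hx Hy]; first last.
- by rewrite palg_mulDZr Hx Hy.
- by rewrite palg_mulg0.
rewrite palg_mul_suml (bigD1 (pend p)) //= big1 ?addr0 => [|e ep].
  rewrite palg_mulbb; suff -> : pcomp (vpath (pend p)) p = Some p by [].
  by apply/eqP/pcompP; rewrite /parrows /= cats0.
by rewrite palg_mulbb pcompN //; apply/eqP; rewrite eq_sym.
Qed.

Lemma palg_mulr1 : right_id palg_one palg_mul.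
Proof.
move=> g; elim/palg_ind: g => [p||c x y Hx Hy]; first last.
- by rewrite palg_mulDZl Hx Hy.
- by rewrite palg_mul0g.
rewrite palg_mul_sumr (bigD1 (pstart p)) //= big1 ?addr0 => [|e ep].
  rewrite palg_mulbb; suff -> : pcomp p (vpath (pstart p)) = Some p by [].
  by apply/eqP/pcompP.
by rewrite palg_mulbb pcompN //; apply/eqP.
Qed.

HB.instance Definition _ := GRing.Zmodule_isPzRing.Build palg
  palg_mulA palg_mul1 palg_mulr1 palg_mulDl palg_mulDr.

Definition arrow_ideal : ideal palg :=
  ideal_gen (fun x => exists a : arrow G, x = pbase (apath a)).

Definition admissible (I : ideal palg) : Prop :=
  exists m : nat, (2 <= m)%N /\
    {subset ideal_exp arrow_ideal m <= I} /\
    {subset I <= ideal_exp arrow_ideal 2}.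

Definition generated_by_paths (I : ideal palg) : Prop :=
  exists R : qpath G -> Prop,
    I =i ideal_gen (fun x => exists2 r, R r & x = pbase r).

End PathAlgebra.

HB.lock Definition palg_unop (K : fieldType) (G : quiver)
    (g : palg K (opquiver G)) : palg K G :=
  linext (fun p => pbase K (unop p) : palg K G) g.

Section Opposite.
Variables (K : fieldType) (G : quiver) (I : ideal (palg K G)).
Local Notation palg_unop := (@palg_unop K G).

Lemma palg_unop_linear : linear palg_unop.
Proof. by move=> c x y; rewrite palg_unop.unlock linearP. Qed.

Lemma palg_unop_pbase p : palg_unop (pbase K p) = pbase K (unop p).
Proof. by rewrite palg_unop.unlock linext_pbase. Qed.

Lemma palg_unopB : {morph palg_unop : x y / x - y}.
Proof. by move=> x y; rewrite palg_unop.unlock linearB. Qed.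

Lemma palg_unop0 : palg_unop 0 = 0.
Proof. by rewrite -[in LHS](subrr 0) palg_unopB subrr. Qed.

Lemma palg_unop_sum (J : finType) (F : J -> palg K (opquiver G)) :
  palg_unop (\sum_j F j) = \sum_j palg_unop (F j).
Proof. by rewrite palg_unop.unlock linear_sum. Qed.

Lemma palg_unop1 : palg_unop 1 = 1.
Proof.
rewrite [LHS]palg_unop_sum; apply: eq_bigr => e _; rewrite palg_unop_pbase.
by congr pbase; apply: qpath_eq.
Qed.

Lemma palg_unopM g h : palg_unop (g * h) = palg_unop h * palg_unop g.
Proof.
elim/palg_ind: g => [q||c x y Hx Hy]; first last.
- rewrite [in RHS]palg_unop_linear [RHS]palg_mulDZr.
  by rewrite [X in palg_unop X](palg_mulDZl c x y h) palg_unop_linear Hx Hy.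
- by rewrite mul0r palg_unop0 mulr0.
elim/palg_ind: h => [p||c x y Hx Hy]; first last.
- rewrite [in RHS]palg_unop_linear [RHS]palg_mulDZl.
  by rewrite [X in palg_unop X](palg_mulDZr c x y) palg_unop_linear Hx Hy.
- by rewrite mulr0 palg_unop0 mul0r.
rewrite [X in palg_unop X]palg_mulbb !palg_unop_pbase [RHS]palg_mulbb.
case: (pend p =P pstart q) => [pq|npq]; last first.
  rewrite !pcompN ?palg_unop0 // => E; apply: npq.
  by rewrite -[pstart q]pend_unop E.
have [r rE] := pcompS pq; rewrite rE /= palg_unop_pbase.
suff -> : pcomp (unop p) (unop q) = Some (unop r) by [].
apply/eqP/pcompP; rewrite pend_unop -pq; split=> //.
  exact: (pcomp_end rE).
by move/eqP/pcompP: rE => [_ _ rs]; rewrite /unop /parrows /= -rev_cat -rs.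
Qed.

(* Right modules over L = palg K G / I are left modules over the converse ring
   L^c, and L^c receives the path algebra of the opposite quiver: the two ways
   of presenting L are [toquo I] for left and [toquo_op I] for right modules. *)
Definition toquo_op (g : palg K (opquiver G)) : (quo I)^c :=
  toquo I (palg_unop g).

Lemma toquo_opB : {morph toquo_op : x y / x - y}.
Proof. by move=> x y; rewrite /toquo_op palg_unopB toquoB. Qed.

Lemma toquo_opM : GRing.monoid_morphism toquo_op.
Proof.
split; rewrite /toquo_op ?palg_unop1 ?rmorph1 // => x y.
by rewrite palg_unopM rmorphM.
Qed.

HB.instance Definition _ :=
  GRing.isZmodMorphism.Build (palg K (opquiver G)) (quo I)^c toquo_op toquo_opB.
HB.instance Definition _ :=
  GRing.isMonoidMorphism.Build (palg K (opquiver G)) (quo I)^c toquo_op toquo_opM.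

End Opposite.

Section Modules.
Variable A : pzRingType.

Section OneModule.
Variable U : lmodType A.

Definition submodule (N : {pred U}) : Prop := submod_closed N.

Definition submodule_gen (S : U -> Prop) : {pred U} :=
  [pred x | `[< forall N : {pred U}, submodule N ->
                (forall y, S y -> y \in N) -> x \in N >]].

Definition finitely_generated : Prop :=
  exists s : seq U, predT =i submodule_gen (fun x => x \in s).

Definition uniserial : Prop :=
  finitely_generated /\
  forall N M : {pred U}, submodule N -> submodule M ->
    {subset N <= M} \/ {subset M <= N}.

Definition maximal_in (N M : {pred U}) : Prop :=
  [/\ {subset M <= N}, ~ {subset N <= M} &
      forall P : {pred U}, submodule P -> {subset M <= P} -> {subset P <= N} ->
        P =i M \/ P =i N].

Definition composition_length (n : nat) : Prop :=
  exists M : nat -> {pred U},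
    [/\ M 0%N =i predT, M n =i pred1 0,
        forall i, (i <= n)%N -> submodule (M i) &
        forall i, (i < n)%N -> maximal_in (M i) (M i.+1)].

Definition simple_module : Prop :=
  (exists x : U, x != 0) /\
  forall N : {pred U}, submodule N -> N =i pred1 0 \/ N =i predT.

(* N / M is isomorphic to S, for submodules M of N: there is a surjective
   homomorphism N -> S with kernel M. Values outside N are irrelevant. *)
Definition subquotient_iso (N M : {pred U}) (S : lmodType A) : Prop :=
  exists f : U -> S,
    [/\ forall a, {in N &, forall x y, f (a *: x + y) = a *: f x + f y},
        forall s, exists2 x, x \in N & f x = s &
        forall x, x \in N -> (f x == 0) = (x \in M)].

End OneModule.

Definition module_iso (U V : lmodType A) : Prop :=
  exists f : {linear U -> V}, bijective f.

Definition maximal_left_ideal (M : {pred A^o}) : Prop :=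
  submodule M /\ maximal_in predT M.

Definition jacobson : {pred A} :=
  [pred a | `[< forall M : {pred A^o}, maximal_left_ideal M -> a \in M >]].

(* [radical_power U i] is J^i U *)
Fixpoint radical_power (U : lmodType A) (i : nat) {struct i} : {pred U} :=
  if i is i'.+1 then
    submodule_gen (fun y : U => exists (a : A) (x : U),
      [/\ a \in jacobson, x \in @radical_power U i' & y = a *: x])
  else predT.
Arguments radical_power : clear implicits.

Definition has_series (U : lmodType A) (l : nat) (S : 'I_l.+1 -> lmodType A) : Prop :=
  composition_length U l.+1 /\
  forall i : 'I_l.+1, subquotient_iso (radical_power U i) (radical_power U i.+1) (S i).

Definition finite_uniserial_type : Prop :=
  exists (n : nat) (M : 'I_n -> lmodType A),
    forall U : lmodType A, uniserial U -> exists i, module_iso U (M i).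

Definition uniserial_unique_by_series : Prop :=
  forall (l : nat) (S : 'I_l.+1 -> lmodType A), (forall i, simple_module (S i)) ->
  forall U V : lmodType A, uniserial U -> uniserial V ->
    has_series U S -> has_series V S -> module_iso U V.

End Modules.

Arguments radical_power {A} U i.

(* The remaining definitions are relative to a ring homomorphism [rho : palg K G -> A],
   which is the quotient map [toquo I] when left modules are considered and
   [toquo_op I] when right modules are. *)

Section Masts.
Variables (K : fieldType) (G : quiver) (A : pzRingType).
Variable rho : {rmorphism palg K G -> A}.

Implicit Types p : qpath G.

Local Notation cls p := (rho (pbase K p)).

Definition mast_of (p : qpath G) (U : lmodType A) : Prop :=
  composition_length U (plen p).+1 /\ exists x : U, cls p *: x != 0.

Definition mast (p : qpath G) : Prop :=
  exists U : lmodType A, uniserial U /\ mast_of p U.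

Definition top_element (U : lmodType A) (x : U) : Prop :=
  x \notin radical_power U 1 /\ exists e : vertex G, x = cls (vpath e) *: x.

Definition Vp (p : qpath G) (k : detour_index p -> K) : Prop :=
  exists U : lmodType A, [/\ uniserial U, mast_of p U &
    exists2 x : U, top_element x &
      forall (a : arrow G) (u : qpath G), detour p a u ->
        cls (apath a) *: (cls u *: x) =
        \sum_(d : detour_index p | (darrow d == a) && (dsub d == u))
          rho (k d *: pbase K (dbypass d)) *: x].

Local Notation polyring p := (mpoly #|detour_index p| K).

Definition vanishing_pred (p : qpath G) : {pred polyring p} :=
  [pred f : polyring p | `[< forall k, Vp k ->
     meval (fun i => k (enum_val i)) f = 0 >]].

Arguments vanishing_pred : clear implicits.

Lemma vanishing_two_sided p : @two_sided (polyring p) (vanishing_pred p).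
Proof.
split=> [|f g|f g|f g]; rewrite !inE.
- by move=> k _; rewrite rmorph0.
- by move=> Hf Hg k Vk; rewrite rmorphB /= Hf ?Hg ?subrr.
- by move=> Hg k Vk; rewrite rmorphM /= Hg ?mulr0.
- by move=> Hg k Vk; rewrite rmorphM /= Hg ?mul0r.
Qed.

Definition vanishing_ideal p : ideal (polyring p) :=
  Ideal (@vanishing_two_sided p).

Definition coord_ring (p : qpath G) : pzRingType := quo (vanishing_ideal p).

Definition coord_const p (c : K) : coord_ring p :=
  toquo (vanishing_ideal p) (mpolyC _ c).

(* the image in A_p of the variable X_i(a,u) with index d = (a,u,i) *)
Definition coord_var p (d : detour_index p) : coord_ring p :=
  toquo (vanishing_ideal p) (mpolyX K (mnm1 (enum_rank d))).

Definition transcendental p (z : coord_ring p) : Prop :=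
  forall f : {poly K},
    \sum_(i < size f) coord_const p f`_i * z ^+ i = 0 -> f = 0.

Definition halyard p (a : arrow G) (u : qpath G) : Prop :=
  detour p a u /\
  exists d : detour_index p, [/\ darrow d = a, dsub d = u & coord_var d != 0].

Definition slack_variable p (d : detour_index p) : Prop :=
  halyard p (darrow d) (dsub d) /\ transcendental (coord_var d).

Definition slack_halyard p (a : arrow G) (u : qpath G) : Prop :=
  halyard p a u /\
  exists d : detour_index p, [/\ darrow d = a, dsub d = u & slack_variable d].

Definition slack_condition : Prop :=
  forall p : qpath G, mast p -> (0 < plen p)%N ->
  forall (a : arrow G) (u : qpath G), slack_halyard p a u ->
  forall r : detour_index p, darrow r = a -> dsub r = u -> slack_variable r ->
  exists w : qpath G,
    [/\ w \in right_subpaths p, pstart w = pstart p, pend w = pstart p &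
        pbase K (dbypass r) = pbase K (apath a) * pbase K u * pbase K w].

Definition condition_N : Prop :=
  forall (a : arrow G) (p : qpath G),
    pstart p = src a -> pend p = tgt a -> mast p -> (0 < plen p)%N ->
    (exists c : palg K G, pbase K p = c * pbase K (apath a)) \/
    (exists c : palg K G, pbase K p = pbase K (apath a) * c).

(* cls p != 0 in A says that p is not in the ideal I *)
Definition vertex_condition : Prop :=
  condition_N /\
  forall p : qpath G, cls p != 0 ->
  let e := nth (pstart p) (pverts p) in
  forall i j : nat, (i < j < plen p)%N ->
    e i = e j -> e i.+1 != e j.+1 ->
    (exists q : qpath G,
       cls q != 0 /\ pverts q = rcons [seq e k | k <- iota 0 i.+1] (e j.+1)) ->
  forall k : nat, (k <= i)%N -> e (j - i + k)%N = e k.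

End Masts.

(* Main.v *)
(* All four conditions are equivalent to one property of the nonzero paths, called
   [rigid] below: if u is a proper initial segment of a nonzero path s, and a is an
   arrow from the end of u to the end of s with au nonzero, then au is an initial
   or a final segment of s.

   Let x be a top element of a uniserial module with mast s. If the nonzero paths
   are rigid, then for each detour (a,u) the vector aux is a combination of vectors
   auwx where w and auw are initial segments of s, and no w occurs for two
   detours. Subtracting multiples of the wx from x, by increasing length of w,
   yields a top element killed by all detours, so the module is determined by its
   mast; rigidity also makes the mast determined by its vertices. This gives (1),
   (2) and (3).

   Conversely, a failure of rigidity at (s,u,a) gives uniserial modules U_k with
   mast s, for k in K, in which aux = k sx. They have the same composition series
   and are pairwise non-isomorphic: for every y in U_k, the coefficients of the
   last basis vector in auy and in sy are k c and c, where c is the coefficient of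
   x in y. So (1), (2) and (3) fail.

   Rigidity is a statement about paths only, and it is self-dual. *)

(* The subtraction that straightens x is delicate because it changes the action of every other
   detour too. For a closed segment w of length n, the correction for a detour (b,u') is the path w
   u' b applied to x. If this path stays on the mast, then (b,u') realigns along w, and only one
   detour can do so. Otherwise it leaves the mast, and the arrows that leave the mast already sink n
   > 0 layers beyond what their length accounts for, so the correction lies below the layer being
   cleared. Cleared layers therefore stay clear, and as many passes as the mast has arrows suffice.

   Layers can be computed with paths once the Jacobson radical, defined by maximal left ideals, is
   identified with the image of the arrow ideal. The algebra modulo its radical is a product of
   copies of K, so the radical layers of a uniserial module are at most one-dimensional over any
   field K. The resulting basis of initial segments of the mast applied to x carries all later
   computations. *)
Require Import Defs.
From HB Require Import structures.
From mathcomp Require Import all_boot all_algebra.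
From mathcomp Require Import zify mpoly monalg.
From mathcomp Require Import boolp classical_sets cardinality.

Set Implicit Arguments.
Unset Strict Implicit.
Unset Printing Implicit Defensive.

Import GRing.Theory.
Local Open Scope ring_scope.

(* all_boot also exports a [pcomp], on partial functions. *)
Local Notation pcomp := Defs.pcomp.

(** * Path algebras and monomial presentations *)

Section Coefficients.
Variables (K : fieldType) (G : quiver).

Definition pcoef (p : qpath G) (g : palg K G) : K := mcoeff p (g : {malg K[qpath G]}).

Lemma pcoef_pbase p q : pcoef p (pbase K q) = (q == p)%:R.
Proof. by rewrite /pcoef pbase.unlock mcoeffU. Qed.

Lemma pcoef_pbase_neq0 p q : (pcoef p (pbase K q) != 0) = (q == p).
Proof. by rewrite pcoef_pbase; case: (q == p); rewrite ?oner_neq0 ?eqxx. Qed.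

Lemma pcoef0 p : pcoef p 0 = 0.
Proof. exact: mcoeff0. Qed.

Lemma pcoefDZ p c g h : pcoef p (c *: g + h) = c * pcoef p g + pcoef p h.
Proof. by rewrite /pcoef mcoeffD mcoeffZ. Qed.

Lemma pcoefD p : {morph @pcoef p : g h / g + h}.
Proof. exact: mcoeffD. Qed.

Lemma pcoefB p g h : pcoef p (g - h) = pcoef p g - pcoef p h.
Proof. exact: mcoeffB. Qed.

Lemma pcoefZ p c g : pcoef p (c *: g) = c * pcoef p g.
Proof. exact: mcoeffZ. Qed.

Lemma pcoef_opt p o : pcoef p (pbase_opt K o) = (o == Some p)%:R.
Proof. by case: o => [q|] /=; rewrite ?pcoef_pbase // pcoef0. Qed.

(** Linear induction visiting only paths in the support of [g]: this passes statements about single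
    paths to elements of monomial ideals. *)
Lemma palg_supp_ind (Q : qpath G -> Prop) (P : palg K G -> Prop) :
    (forall p, Q p -> P (pbase K p)) -> P 0 ->
    (forall c x y, P x -> P y -> P (c *: x + y)) ->
  forall g, (forall p, pcoef p g != 0 -> Q p) -> P g.
Proof.
move=> Pb P0 Plin g Qg; rewrite [g]monalgE big_seq; elim/big_ind: _ => //.
  by move=> x y Px Py; rewrite -[x]scale1r; apply: Plin.
move=> p pg; have -> : << mcoeff p g *g p >> = mcoeff p g *: pbase K p + 0.
  rewrite addr0; apply/malgP => q.
  by rewrite pbase.unlock [LHS]mcoeffU [RHS]mcoeffZ [in RHS]mcoeffU mulrnAr mulr1.
by apply: Plin => //; apply: Pb; apply: Qg; rewrite /pcoef mcoeff_neq0.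
Qed.

Lemma palg_ind2 (Q Q' : qpath G -> Prop) (P : palg K G -> Prop) :
    (forall p q, Q p -> Q' q -> P (pbase_opt K (pcomp p q))) -> P 0 ->
    (forall c x y, P x -> P y -> P (c *: x + y)) ->
  forall g h, (forall p, pcoef p g != 0 -> Q p) ->
    (forall p, pcoef p h != 0 -> Q' p) -> P (g * h).
Proof.
move=> Pb P0 Plin g h Qg Qh.
move: g Qg; apply: palg_supp_ind => [p Qp||c x y Px Py]; last 2 first.
- by rewrite mul0r.
- by rewrite [_ * h]palg_mulDZl; apply: Plin.
move: h Qh; apply: palg_supp_ind => [q Qq||c x y Px Py]; last 2 first.
- by rewrite mulr0.
- by rewrite [_ * _]palg_mulDZr; apply: Plin.
by rewrite [_ * _]palg_mulbb; apply: Pb.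
Qed.

(** A composite is trivial only if both factors are. This character of the path algebra yields the
    maximal left ideals of [maximal_vertex]. *)
Lemma pcoef_vpathM e g h :
  pcoef (vpath e) (g * h) = pcoef (vpath e) g * pcoef (vpath e) h.
Proof.
elim/palg_ind: g => [p||c x y Hx Hy]; first last.
- by rewrite [_ * h]palg_mulDZl !pcoefDZ Hx Hy mulrDl mulrA.
- by rewrite mul0r pcoef0 mul0r.
elim/palg_ind: h => [q||c x y Hx Hy]; first last.
- by rewrite [_ * (_ + _)]palg_mulDZr !pcoefDZ Hx Hy mulrDr mulrCA.
- by rewrite mulr0 pcoef0 mulr0.
rewrite [_ * _]palg_mulbb pcoef_opt !pcoef_pbase -natrM mulnb; congr (_ %:R); congr nat_of_bool.
apply/pcompP/andP => [[E1 E2 E3]|[/eqP-> /eqP->]]; last by [].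
have [q0 p0] : parrows q = [::] /\ parrows p = [::].
  by move: E3; rewrite {1}/parrows /=; case: (parrows q) (parrows p) => [|? ?] [].
split; apply/eqP/qpath_eq => //; rewrite -E1.
by rewrite /pend q0 -E2.
Qed.

End Coefficients.

Lemma palg_scaleE (K : fieldType) (G : quiver) c (g : palg K G) :
  c *: g = (c *: (1 : palg K G)) * g.
Proof.
suff H : palg_mul (c *: palg_one K G) g = c *: palg_mul (palg_one K G) g.
  by rewrite palg_mul1 in H; rewrite -[LHS]H.
by rewrite palg_mul.unlock linearZ.
Qed.

(** * The length filtration, and ideals generated by paths *)

Section Longer.
Variables (K : fieldType) (G : quiver).

(** The span of the paths of length at least [n], a concrete form of the n-th power of the arrow
    ideal. *)
Definition longer_pred n : {pred palg K G} :=
  [pred g | `[< forall p, pcoef p g != 0 -> (n <= plen p)%N >]].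

Lemma longerP n g :
  reflect (forall p, pcoef p g != 0 -> (n <= plen p)%N) (g \in longer_pred n).
Proof. by rewrite inE; apply: asboolP. Qed.

Lemma longer0 n : 0 \in longer_pred n.
Proof. by apply/longerP => p; rewrite pcoef0 eqxx. Qed.

Lemma longerDZ n c g h : g \in longer_pred n -> h \in longer_pred n ->
  c *: g + h \in longer_pred n.
Proof.
move=> /longerP Hg /longerP Hh; apply/longerP => p.
rewrite pcoefDZ; case: (eqVneq (pcoef p g) 0) => [->|/Hg //].
by rewrite mulr0 add0r => /Hh.
Qed.

Lemma longer_pbase n p : (n <= plen p)%N -> pbase K p \in longer_pred n.
Proof. by move=> np; apply/longerP => q; rewrite pcoef_pbase_neq0 => /eqP<-. Qed.

Lemma plen_pcomp (p q r : qpath G) : pcomp p q = Some r -> plen r = (plen q + plen p)%N.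
Proof. by move=> /eqP/pcompP[_ _ E]; rewrite /plen E size_cat. Qed.

Lemma longerM m n g h : g \in longer_pred m -> h \in longer_pred n ->
  g * h \in longer_pred (m + n).
Proof.
move=> /longerP Hg /longerP Hh.
apply: (palg_ind2 (P := fun x => x \in longer_pred (m + n)) _ _ _ Hg Hh) => [p q mp nq||c x y Px Py].
- case E: (pcomp p q) => [r|] /=; last exact: longer0.
  by apply: longer_pbase; rewrite (plen_pcomp E) addnC leq_add.
- exact: longer0.
- exact: longerDZ.
Qed.

Lemma longer_all g : g \in longer_pred 0.
Proof. exact/longerP. Qed.

Lemma longer_two_sided n : two_sided (longer_pred n).
Proof.
split=> [|g h Hg Hh|a g Hg|a g Hg].
- exact: longer0.
- by rewrite -scaleN1r addrC; apply: longerDZ.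
- by rewrite -[n]add0n; apply: longerM => //; exact: longer_all.
- by rewrite -[n]addn0; apply: longerM => //; exact: longer_all.
Qed.

Lemma ideal_gen_sub (A : pzRingType) (S : A -> Prop) (J : {pred A}) :
  two_sided J -> (forall x, S x -> x \in J) -> {subset ideal_gen S <= J}.
Proof. by move=> HJ SJ x; rewrite inE => /(_ (Ideal HJ) SJ). Qed.

Lemma ideal_gen_mem (A : pzRingType) (S : A -> Prop) x : S x -> x \in ideal_gen S.
Proof. by move=> Sx; rewrite inE => J; apply. Qed.

Lemma arrow_ideal_exp_longer n : {subset ideal_exp (arrow_ideal K G) n <= longer_pred n}.
Proof.
elim: n => [|n IH]; first by move=> x _; exact: longer_all.
apply: ideal_gen_sub; first exact: longer_two_sided.
move=> _ [x [y [xI yI ->]]]; rewrite -[n.+1]add1n; apply: longerM (IH _ yI).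
move: x xI; apply: ideal_gen_sub; first exact: longer_two_sided.
by move=> _ [a ->]; apply: longer_pbase.
Qed.

Lemma pbase_arrow_ideal_exp n p : (n <= plen p)%N ->
  pbase K p \in ideal_exp (arrow_ideal K G) n.
Proof.
elim: n p => [|n IH] p np; first exact: ideal_gen_mem.
case: p np => [[e s] W]; rewrite /plen /parrows /=.
case/lastP: s W => [|s a] // W; rewrite size_rcons ltnS => ns.
have [W1 Ea] : walk e s /\ src a = walk_end e s.
  have W' : walk e (rcons s a) by exact: W.
  by move: W'; rewrite -cats1 walk_cat => /andP[-> /= /andP[/eqP-> _]].
have -> : pbase K (QPath W) = pbase K (apath a) * pbase K (@QPath G (e, s) W1).
  rewrite [RHS]palg_mulbb; suff -> : pcomp (apath a) (@QPath G (e, s) W1) = Some (QPath W) by [].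
  by apply/eqP/pcompP; split=> //; rewrite /parrows /= cats1.
apply: ideal_gen_mem; exists (pbase K (apath a)); exists (pbase K (@QPath G (e, s) W1)).
by split=> //; [apply: ideal_gen_mem; exists a | apply: IH].
Qed.

End Longer.

(* The only features of a presentation of a monomial algebra that are used:
   they hold both for [toquo I] and for [toquo_op I]. *)
Record monomial_presentation (K : fieldType) (G : quiver) (A : pzRingType)
    (rho : {rmorphism palg K G -> A}) : Prop := MonomialPresentation {
  presS : forall a, exists g, a = rho g;
  presI : forall g, rho g = 0 -> forall p, pcoef p g != 0 -> rho (pbase K p) = 0;
  presN : exists m, forall p, (m <= plen p)%N -> rho (pbase K p) = 0;
  presA : forall p, (plen p <= 1)%N -> rho (pbase K p) != 0
}.

Section Quotients.
Variables (K : fieldType) (G : quiver) (I : ideal (palg K G)).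
Hypotheses (I_admissible : admissible I) (I_monomial : generated_by_paths I).

(** The elements supported on paths of [I] form a two-sided ideal that contains the generating
    paths. *)
Lemma monomial_coef g : g \in (I : {pred _}) -> forall p, pcoef p g != 0 -> pbase K p \in (I : {pred _}).
Proof.
case: I_monomial => R IR; case: (idealP I) => I0 IB Il Ir.
pose J : {pred palg K G} :=
  [pred g | `[< forall p, pcoef p g != 0 -> pbase K p \in (I : {pred _}) >]].
have J0 : 0 \in J by rewrite inE => p; rewrite pcoef0 eqxx.
have JDZ c x y : x \in J -> y \in J -> c *: x + y \in J.
  rewrite !inE => Jx Jy p.
  rewrite pcoefDZ; case: (eqVneq (pcoef p x) 0) => [->|/Jx //].
  by rewrite mulr0 add0r => /Jy.
have Jb p : pbase K p \in (I : {pred _}) -> pbase K p \in J.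
  move=> Ip; rewrite inE => q.
  by rewrite pcoef_pbase_neq0 => /eqP<-.
have Jo p q : pbase K p \in (I : {pred _}) \/ pbase K q \in (I : {pred _}) -> pbase_opt K (pcomp p q) \in J.
  move=> pq; case E: (pcomp p q) => [r|] //=; apply: Jb.
  have -> : pbase K r = pbase K p * pbase K q by rewrite [RHS]palg_mulbb E.
  by case: pq => [/Ir|/Il].
have J2 : two_sided J.
  split=> // [x y Jx Jy|a x|a x].
  - by rewrite -scaleN1r addrC; apply: JDZ.
  - rewrite inE => Jx.
    by apply: (palg_ind2 (P := fun x => x \in J) (Q := fun=> True) _ J0 JDZ _ Jx) =>// => p q _ Iq; apply: Jo; right.
  - rewrite inE => Jx.
    by apply: (palg_ind2 (P := fun x => x \in J) (Q' := fun=> True) _ J0 JDZ Jx) =>// => p q Ip _; apply: Jo; left.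
rewrite IR => gI; suff: g \in J by rewrite inE.
apply: (ideal_gen_sub J2) gI => _ [r Rr ->]; apply: Jb; rewrite IR.
by apply: ideal_gen_mem; exists r.
Qed.

Lemma toquo_presentation : monomial_presentation (toquo I).
Proof.
case: I_admissible => m [m2 [mI I2]]; split=> [a|g /toquo_eq0 gI p pg||p p1].
- by exists (repr a); rewrite -[LHS]toquo_reprK.
- by apply/toquo_eq0; apply: monomial_coef pg.
- by exists m => p mp; apply/toquo_eq0/mI/pbase_arrow_ideal_exp.
(* [I] lies in the square of the arrow ideal, so it contains no path of length at most 1. *)
apply/negP => /eqP /toquo_eq0 /I2 /arrow_ideal_exp_longer /longerP /(_ p).
by rewrite pcoef_pbase eqxx oner_neq0 => /(_ isT); rewrite leqNgt ltnS p1.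
Qed.

Lemma unop_inj : injective (@unop G).
Proof.
move=> p q E; apply: qpath_eq.
  by rewrite -(pend_unop p) -(pend_unop q) E.
by apply: (can_inj revK); have := congr1 (@parrows G) E.
Qed.

Lemma unop_surj (p : qpath G) : exists q, unop q = p.
Proof.
have [W E] := @walk_rev (opquiver G) (pstart p) (parrows p) (qpath_walk p).
exists (@QPath (opquiver G) (pend p, rev (parrows p)) W).
by apply: qpath_eq; [exact: E | rewrite /parrows /= revK].
Qed.

Lemma palg_unop_surj (g : palg K G) : exists h, g = palg_unop h.
Proof.
elim/palg_ind: g => [p||c x y [h ->] [h' ->]].
- by have [q <-] := unop_surj p; exists (pbase K q); rewrite palg_unop_pbase.
- by exists 0; rewrite palg_unop0.
- by exists (c *: h + h'); rewrite palg_unop_linear.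
Qed.

Lemma pcoef_unop p (g : palg K (opquiver G)) :
  pcoef (unop p) (palg_unop g) = pcoef p g.
Proof.
elim/palg_ind: g => [q||c x y Hx Hy].
- by rewrite palg_unop_pbase !pcoef_pbase (inj_eq unop_inj).
- by rewrite palg_unop0 !pcoef0.
- by rewrite palg_unop_linear !pcoefDZ Hx Hy.
Qed.

Lemma plen_unop (p : qpath (opquiver G)) : plen (unop p) = plen p.
Proof. exact: size_rev. Qed.

Lemma toquo_op_presentation : monomial_presentation (toquo_op I).
Proof.
case: toquo_presentation => sI dI [m mI] aI; rewrite /toquo_op.
split=> [a|g gI p pg||p p1].
- by have [g ->] := sI a; have [h ->] := palg_unop_surj g; exists h.
- by rewrite /= /toquo_op palg_unop_pbase; apply: dI gI _ _; rewrite pcoef_unop.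
- by exists m => p mp; rewrite /= /toquo_op palg_unop_pbase; apply: mI; rewrite plen_unop.
- by rewrite /= /toquo_op palg_unop_pbase; apply: aI; rewrite plen_unop.
Qed.

End Quotients.

HB.lock Definition idm (K : fieldType) (G : quiver) (A : pzRingType)
    (rho : {rmorphism palg K G -> A}) (e : vertex G) : A :=
  rho (pbase K (vpath e)).
HB.lock Definition arr (K : fieldType) (G : quiver) (A : pzRingType)
    (rho : {rmorphism palg K G -> A}) (a : arrow G) : A :=
  rho (pbase K (apath a)).
(** [A] is only a ring; the scalars of [K] reach it through [rho]. *)
HB.lock Definition sc (K : fieldType) (G : quiver) (A : pzRingType)
    (rho : {rmorphism palg K G -> A}) (c : K) : A :=
  rho (c *: (1 : palg K G)).

(** * Values of paths in the algebra, and its Jacobson radical *)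

Section PathValues.
Variables (K : fieldType) (G : quiver) (A : pzRingType).
Variable rho : {rmorphism palg K G -> A}.
Hypothesis pres : monomial_presentation rho.

Local Notation idm := (idm rho).
Local Notation arr := (arr rho).
Local Notation sc := (sc rho).

(* The value in A of the path with start v and arrows s; it is 0 when s is not
   a walk from v. *)
Definition mon (v : vertex G) (s : seq (arrow G)) : A :=
  foldl (fun y a => arr a * y) (idm v) s.

Lemma rho_pbaseM p q : rho (pbase K p) * rho (pbase K q) = rho (pbase_opt K (pcomp p q)).
Proof. by rewrite -rmorphM [X in rho X]palg_mulbb. Qed.

Lemma idmM e f : idm e * idm f = if e == f then idm e else 0.
Proof.
rewrite idm.unlock ?arr.unlock rho_pbaseM; case: eqP => [<-|ef]; last by rewrite pcompN ?rmorph0 //= => fe; apply: ef.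
suff -> : pcomp (vpath e) (vpath e) = Some (vpath e) by [].
exact/eqP/pcompP.
Qed.

Lemma idmK e : idm e * idm e = idm e.
Proof. by rewrite idmM eqxx. Qed.

Lemma arr_idm a e : arr a * idm e = if src a == e then arr a else 0.
Proof.
rewrite idm.unlock ?arr.unlock rho_pbaseM; case: eqP => [<-|ef]; last by rewrite pcompN ?rmorph0 //= => fe; apply: ef.
suff -> : pcomp (apath a) (vpath (src a)) = Some (apath a) by [].
exact/eqP/pcompP.
Qed.

Lemma idm_arr a e : idm e * arr a = if tgt a == e then arr a else 0.
Proof.
rewrite idm.unlock ?arr.unlock rho_pbaseM; case: eqP => [<-|ef]; last by rewrite pcompN ?rmorph0 //= => fe; apply: ef.
suff -> : pcomp (vpath (tgt a)) (apath a) = Some (apath a) by [].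
exact/eqP/pcompP.
Qed.

Lemma sum_idm : \sum_e idm e = 1.
Proof. by rewrite idm.unlock -rmorph_sum -(rmorph1 rho). Qed.

Lemma scE c : sc c = rho (c *: (1 : palg K G)).
Proof. by rewrite sc.unlock. Qed.

Lemma rhoZ c g : rho (c *: g) = sc c * rho g.
Proof. by rewrite sc.unlock palg_scaleE rmorphM. Qed.

Lemma rhoDZ c g h : rho (c *: g + h) = sc c * rho g + rho h.
Proof. by rewrite rmorphD /= rhoZ. Qed.

Lemma scC c a : sc c * a = a * sc c.
Proof.
have [g ->] := presS pres a; rewrite sc.unlock -rmorphM -palg_scaleE -rmorphM /=; congr (rho _).
have E (x : palg K G) : x * 1 = x by exact: mulr1.
have := palg_mulDZr c (1 : palg K G) 0 g; rewrite palg_mulg0.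
rewrite (_ : palg_mul g 1 = g); last exact: E.
rewrite [X in palg_mul g X](_ : _ = c *: (1 : palg K G)); last exact: addr0.
by rewrite [X in _ = X](_ : _ = c *: g); last exact: addr0.
Qed.

Lemma sc1 : sc 1 = 1. Proof. by rewrite sc.unlock scale1r rmorph1. Qed.
Lemma sc0 : sc 0 = 0. Proof. by rewrite sc.unlock scale0r rmorph0. Qed.
Lemma scD c d : sc (c + d) = sc c + sc d. Proof. by rewrite sc.unlock scalerDl rmorphD. Qed.
Lemma scN c : sc (- c) = - sc c. Proof. by rewrite sc.unlock scaleNr rmorphN. Qed.
Lemma scM c d : sc (c * d) = sc c * sc d.
Proof. by rewrite (scE d) -rhoZ scE -scalerA. Qed.

Lemma mon_rcons v s a : mon v (rcons s a) = arr a * mon v s.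
Proof. by rewrite /mon foldl_rcons. Qed.

Lemma mon_nil v : mon v [::] = idm v. Proof. by []. Qed.

Lemma walk_end_rcons (v : vertex G) s a : walk_end v (rcons s a) = tgt a.
Proof. by rewrite -cats1 walk_end_cat. Qed.

Lemma idm_mon v s : idm (walk_end v s) * mon v s = mon v s.
Proof.
case/lastP: s => [|s a]; first exact: idmK.
by rewrite mon_rcons walk_end_rcons mulrA idm_arr eqxx.
Qed.

Lemma mon_idm v s : mon v s * idm v = mon v s.
Proof.
elim/last_ind: s => [|s a IH]; first exact: idmK.
by rewrite mon_rcons -mulrA IH.
Qed.

Lemma mon_cat v s1 s2 : mon v (s1 ++ s2) = mon (walk_end v s1) s2 * mon v s1.
Proof.
elim/last_ind: s2 => [|s2 a IH]; first by rewrite cats0 idm_mon.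
by rewrite -rcons_cat !mon_rcons IH mulrA.
Qed.

Lemma mon_cons v a s : mon v (a :: s) = mon (tgt a) s * arr a * idm v.
Proof. by rewrite -cat1s mon_cat mulrA. Qed.

Lemma idm_mon_neq v s e : e != walk_end v s -> idm e * mon v s = 0.
Proof. by move=> /negbTE ne; rewrite -idm_mon mulrA idmM ne mul0r. Qed.

Lemma mon_idm_neq v s e : e != v -> mon v s * idm e = 0.
Proof. by rewrite eq_sym => /negbTE ne; rewrite -mon_idm -mulrA idmM ne mulr0. Qed.

Lemma rho_pbase p : rho (pbase K p) = mon (pstart p) (parrows p).
Proof.
case: p => [[v s] W]; rewrite /pstart /parrows /=.
elim/last_ind: s W => [|s a IH] W.
  by rewrite mon_nil idm.unlock; congr (rho (pbase _ _)); exact: qpath_eq.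
have [W1 Ea] : walk v s /\ src a = walk_end v s.
  have W' : walk v (rcons s a) by exact: W.
  by move: W'; rewrite -cats1 walk_cat => /andP[-> /= /andP[/eqP-> _]].
rewrite mon_rcons -(IH W1) arr.unlock rho_pbaseM.
suff -> : pcomp (apath a) (@QPath G (v, s) W1) = Some (QPath W) by [].
by apply/eqP/pcompP; split=> //; rewrite /parrows /= cats1.
Qed.

Lemma mon_walk v s : mon v s != 0 -> walk v s.
Proof.
elim/last_ind: s => // s a IH; rewrite mon_rcons => nz.
rewrite -cats1 walk_cat /= andbT; apply/andP; split.
  by apply: IH; apply: contraNneq nz => ->; rewrite mulr0.
by apply: contraNT nz => /negbTE E; rewrite -idm_mon mulrA arr_idm E mul0r.
Qed.

Lemma mon_qpath v s : mon v s != 0 -> exists p : qpath G,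
  [/\ pstart p = v, parrows p = s & rho (pbase K p) = mon v s].
Proof. by move=> /mon_walk W; exists (@QPath G (v, s) W); rewrite rho_pbase. Qed.

Lemma mon_catl v s1 s2 : mon v (s1 ++ s2) != 0 -> mon v s1 != 0.
Proof. by rewrite mon_cat; apply: contraNneq => ->; rewrite mulr0. Qed.

Lemma mon_catr v s1 s2 : mon v (s1 ++ s2) != 0 -> mon (walk_end v s1) s2 != 0.
Proof. by rewrite mon_cat; apply: contraNneq => ->; rewrite mul0r. Qed.

Lemma mon_take n v s : mon v s != 0 -> mon v (take n s) != 0.
Proof. by rewrite -{1}(cat_take_drop n s); apply: mon_catl. Qed.

Lemma mon_drop n v s : mon v s != 0 -> mon (walk_end v (take n s)) (drop n s) != 0.
Proof. by rewrite -{1}(cat_take_drop n s); apply: mon_catr. Qed.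

Lemma mon_long : exists m, forall v s, (m <= size s)%N -> mon v s = 0.
Proof.
have [m mI] := presN pres; exists m => v s ms; apply/eqP; apply: contraT => nz.
have [p [_ ps E]] := mon_qpath nz; rewrite -E in nz.
by rewrite mI ?eqxx // /plen ps in nz.
Qed.

Lemma idm_neq0 v : idm v != 0.
Proof. by rewrite ?idm.unlock ?arr.unlock; exact: (presA pres). Qed.

Lemma arr_neq0 a : arr a != 0.
Proof. by rewrite ?idm.unlock ?arr.unlock; exact: (presA pres). Qed.

Lemma mon_arr_neq0 a : mon (src a) [:: a] != 0.
Proof. by rewrite /mon /= arr_idm eqxx arr_neq0. Qed.

Lemma alg_ind (P : A -> Prop) :
    (forall v s, mon v s != 0 -> P (mon v s)) -> P 0 ->
    (forall c x y, P x -> P y -> P (sc c * x + y)) ->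
  forall a, P a.
Proof.
move=> Pm P0 PDZ a; have [g ->] := presS pres a; elim/palg_ind: g => [p||c x y Px Py].
- by rewrite rho_pbase; have [->|] := eqVneq (mon (pstart p) (parrows p)) 0; [|apply: Pm].
- by rewrite rmorph0.
- by rewrite rhoDZ; apply: PDZ.
Qed.

(** The image of the arrow ideal; [jacobsonP] identifies it with the Jacobson radical. *)
Definition in_rad (j : A) : Prop :=
  exists2 g, j = rho g & g \in longer_pred 1.

Lemma in_rad_ind (P : A -> Prop) :
    (forall v s a, P (arr a * mon v s)) -> P 0 ->
    (forall c x y, P x -> P y -> P (sc c * x + y)) ->
  forall j, in_rad j -> P j.
Proof.
move=> Pm P0 PDZ j [g -> /longerP].
move: g; apply: palg_supp_ind => [p||c x y Px Py].
- rewrite rho_pbase /plen; case/lastP: (parrows p) => // s a _.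
  by rewrite mon_rcons.
- by rewrite rmorph0.
- by rewrite rhoDZ; apply: PDZ.
Qed.

Lemma in_radM a j : in_rad j -> in_rad (a * j).
Proof.
have [h ->] := presS pres a; case=> g -> g1; exists (h * g); first by rewrite rmorphM.
by rewrite -[1%N]add0n; apply: longerM => //; exact: longer_all.
Qed.

Lemma in_rad_mon v s : (0 < size s)%N -> in_rad (mon v s).
Proof.
move=> s0; have [->|nz] := eqVneq (mon v s) 0.
  by exists 0; rewrite ?rmorph0 ?longer0.
have [p [pv ps <-]] := mon_qpath nz; exists (pbase K p) => //.
by apply: longer_pbase; rewrite /plen ps.
Qed.

Lemma in_rad_arr a : in_rad (arr a).
Proof. by rewrite arr.unlock; exists (pbase K (apath a)) => //; exact: longer_pbase. Qed.

Lemma in_rad0 : in_rad 0.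
Proof. by exists 0; rewrite ?rmorph0 ?longer0. Qed.

Lemma in_radDZ c x y : in_rad x -> in_rad y -> in_rad (sc c * x + y).
Proof.
move=> [g -> g1] [h -> h1]; exists (c *: g + h); first by rewrite rhoDZ.
exact: longerDZ.
Qed.

(** Modulo the radical the algebra is spanned by the vertices. Through [homog_act], elements act as
    scalars on vectors supported at one vertex, up to the next layer. *)
Lemma alg_dec a : exists (c : vertex G -> K) (j : A),
  a = \sum_e sc (c e) * idm e + j /\ in_rad j.
Proof.
elim/alg_ind: a => [v s _||c x y [d [j [-> Jj]]] [d' [j' [-> Jj']]]].
- case: s => [|a s].
    exists (fun e => (e == v)%:R), 0; split; last exact: in_rad0.
    rewrite (bigD1 v) //= eqxx sc1 mul1r big1 ?addr0 // => e /negbTE ->.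
    by rewrite sc0 mul0r.
  exists (fun=> 0), (mon v (a :: s)); split; last exact: in_rad_mon.
  by rewrite big1 ?add0r // => e _; rewrite sc0 mul0r.
- exists (fun=> 0), 0; split; last exact: in_rad0.
  by rewrite addr0 big1 // => e _; rewrite sc0 mul0r.
exists (fun e => c * d e + d' e), (sc c * j + j'); split; last exact: in_radDZ.
rewrite mulrDr addrACA; congr (_ + _); rewrite mulr_sumr -big_split /=.
by apply: eq_bigr => e _; rewrite scD mulrDl scM mulrA.
Qed.

(** If the coefficients differed, [presI] would send the vertex [e] to 0, against [presA]. So the
    coefficient descends to [A]. *)
Lemma vertex_coef g h e : rho g = rho h -> pcoef (vpath e) g = pcoef (vpath e) h.
Proof.
move=> gh; have := @presI _ _ _ _ pres (g - h).
rewrite rmorphB gh subrr => /(_ erefl (vpath e)) H.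
apply/eqP; rewrite -subr_eq0 -pcoefB; apply: contraT => /H E.
by have := idm_neq0 e; rewrite idm.unlock E eqxx.
Qed.

(** [M] is the kernel of a character to [K]: any [a] outside it, suitably scaled, differs from a
    given [b] by an element of [M]. *)
Lemma maximal_vertex (e : vertex G) (M : {pred A^o}) :
  (forall a, reflect (exists2 g, a = rho g & pcoef (vpath e) g = 0) (a \in M)) ->
  maximal_left_ideal M.
Proof.
move=> MP; have sM : submodule M.
  split; first by apply/MP; exists 0; rewrite ?rmorph0 ?pcoef0.
  move=> a x y /MP[g -> g0] /MP[h -> h0]; have [f ->] := presS pres a.
  apply/MP; exists (f * g + h); first by rewrite rmorphD rmorphM.
  have := pcoefDZ (vpath e) 1 (f * g) h; rewrite scale1r => ->.
  by rewrite pcoef_vpathM g0 h0 mulr0 mulr0 addr0.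
split=> //; split=> // [|P [P0 PD] MP' _].
  move=> /(_ 1 isT) /MP [g]; rewrite -(rmorph1 rho) => /(vertex_coef e) <- /eqP.
  rewrite (_ : pcoef _ _ = 1) ?oner_eq0 //.
  rewrite [LHS](big_morph _ (pcoefD _) (pcoef0 K _)) (bigD1 e) //=.
  rewrite [X in X + _](pcoef_pbase K (vpath e) (vpath e)) eqxx.
  rewrite big1 ?addr0 // => f fe.
  rewrite [LHS](pcoef_pbase K (vpath e) (vpath f)).
  by have [[E]|//] := vpath f =P vpath e; rewrite E eqxx in fe.
have [PM|] := pselect ({subset P <= M}).
  by left=> x; apply/idP/idP => [/PM|/MP'].
move=> /existsNP [a /not_implyP [Pa /negP Ma]]; right=> b; rewrite [RHS]inE; apply/idP => /=.
have [g ga] := presS pres a; have [h hb] := presS pres b.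
have g0 : pcoef (vpath e) g != 0.
  by apply: contraNneq Ma => g0; apply/MP; exists g.
set c := pcoef (vpath e) h / pcoef (vpath e) g.
have -> : b = sc c *: (a : A^o) + (b - sc c * a) by rewrite addrC subrK.
apply: PD => //; apply: MP'; apply/MP; exists (h - c *: g).
  by rewrite rmorphB /= rhoZ ga hb.
by rewrite pcoefB pcoefZ divfK ?subrr.
Qed.

(** [1 - n ^+ k] is a left multiple of [1 - n]. *)
Lemma nil_subr1 (M : {pred A^o}) (n : A) k : submodule M ->
  (1 - n : A) \in M -> n ^+ k = 0 -> (1 : A) \in M.
Proof.
move=> [M0 MD] n1; suff H : (1 - n ^+ k : A) \in M by move=> E; rewrite E subr0 in H.
elim: k => [|k IH]; first by rewrite expr0 subrr.
have -> : 1 - n ^+ k.+1 = n ^+ k *: (1 - n : A^o) + (1 - n ^+ k).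
  by rewrite [_ *: _]mulrBr mulr1 -exprSr [RHS]addrC addrA subrK.
exact: MD.
Qed.

Lemma in_rad_nil j : in_rad j -> exists k, j ^+ k = 0.
Proof.
case=> g -> g1; have [m mI] := presN pres; exists m.
have : g ^+ m \in longer_pred m.
  elim: m {mI} => [|k IH]; first exact: longer_all.
  by rewrite exprS -add1n; apply: longerM.
rewrite -rmorphXn; move: (g ^+ m) => h /longerP; move: h.
apply: palg_supp_ind => [p mp||c x y Px Py]; first exact: mI.
- exact: rmorph0.
- by rewrite rhoDZ Px Py mulr0 addr0.
Qed.

(** Forwards, the maximal ideals attached to the vertices exclude trivial paths. Backwards, if a
    maximal [M] missed [j], then 1 = m + c j with m in [M] and c j nilpotent, so 1 would lie in
    [M]. *)
Lemma jacobsonP j : reflect (in_rad j) (j \in @jacobson A).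
Proof.
apply: (iffP idP) => [|Jj].
  rewrite inE => H; have [g gj] := presS pres j; exists g => //; apply/longerP => p.
  rewrite lt0n; apply: contraNneq => p0.
  pose M : {pred A^o} := [pred a | `[< exists2 g, a = rho g & pcoef (vpath (pstart p)) g = 0 >]].
  have MP a : reflect (exists2 g, a = rho g & pcoef (vpath (pstart p)) g = 0) (a \in M).
    by rewrite inE; apply: asboolP.
  have /MP [h] := H _ (maximal_vertex MP); rewrite gj => /(vertex_coef (pstart p)) <- <-.
  suff -> : p = vpath (pstart p) by [].
  by apply: qpath_eq => //; apply: size0nil.
rewrite inE => M [sM [_ MT max]]; apply: contraT => jM.
have [M0 MD] := sM.
pose P : {pred A^o} := [pred b : A | `[< exists2 m : A, m \in M & exists c : A, b = m + c * j >]].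
have PP b : reflect (exists2 m : A, m \in M & exists c : A, b = m + c * j) (b \in P).
  by rewrite inE; apply: asboolP.
have sP : submodule P.
  split; first by apply/PP; exists 0 => //; exists 0; rewrite mul0r addr0.
  move=> a x y /PP[m Mm [c ->]] /PP[m' Mm' [c' ->]]; apply/PP.
  exists (a *: (m : A^o) + m'); first exact: MD.
  by exists (a * c + c'); rewrite [_ *: (_ + _)]mulrDr mulrDl mulrA addrACA.
have MP : {subset M <= P}.
  by move=> m Mm; apply/PP; exists m => //; exists 0; rewrite mul0r addr0.
have [E|E] := max P sP MP (fun _ _ => isT).
  case/negP: jM; rewrite -E; apply/PP; exists 0 => //; exists 1.
  by rewrite mul1r add0r.
have /PP [m Mm [c e1]] : (1 : A) \in P by rewrite E.
have [k ck] := in_rad_nil (in_radM c Jj).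
case: MT => x _; rewrite -[x]mulr1 -[_ * _]addr0; apply: (MD x) => //.
by apply: (nil_subr1 sM _ ck); rewrite e1 addrK.
Qed.

End PathValues.

(** * Radical series of uniserial modules *)

Section Submodules.
Variables (A : pzRingType) (U : lmodType A) (N : {pred U}).
Hypothesis sN : submodule N.

Lemma submod0 : 0 \in N. Proof. by case: sN. Qed.

Lemma submodZ a x : x \in N -> a *: x \in N.
Proof. by case: sN => N0 ND Nx; rewrite -[_ *: _]addr0; apply: ND. Qed.

Lemma submodD x y : x \in N -> y \in N -> x + y \in N.
Proof. by case: sN => N0 ND Nx Ny; rewrite -[x]scale1r; apply: ND. Qed.

Lemma submodN x : x \in N -> - x \in N.
Proof. by move=> Nx; rewrite -scaleN1r; apply: submodZ. Qed.

Lemma submodB x y : x \in N -> y \in N -> x - y \in N.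
Proof. by move=> Nx /submodN; apply: submodD. Qed.

Lemma submod_sum (J : Type) (r : seq J) (P : pred J) (F : J -> U) :
  (forall i, P i -> F i \in N) -> \sum_(i <- r | P i) F i \in N.
Proof. by move=> NF; elim/big_ind: _ => //; [apply: submod0 | apply: submodD]. Qed.

Lemma submod_congr x y : x - y \in N -> y \in N -> x \in N.
Proof. by move=> xy Ny; rewrite -(subrK y x); apply: submodD. Qed.

End Submodules.

Section Isomorphisms.
Variable A : pzRingType.
Implicit Types U V W : lmodType A.

Lemma submodule_gen_sub U (S : U -> Prop) : submodule (submodule_gen S).
Proof.
split=> [|a x y]; rewrite !inE.
  by move=> N sN _; exact: submod0.
move=> Hx Hy N sN SN; apply: submodD => //; last exact: Hy.
by apply: submodZ => //; exact: Hx.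
Qed.

Lemma submodule_gen_min U (S : U -> Prop) (N : {pred U}) : submodule N ->
  (forall y, S y -> y \in N) -> {subset submodule_gen S <= N}.
Proof. by move=> sN SN x; rewrite inE; apply. Qed.

Lemma submodule_gen_mem U (S : U -> Prop) x : S x -> x \in submodule_gen S.
Proof. by move=> Sx; rewrite inE => N _; apply. Qed.

Lemma module_iso_sym U V : module_iso U V -> module_iso V U.
Proof.
case=> f [g fK gK]; have lg : linear g by exact: (can2_linear fK gK).
pose g' : {linear V -> U} :=
  HB.pack_for {linear V -> U} g (GRing.isLinear.Build A V U *:%R g lg).
by exists g'; exists f.
Qed.

Lemma module_iso_trans U V W : module_iso U V -> module_iso V W -> module_iso U W.
Proof.
case=> f bf [g bg]; exists (g \o f : {linear U -> W}).
exact: bij_comp.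
Qed.

(** Sending a x to a x' is well defined in both directions because the annihilators agree. *)
Lemma cyclic_iso U V (x : U) (x' : V) :
    (forall y : U, exists a : A, y = a *: x) ->
    (forall y : V, exists a : A, y = a *: x') ->
    (forall a : A, a *: x = 0 <-> a *: x' = 0) ->
  module_iso U V.
Proof.
move=> genU genV ann.
pose f (y : U) := projT1 (cid (genU y)) *: x'.
pose g (y : V) := projT1 (cid (genV y)) *: x.
have fE a : f (a *: x) = a *: x'.
  rewrite /f; case: cid => b /= E; apply/eqP; rewrite -subr_eq0 -scalerBl.
  by apply/eqP/ann; rewrite scalerBl -E subrr.
have gE a : g (a *: x') = a *: x.
  rewrite /g; case: cid => b /= E; apply/eqP; rewrite -subr_eq0 -scalerBl.
  by apply/eqP/ann; rewrite scalerBl -E subrr.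
have lf : linear f.
  move=> c y z; have [a ->] := genU y; have [b ->] := genU z.
  by rewrite scalerA -scalerDl !fE scalerDl scalerA.
pose f' : {linear U -> V} :=
  HB.pack_for {linear U -> V} f (GRing.isLinear.Build A U V *:%R f lf).
exists f'; exists g => y.
- by have [a ->] := genU y; rewrite /= fE gE.
- by have [a ->] := genV y; rewrite gE /= fE.
Qed.

End Isomorphisms.

Section RadicalSeries.
Variables (K : fieldType) (G : quiver) (A : pzRingType).
Variable rho : {rmorphism palg K G -> A}.
Hypothesis pres : monomial_presentation rho.

Local Notation idm := (idm rho).
Local Notation arr := (arr rho).
Local Notation sc := (sc rho).
Local Notation mon := (mon rho).

Section OneModule.
Variable U : lmodType A.
Local Notation R := (radical_power U).

Lemma scZK c (y : U) : c != 0 -> sc c^-1 *: (sc c *: y) = y.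
Proof. by move=> c0; rewrite scalerA -scM mulVf // sc1 scale1r. Qed.

Lemma sc_comm c a (y : U) : a *: (sc c *: y) = sc c *: (a *: y).
Proof. by rewrite !scalerA scC. Qed.

Lemma sc_sub (N : {pred U}) c y : submodule N -> c != 0 -> sc c *: y \in N -> y \in N.
Proof. by move=> sN c0 Ny; rewrite -(scZK y c0); apply: submodZ. Qed.

Lemma sum_idmZ (y : U) : y = \sum_e idm e *: y.
Proof. by rewrite -scaler_suml sum_idm scale1r. Qed.

Lemma rad_sub n : submodule (R n).
Proof. by case: n => [|n]; [split | exact: submodule_gen_sub]. Qed.

Lemma rad_in_rad j n y : in_rad rho j -> y \in R n -> j *: y \in R n.+1.
Proof.
move=> Jj Ry; apply: submodule_gen_mem; exists j, y; split=> //.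
exact/(jacobsonP pres).
Qed.

Lemma rad_arr a n y : y \in R n -> arr a *: y \in R n.+1.
Proof. by apply: rad_in_rad; apply: in_rad_arr. Qed.

(** The radical is spanned by products of an arrow with a path. The path acts first and keeps y in
    [R n], so only arrows need checking. *)
Lemma rad_ind (N : {pred U}) n : submodule N ->
  (forall a y, y \in R n -> arr a *: y \in N) -> {subset R n.+1 <= N}.
Proof.
move=> sN NR; apply: submodule_gen_min => // _ [j [y [/(jacobsonP pres) Jj Ry ->]]].
elim/in_rad_ind: Jj => [v s a||c j1 j2 H1 H2].
- by rewrite -scalerA; apply: NR; apply: submodZ (rad_sub n) _ _ Ry.
- by rewrite scale0r; apply: submod0.
- by rewrite scalerDl -scalerA; apply: submodD => //; apply: submodZ.
Qed.

Lemma rad_decr n : {subset R n.+1 <= R n}.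
Proof. by apply: rad_ind (rad_sub n) _ => a y; apply: submodZ (rad_sub n) _ _. Qed.

Lemma rad_leq m n : (m <= n)%N -> {subset R n <= R m}.
Proof.
move=> /subnK <-; elim: (n - m)%N => [//|k IH] y.
by rewrite addSn => /rad_decr /IH.
Qed.

Lemma rad_mon v s n y : y \in R n -> mon v s *: y \in R (n + size s).
Proof.
move=> Ry; elim/last_ind: s => [|s a IH].
  by rewrite addn0; apply: submodZ (rad_sub n) _ _ Ry.
by rewrite mon_rcons -scalerA size_rcons addnS; apply: rad_arr.
Qed.

Definition paths_kill k := forall v s (y : U), (k <= size s)%N -> mon v s *: y = 0.

(** [N k] is the submodule killed by paths of length at least k; arrows map [N k.+1] into [N k],
    which drives the induction on n. *)
Lemma rad_kill n k v s y : paths_kill (n + k) -> y \in R n -> (k <= size s)%N ->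
  mon v s *: y = 0.
Proof.
pose N k : {pred U} := [pred y | `[< forall v s, (k <= size s)%N -> mon v s *: y = 0 >]].
have NP i z : reflect (forall v s, (i <= size s)%N -> mon v s *: z = 0) (z \in N i).
  by rewrite inE; apply: asboolP.
have sN i : submodule (N i).
  split=> [|a x z /NP Hx /NP Hz]; apply/NP => w r ir; first by rewrite scaler0.
  rewrite scalerDr Hz // addr0 scalerA; elim/(alg_ind pres): a => [w' r' _||c a b Ha Hb].
  - have [ww'|nww'] := eqVneq w (walk_end w' r').
      by rewrite ww' -mon_cat Hx // size_cat (leq_trans ir) ?leq_addl.
    by rewrite -mon_idm -[X in X *: _]mulrA idm_mon_neq // mulr0 scale0r.
  - by rewrite mulr0 scale0r.
  - by rewrite mulrDr scalerDl Hb addr0 mulrA -(scC pres) -mulrA -scalerA Ha scaler0.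
move=> kill Ry ks; suff /NP : y \in N k by apply.
elim: n k {ks} kill y Ry => [|n IH] k kill y Ry.
  by apply/NP => w r; apply: kill.
apply: rad_ind Ry => // a z Rz.
have /NP Nz : z \in N k.+1 by apply: IH => //; rewrite addnS -addSn.
apply/NP => w r kr; rewrite scalerA.
have [E|ne] := eqVneq (tgt a) w.
  have := Nz (src a) (a :: r) kr.
  by rewrite mon_cons -mulrA arr_idm eqxx E.
by rewrite -mon_idm -[X in X *: _]mulrA idm_arr (negbTE ne) mulr0 scale0r.
Qed.

Lemma rad_zero n y : paths_kill n -> y \in R n -> y = 0.
Proof.
move=> kill Ry; rewrite (sum_idmZ y) big1 // => e _.
by apply: (@rad_kill n 0 e [::] y); rewrite ?addn0.
Qed.

Lemma homog_act (c : vertex G -> K) j n e y :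
    in_rad rho j -> y \in R n -> idm e *: y = y ->
  (\sum_f sc (c f) * idm f + j) *: y - sc (c e) *: y \in R n.+1.
Proof.
move=> Jj Ry ey; rewrite scalerDl scaler_suml (bigD1 e) //= big1 => [|f fe].
  by rewrite addr0 -scalerA ey addrAC subrr add0r; apply: rad_in_rad.
by rewrite -ey scalerA -mulrA idmM (negbTE fe) mulr0 scale0r.
Qed.

Lemma homog_act_ex a n e y : y \in R n -> idm e *: y = y ->
  exists c, a *: y - sc c *: y \in R n.+1.
Proof.
move=> Ry ey; have [c [j [-> Jj]]] := alg_dec pres a.
by exists (c e); apply: homog_act.
Qed.

(** Modulo the next layer every ring element acts on x as a scalar, so the line through x plus that
    layer is stable. *)
Lemma line_sub n e x (N : {pred U}) : x \in R n -> idm e *: x = x ->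
    (forall y, reflect (exists c, y - sc c *: x \in R n.+1) (y \in N)) ->
  submodule N.
Proof.
move=> Rx ex NP; split; first by apply/NP; exists 0; rewrite sc0 scale0r subr0; apply: submod0 (rad_sub _).
move=> a y z /NP[c Hy] /NP[d Hz]; have [b Hb] := homog_act_ex a Rx ex.
apply/NP; exists (c * b + d).
have -> : a *: y + z - sc (c * b + d) *: x =
    a *: (y - sc c *: x) + sc c *: (a *: x - sc b *: x) + (z - sc d *: x).
  rewrite !scalerBr (sc_comm c) scD scM scalerDl -scalerA.
  by rewrite [X in _ = X + _]addrA subrK addrACA -opprD.
have sR := rad_sub n.+1.
by apply: submodD Hz => //; apply: submodD; do ?[apply: submodZ].
Qed.

Hypothesis uni : uniserial U.

(** The layers of a uniserial module have dimension at most 1: for w and x each supported at one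
    vertex, their lines plus the next layer are submodules, hence comparable. *)
Lemma chain_step n e x z : x \in R n -> x \notin R n.+1 -> idm e *: x = x ->
  z \in R n -> exists c, z - sc c *: x \in R n.+1.
Proof.
move=> Rx Rx' ex; have sR := rad_sub n.+1.
have homo f w : w \in R n -> idm f *: w = w -> exists c, w - sc c *: x \in R n.+1.
  move=> Rw fw.
  pose L (y : U) : {pred U} := [pred w | `[< exists c, w - sc c *: y \in R n.+1 >]].
  have LP y w' : reflect (exists c, w' - sc c *: y \in R n.+1) (w' \in L y).
    by rewrite inE; apply: asboolP.
  have LL y : y \in L y by apply/LP; exists 1; rewrite sc1 scale1r subrr; apply: submod0.
  have [sub|sub] := uni.2 _ _ (line_sub Rw fw (LP w)) (line_sub Rx ex (LP x)).
    by apply/LP; apply: sub; exact: LL.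
  (* The reverse inclusion gives x = c w modulo the next layer, and c is invertible since x is not
     in that layer. *)
  have /LP [c Hc] := sub _ (LL x).
  have c0 : c != 0.
    by apply: contraNneq Rx' => c0; rewrite c0 sc0 scale0r subr0 in Hc.
  exists c^-1; rewrite -[w in w - _](scZK w c0) -scalerBr; apply: submodZ => //.
  by rewrite -opprB; apply: submodN.
move=> Rz; have H f : exists c, idm f *: z - sc c *: x \in R n.+1.
  apply: (homo f); first by apply: submodZ (rad_sub n) _ _ Rz.
  by rewrite scalerA idmK.
have [c Hc] := choice H; exists (\sum_f c f).
have -> : sc (\sum_f c f) = \sum_f sc (c f) by exact: (big_morph _ (scD rho) (sc0 rho)).
by rewrite scaler_suml {1}(sum_idmZ z) -sumrB; apply: submod_sum => // f _.
Qed.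

End OneModule.

(* x generates U as a uniserial module with mast the path from v along s. *)
Record strand (U : lmodType A) (v : vertex G) (s : seq (arrow G)) (x : U) : Prop := Strand {
  strand_top : idm v *: x = x;
  strand_span : forall y, exists c : nat -> K,
    y = \sum_(t < (size s).+1) sc (c t) *: (mon v (take t s) *: x);
  strand_end : mon v s *: x != 0;
  strand_kill : paths_kill U (size s).+1
}.

Section StrandExistence.
Variable U : lmodType A.
Hypothesis uni : uniserial U.
Local Notation R := (radical_power U).

Lemma mon_take_drop v s t (x : U) :
  mon (walk_end v (take t s)) (drop t s) *: (mon v (take t s) *: x) = mon v s *: x.
Proof. by rewrite scalerA -mon_cat cat_take_drop. Qed.

Lemma take_homog v s t (x : U) :
  idm (walk_end v (take t s)) *: (mon v (take t s) *: x) = mon v (take t s) *: x.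
Proof. by rewrite scalerA idm_mon. Qed.

Lemma take_rad v s t (x : U) : (t <= size s)%N -> mon v (take t s) *: x \in R t.
Proof.
by move=> ts; have := @rad_mon U v (take t s) 0 x isT; rewrite add0n size_takel.
Qed.

(** One layer too deep, the segment completed to [s] would land in a zero radical power. *)
Lemma take_radN v s t (x : U) : mon v s *: x != 0 -> paths_kill U (size s).+1 ->
  (t <= size s)%N -> mon v (take t s) *: x \notin R t.+1.
Proof.
move=> nz kill ts; apply: contraNN nz => Rx; rewrite -(mon_take_drop v s t).
apply/eqP; apply: (rad_kill (k := (size s - t)%N)) Rx _; last by rewrite size_drop.
by rewrite addSn subnKC.
Qed.

(** Initial segments of [s] applied to x give one vector of each exact depth, so [chain_step]
    expands y layer by layer down to zero. *)
Lemma strand_of v s (x : U) : idm v *: x = x -> mon v s *: x != 0 ->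
  paths_kill U (size s).+1 -> strand v s x.
Proof.
move=> vx nz kill; split=> // y.
have H k : (k <= (size s).+1)%N -> exists c : nat -> K,
    y - \sum_(t < k) sc (c t) *: (mon v (take t s) *: x) \in R k.
  elim: k => [|k IH] ks; first by exists (fun=> 0).
  have [c Hc] := IH (ltnW ks).
  have [d Hd] := chain_step uni (take_rad v x ks) (take_radN nz kill ks)
                   (take_homog v s k x) Hc.
  exists (fun t => if t == k then d else c t).
  rewrite big_ord_recr /= eqxx opprD addrA.
  rewrite (eq_bigr (fun t : 'I_k => sc (c t) *: (mon v (take t s) *: x))) // => t _.
  by rewrite ltn_eqF.
have [c Hc] := H _ (leqnn _); exists c; apply/eqP; rewrite -subr_eq0; apply/eqP.
exact: rad_zero Hc.
Qed.

(** A longest path that does not kill [U] serves as mast; lengths are bounded by [mon_long]. *)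
Lemma strand_exists (y : U) : y != 0 -> exists v s (x : U), strand v s x.
Proof.
move=> y0; have [m mI] := mon_long pres.
pose P k := `[< exists v s (z : U), size s = k /\ mon v s *: z != 0 >].
have exP : exists k, P k.
  exists 0; apply/asboolP.
  have [e He] : exists e, idm e *: y != 0.
    apply: contra_notP (elimN eqP y0) => H; rewrite (sum_idmZ y) big1 // => e _.
    by apply/eqP; apply: contraT => /negP ne; case: H; exists e; apply/negP.
  by exists e, [::], y.
have ubP k : P k -> (k <= m)%N.
  move=> /asboolP[v [s [z [<- nz]]]]; rewrite leqNgt; apply: contraNN nz => /ltnW ms.
  by rewrite mI ?scale0r.
have [l /asboolP [v [s [z [sl nz]]]] max] := ex_maxnP exP ubP.
exists v, s, (idm v *: z); apply: strand_of.
- by rewrite scalerA idmK.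
- by rewrite scalerA mon_idm.
move=> w r u sr; apply/eqP; apply: contraT => nz'.
have /max : P (size r) by apply/asboolP; exists w, r, u.
by rewrite -sl leqNgt sr.
Qed.

End StrandExistence.

Section StrandTheory.
Variables (U : lmodType A) (v : vertex G) (s : seq (arrow G)) (x : U).
Hypothesis st : strand v s x.
Local Notation R := (radical_power U).
Local Notation xs t := (mon v (take t s) *: x).

Lemma strand_radN t : (t <= size s)%N -> xs t \notin R t.+1.
Proof. by apply: take_radN; [apply: strand_end st | apply: strand_kill st]. Qed.

Lemma strand_rad_zero n y : (size s < n)%N -> y \in R n -> y = 0.
Proof.
by move=> sn Ry; apply: (rad_zero (strand_kill st)); apply: (rad_leq sn) Ry.
Qed.

(** Completing the t-th initial segment to [s] kills every later term, so the coefficients vanish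
    one after another from t = 0 upwards. *)
Lemma strand_free n (c : nat -> K) :
  \sum_(t < (size s).+1) sc (c t) *: xs t \in R n ->
  forall t, (t < n)%N -> (t <= size s)%N -> c t = 0.
Proof.
move=> Rc; elim/ltn_ind => t IH tn ts.
have ts' : (t < (size s).+1)%N by [].
have E : mon (walk_end v (take t s)) (drop t s) *:
    (\sum_(i < (size s).+1) sc (c i) *: xs i) = sc (c t) *: (mon v s *: x).
  rewrite scaler_sumr (bigD1 (Ordinal ts')) //= big1 => [|i it].
    by rewrite addr0 (sc_comm (c t)) mon_take_drop.
  rewrite (sc_comm (c i)); have [it'|ti|it'] := ltngtP i t.
  - by rewrite IH ?sc0 ?scale0r // ?(ltn_trans it') // -ltnS ltn_ord.
  - rewrite [X in _ *: X](_ : _ = 0) ?scaler0 //.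
    apply: (@strand_rad_zero (i + size (drop t s))).
      by rewrite size_drop; lia.
    by apply: rad_mon; apply: take_rad; rewrite -ltnS ltn_ord.
  - by case/eqP: it; apply: val_inj.
have E0 : sc (c t) *: (mon v s *: x) = 0.
  rewrite -E; apply: (@strand_rad_zero (n + size (drop t s))); last exact: rad_mon.
  by rewrite size_drop; lia.
apply/eqP; apply: contraT => ct0; case/eqP: (strand_end st).
by rewrite -(scZK (mon v s *: x) ct0) E0 scaler0.
Qed.

Lemma strand_coef_eq0 (c : nat -> K) :
  \sum_(t < (size s).+1) sc (c t) *: xs t = 0 -> forall t, (t <= size s)%N -> c t = 0.
Proof.
move=> E t ts; apply: (@strand_free (size s).+1 c) => //.
by rewrite E; apply: submod0 (rad_sub _ _).
Qed.

(** The counterpart of [chain_step] deduced from the basis alone; [strand_uniserial] derives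
    uniseriality from it. *)
Lemma strand_step n y : (n <= size s)%N -> y \in R n -> exists c, y - sc c *: xs n \in R n.+1.
Proof.
move=> ns Ry; have [c E] := strand_span st y; exists (c n).
have ns' : (n < (size s).+1)%N by [].
have c0 t : (t < n)%N -> c t = 0.
  by move=> tn; apply: (@strand_free n c) => //; rewrite -?E // ltnW // (leq_trans tn).
rewrite E (bigD1 (Ordinal ns')) // addrAC subrr add0r.
apply: (submod_sum (rad_sub _ _)) => i /andP[_ /negP ni].
have [ni'|ni'|ni'] := ltngtP i n; first by rewrite c0 // sc0 scale0r; apply: submod0 (rad_sub _ _).
  apply: submodZ (rad_sub _ _) _ _ _; apply: (rad_leq ni'); apply: take_rad.
  by rewrite -ltnS ltn_ord.
by case: ni; apply/eqP/val_inj.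
Qed.

Lemma strand_level (y : U) : y != 0 ->
  exists n, [/\ (n <= size s)%N, y \in R n & y \notin R n.+1].
Proof.
move=> y0; have exP : exists n, y \notin R n.+1.
  by exists (size s); apply: contraNN y0 => /strand_rad_zero ->.
have [n yn min] := ex_minnP exP; exists n; split=> //.
- by apply: min; apply: contraNN y0 => /strand_rad_zero ->.
- by case: n {yn} min => // n min; apply: contraT => /min; rewrite ltnn.
Qed.

Lemma strand_take t : (t < size s)%N ->
  exists a, arr a *: xs t = xs t.+1 /\ nth a s t = a.
Proof.
case: s => // a0 s' ts; exists (nth a0 (a0 :: s') t); split; last exact: set_nth_default.
by rewrite (take_nth a0 ts) mon_rcons scalerA.
Qed.

(** A vector of exact depth n generates [R n]: the next arrow of [s] moves it to exact depth n + 1,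
    which by induction supplies [R n.+1]. *)
Lemma strand_gen (N : {pred U}) n y : submodule N -> y \in N ->
  y \in R n -> y \notin R n.+1 -> {subset R n <= N}.
Proof.
move=> sN; have [k] := ubnP ((size s).+1 - n); elim: k => // k IH in n y *.
move=> nk Ny Ry Ry' z Rz.
have [sn|ns] := ltnP (size s) n; first by rewrite (strand_rad_zero sn Rz); apply: submod0.
have [c Hc] := strand_step ns Ry.
have c0 : c != 0 by apply: contraNneq Ry' => c0; rewrite c0 sc0 scale0r subr0 in Hc.
have RN : {subset R n.+1 <= N}.
  have [ns'|sn] := ltnP n (size s); last first.
    by move=> w Rw; rewrite (strand_rad_zero _ Rw) //; apply: submod0.
  have [a [Ea _]] := strand_take ns'.
  apply: (IH n.+1 (arr a *: y)).
  - by rewrite -ltnS (leq_trans _ nk) // ltnS ltn_sub2l // ltnS ltnW.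
  - exact: submodZ.
  - exact: rad_arr.
  have := strand_radN ns'; apply: contraNN => Ray.
  apply: (sc_sub (rad_sub _ _) c0); rewrite -Ea -sc_comm.
  apply: (submod_congr (rad_sub _ _)) Ray; rewrite -scalerBr.
  by apply: rad_arr; rewrite -opprB; apply: submodN (rad_sub _ _) _ _.
have xN : xs n \in N.
  apply: (sc_sub sN c0); apply: (submod_congr sN) Ny.
  by rewrite -opprB; apply: submodN => //; apply: RN.
have [d Hd] := strand_step ns Rz.
by apply: (submod_congr sN (RN _ Hd)); apply: submodZ.
Qed.

Lemma strand_cyclic (y : U) : exists a : A, y = a *: x.
Proof.
have [c ->] := strand_span st y; exists (\sum_(t < (size s).+1) sc (c t) * mon v (take t s)).
by rewrite scaler_suml; apply: eq_bigr => t _; rewrite scalerA.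
Qed.

Lemma strand_uniserial : uniserial U.
Proof.
split.
  exists [:: x] => y; rewrite [LHS]inE; apply/esym/asboolP => N sN Nx;
  have [a ->] := strand_cyclic y.
  by apply: submodZ => //; apply: Nx; rewrite mem_head.
move=> N M sN sM; have [|] := pselect ({subset N <= M}); first by left.
move=> /existsNP [y /not_implyP [Ny /negP My]]; right=> z Mz.
have y0 : y != 0 by apply: contraNneq My => ->; apply: submod0.
have [->|z0] := eqVneq z 0; first exact: submod0.
have [n [_ Ry Ry']] := strand_level y0; have [m [_ Rz Rz']] := strand_level z0.
have [mn|nm] := leqP m n.
  by case/negP: My; apply: (strand_gen sM Mz Rz Rz'); apply: (rad_leq mn).
by apply: (strand_gen sN Ny Ry Ry'); apply: (rad_leq (ltnW nm)).
Qed.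

Lemma strand_maximal n : (n <= size s)%N -> maximal_in (R n) (R n.+1).
Proof.
move=> ns; split=> [||P sP PR RP].
- exact: rad_decr.
- by move=> /(_ _ (take_rad v x ns)) H; have := strand_radN ns; rewrite H.
have [PR'|] := pselect ({subset P <= R n.+1}).
  by left=> y; apply/idP/idP; [apply: PR' | apply: PR].
move=> /existsNP [y /not_implyP [Py /negP Ry]]; right=> z; apply/idP/idP; first exact: RP.
exact: (strand_gen sP Py (RP _ Py) Ry).
Qed.

Lemma strand_length : composition_length U (size s).+1.
Proof.
exists R; split=> // [y|i _|i]; last by rewrite ltnS; exact: strand_maximal.
- rewrite [RHS]inE; apply/idP/eqP => [/strand_rad_zero ->|->] //.
  exact: submod0 (rad_sub _ _).
- exact: rad_sub.
Qed.

(** Every term of a composition series is comparable with the radical power of the same index, and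
    maximality on both sides forces equality. *)
Lemma strand_length_unique n : composition_length U n -> n = (size s).+1.
Proof.
case=> M [M0 Mn sM maxM].
have ME i : (i <= n)%N -> (i <= (size s).+1)%N -> M i =i R i.
  elim: i => [//|i IH] ni is'; have {}IH := IH (ltnW ni) (ltnW is').
  have [MM nMM mM] := maxM i ni; have [RR nRR mR] := strand_maximal is'.
  have sub1 : {subset M i.+1 <= R i} by move=> y /MM; rewrite IH.
  have sub2 : {subset R i.+1 <= M i} by move=> y /RR; rewrite IH.
  have [MR|RM] := strand_uniserial.2 _ _ (sM _ ni) (rad_sub U i.+1).
    have [E|E] := mM _ (rad_sub U i.+1) MR sub2; first by move=> y; rewrite E.
    by case: nRR => y Ry; rewrite E IH.
  have [E|E] := mR _ (sM _ ni) RM sub1; first by [].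
  by case: nMM => y My; rewrite E -IH.
have [sn|ns|] := ltngtP n (size s).+1; last by [].
- have := take_rad v x (sn : (n <= size s)%N) => Rn.
  have := strand_radN (sn : (n <= size s)%N); rewrite -(ME n) // 1?ltnW // in Rn.
  move: Rn; rewrite Mn => /eqP ->; rewrite submod0 //; exact: rad_sub.
have [_ nMM _] := maxM _ ns; case: nMM => y; rewrite ME // ?(ltnW ns) // => Ry.
by rewrite (strand_rad_zero _ Ry) //; apply: submod0 (sM _ ns).
Qed.

End StrandTheory.

(** The path found by [strand_exists] may differ from [p], but the composition length fixes its
    length. *)
Lemma mast_strand (U : lmodType A) (p : qpath G) : uniserial U -> mast_of rho p U ->
  paths_kill U (plen p).+1 /\ exists y : U, mon (pstart p) (parrows p) *: y != 0.
Proof.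
move=> uni [len [y]]; rewrite rho_pbase => nz; split; last by exists y.
have y0 : y != 0 by apply: contraNneq nz => ->; rewrite scaler0.
have [v [s [x st]]] := strand_exists uni y0.
rewrite (strand_length_unique st len); exact: strand_kill st.
Qed.

(** A vector not killed by [p] is a multiple of x modulo the radical, and [p] kills the radical
    part. So p x is nonzero, which also fixes the vertex of x. *)
Lemma top_strand (U : lmodType A) (p : qpath G) (x : U) :
  uniserial U -> mast_of rho p U -> top_element rho x ->
  strand (pstart p) (parrows p) x.
Proof.
move=> uni mU [Rx [e ex]]; have [kill [y nz]] := mast_strand uni mU.
have {}ex : idm e *: x = x by rewrite idm.unlock -ex.
have [c Hc] := chain_step uni (isT : x \in radical_power U 0) Rx ex (isT : y \in radical_power U 0).
have nzx : mon (pstart p) (parrows p) *: x != 0.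
  apply: contraNneq nz => px0; rewrite -(subrK (sc c *: x) y) scalerDr sc_comm px0 scaler0 addr0.
  by apply/eqP; apply: (rad_kill (n := 1) (k := plen p)) Hc _; rewrite ?leqnn.
apply: strand_of => //; have [<- //|ne] := eqVneq e (pstart p).
by case/eqP: nzx; rewrite -ex scalerA mon_idm_neq // scale0r.
Qed.

End RadicalSeries.

(** * Straightening the top element *)

(* For nz the predicate of nonzero paths: s is a path from v, u a proper initial
   segment of s, and the arrow a leads from the end of u to the end of s. *)
Definition rigid (G : quiver) (nz : vertex G -> seq (arrow G) -> bool) : Prop :=
  forall v s u a, prefix u s -> (size u < size s)%N ->
    nz v s -> nz v (rcons u a) -> tgt a = walk_end v s ->
  prefix (rcons u a) s \/ suffix (rcons u a) s.

Lemma prefix_takeE (T : eqType) (u s : seq T) : prefix u s -> u = take (size u) s.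
Proof. by rewrite prefixE => /eqP. Qed.

Lemma prefix_nested (T : eqType) (x y z : seq T) :
  prefix x z -> prefix y z -> (size x <= size y)%N -> prefix x y.
Proof.
by move=> xz yz xy; rewrite (prefix_takeE xz) (prefix_takeE yz) -(take_takel _ xy) prefix_take.
Qed.

Section Straightening.
Variables (K : fieldType) (G : quiver) (A : pzRingType).
Variable rho : {rmorphism palg K G -> A}.
Hypothesis pres : monomial_presentation rho.

Local Notation idm := (idm rho).
Local Notation arr := (arr rho).
Local Notation sc := (sc rho).
Local Notation mon := (mon rho).

Definition taut (U : lmodType A) (v : vertex G) (s : seq (arrow G)) (x : U) : Prop :=
  forall t a, (t <= size s)%N -> ~~ prefix (rcons (take t s) a) s ->
    arr a *: (mon v (take t s) *: x) = 0.

(** The arrow that leaves the mast gains n extra layers, and later arrows keep the gain. *)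
Lemma off_path (U : lmodType A) v s (x : U) n r :
    (forall t a, (t <= size s)%N -> ~~ prefix (rcons (take t s) a) s ->
       arr a *: (mon v (take t s) *: x) \in radical_power U (t.+1 + n)) ->
  ~~ prefix r s -> mon v r *: x \in radical_power U (size r + n).
Proof.
move=> H; elim/last_ind: r => [|r a IH]; first by rewrite prefix0s.
rewrite mon_rcons -scalerA size_rcons => nra.
have [rs|nrs] := boolP (prefix r s); last by rewrite addSn; apply: (rad_arr pres); apply: IH.
have rE := prefix_takeE rs; rewrite {1}rE; apply: H; rewrite -?rE //.
exact: size_prefix.
Qed.


(* The detour by a leaving the mast after t arrows can be realigned by a closed
   initial segment of length n exactly when it spells out take (t + 1 + n) s. *)
Definition realigns (s : seq (arrow G)) n t a :=
  ((t.+1 + n)%N <= size s)%N && (take (t.+1 + n) s == take n s ++ rcons (take t s) a).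

(** For t < t' the t + 1 arrows after the closed segment can be read off [take t' s], so the shorter
    detour would follow the mast. *)
Lemma realigns_inj (s : seq (arrow G)) n t a t' a' : realigns s n t a -> realigns s n t' a' ->
  ~~ prefix (rcons (take t s) a) s -> ~~ prefix (rcons (take t' s) a') s ->
  t = t' /\ a = a'.
Proof.
wlog tt' : t a t' a' / (t <= t')%N => [W|].
  have [tt'|/ltnW t't] := leqP t t'; first exact: W.
  by move=> H H' d d'; have [-> ->] := W _ _ _ _ t't H' H d' d.
move=> /andP[ts /eqP E] /andP[ts' /eqP E'] d d'.
have [lt|ge|eq] := ltngtP t t'; last 2 first.
- by move: tt'; rewrite leqNgt ge.
- subst t'; split=> //; move: E; rewrite E' => /(congr1 (last a)).
  by rewrite !last_cat !last_rcons.
have ns : (n <= size s)%N := leq_trans (leq_addl _ _) ts.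
have ts2 : (t' <= size s)%N := leq_trans (leqnSn _) (leq_trans (leq_addr _ _) ts').
case/negP: d; have <- : take t.+1 s = rcons (take t s) a; last exact: prefix_take.
have := congr1 (take (t.+1 + n)) E'; rewrite take_takel; last by rewrite leq_add2r ltnS ltnW.
rewrite E take_cat size_takel // ltnNge leq_addl /= addnK => /(congr1 (drop n)).
rewrite !drop_size_cat ?size_takel // => ->.
by rewrite -cats1 takel_cat ?size_takel // take_takel.
Qed.

Section Straighten.
Hypothesis Hrigid : rigid (fun v s => mon v s != 0).
Variables (U : lmodType A) (v : vertex G) (s : seq (arrow G)).
Local Notation R := (radical_power U).
Local Notation xs x t := (mon v (take t s) *: x).
Local Notation detours_in n x := (forall t a, (t <= size s)%N ->
  ~~ prefix (rcons (take t s) a) s -> arr a *: xs x t \in R (t.+1 + n)).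

(** This is where rigidity enters. Landing exactly in layer t + 1 + n forces [a] to end where the
    mast stands after that many arrows, so rigidity applies to this initial segment of [s]; the
    prefix case is no detour. *)
Lemma detour_realigns n (x : U) t a : strand rho v s x -> (t <= size s)%N ->
    ~~ prefix (rcons (take t s) a) s -> arr a *: xs x t \in R (t.+1 + n) ->
    arr a *: xs x t \notin R (t.+1 + n).+1 ->
  realigns s n t a.
Proof.
move=> st ts nd Ra Ra'; set m := (t.+1 + n)%N in Ra Ra'.
have sR := @rad_sub A U.
have [ms|sm] := leqP m (size s); last first.
  by rewrite (strand_rad_zero pres st sm Ra) submod0 in Ra'.
have [c Hc] := strand_step pres st ms Ra.
have c0 : c != 0.
  by apply: contraNneq Ra' => c0; rewrite c0 sc0 scale0r subr0 in Hc.
have ta : tgt a = walk_end v (take m s).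
  apply/eqP; apply: contraT => ne; have := strand_radN pres st ms; case/negP.
  apply: (sc_sub (rho := rho) (sR _) c0); rewrite -[X in X \in _]opprK; apply: submodN (sR _) _ _.
  have := submodZ (sR m.+1) (idm (walk_end v (take m s))) Hc.
  rewrite scalerBr scalerA idm_arr (negbTE ne) scale0r sub0r (sc_comm pres).
  by rewrite take_homog.
have nza : mon v (rcons (take t s) a) != 0.
  rewrite mon_rcons; apply: contraNneq Ra' => E; rewrite scalerA E scale0r.
  exact: submod0 (sR _).
have nzs : mon v (take m s) != 0.
  apply: mon_take; apply: contraNneq (strand_end st) => ->.
  by rewrite scale0r.
have ptm : prefix (take t s) (take m s).
  by rewrite -(@take_takel _ t m s) ?prefix_take // /m; lia.
have := Hrigid ptm _ nzs nza ta; rewrite !size_takel // => /(_ _) [|pre|suf].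
- by rewrite /m; lia.
- by case/negP: nd; apply: prefix_trans pre _; apply: prefix_take.
rewrite /realigns -/m ms /=; move/suffixP: suf => [w E]; rewrite E; apply/eqP.
congr (_ ++ _); have sw : size w = n.
  have := congr1 size E; rewrite size_cat size_rcons !size_takel // /m; lia.
have := congr1 (take n) E; rewrite take_size_cat // => <-.
by rewrite take_takel // /m; lia.
Qed.

(* If some detour realigns along the closed segment w of length n, it is the only
   one, and subtracting a multiple of wx from x pushes it one radical layer down. *)
Lemma straighten_step n (x : U) : strand rho v s x -> detours_in n x ->
  exists2 x', strand rho v s x' & detours_in n.+1 x'.
Proof.
move=> st P; have sR := @rad_sub A U.
have [H|] := pselect (exists t a, [/\ (t <= size s)%N,
    ~~ prefix (rcons (take t s) a) s & realigns s n t a]); last first.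
  move=> H; exists x => // t a ts nd; rewrite addnS.
  apply: contraT => Ra'; case: H; exists t, a; split=> //.
  exact: detour_realigns (P _ _ ts nd) Ra'.
case: H => t0 [a0 [ts0 nd0 re0]]; have /andP[ms0 /eqP E0] := re0.
have ns : (n <= size s)%N by lia.
(* Realigning along the empty segment would mean following the mast. *)
have n0 : (0 < n)%N.
  rewrite lt0n; apply: contraNneq nd0 => n0; move: E0; rewrite n0 take0 addn0 cat0s => <-.
  exact: prefix_take.
have [c Hc] := strand_step pres st ms0 (P _ _ ts0 nd0).
set w := take n s in E0 *.
have nzw : mon (walk_end v w) (rcons (take t0 s) a0) != 0.
  apply: mon_catr; rewrite -E0; apply: mon_take.
  by apply: contraNneq (strand_end st) => ->; rewrite scale0r.
have [c0|c0] := eqVneq c 0.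
  exists x => // t a ts nd; rewrite addnS; apply: contraT => Ra'.
  have re := detour_realigns st ts nd (P _ _ ts nd) Ra'.
  have [E Ea] := realigns_inj re re0 nd nd0; subst t a.
  by move: Ra'; rewrite c0 sc0 scale0r subr0 in Hc; rewrite Hc.
have nza : mon v (rcons (take t0 s) a0) != 0.
  have Rm := strand_radN pres st ms0.
  rewrite mon_rcons; apply: contraNneq Rm => E.
  apply: (sc_sub (rho := rho) (sR _) c0).
  rewrite -[X in X \in _]opprK; apply: submodN (sR _) _ _.
  by move: Hc; rewrite scalerA E scale0r sub0r.
(* The detour path is nonzero both from the end of w and from v, and its first arrow fixes its
   start. *)
have wv : walk_end v w = v.
  move: (mon_walk nzw) (mon_walk nza).
  by case: (rcons _ _) (size_rcons (take t0 s) a0) => //= b r _ /andP[/eqP <- _] /andP[/eqP <- _].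
pose x' := x - sc c *: (mon v w *: x).
have uni := strand_uniserial pres st.
have R1 : mon v w *: x \in R n by apply: (take_rad pres).
exists x'.
  apply: (strand_of pres uni).
  - by rewrite scalerBr (sc_comm pres) (strand_top st) [idm v *: _]scalerA -{1}wv idm_mon.
  - rewrite scalerBr (sc_comm pres) [X in sc c *: X](_ : _ = 0).
      by rewrite scaler0 subr0; exact: strand_end st.
    apply: (rad_kill pres (n := 1) (k := size s)) => //; first exact: strand_kill st.
    exact: (rad_leq pres n0).
  - exact: strand_kill st.
move=> t a ts nd; rewrite addnS /x' !scalerBr !(sc_comm pres).
have TE : arr a *: (mon v (take t s) *: (mon v w *: x)) =
    mon v (w ++ rcons (take t s) a) *: x.
  by rewrite mon_cat wv mon_rcons !scalerA.
rewrite TE; have [re|nre] := boolP (realigns s n t a).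
  have [E Ea] := realigns_inj re re0 nd nd0; subst t a.
  by rewrite -E0.
apply: submodB (sR _) _ _ _ _.
  by apply: contraT => Ra'; case/negP: nre; apply: detour_realigns (P _ _ ts nd) Ra'.
apply: submodZ (sR _) _ _ _.
(* The correction follows a path off the mast, so [off_path] puts it n > 0 layers below its
   length. *)
have sz : size (w ++ rcons (take t s) a) = (t.+1 + n)%N.
  by rewrite size_cat size_rcons !size_takel // addnC.
apply: (rad_leq pres (n := (size (w ++ rcons (take t s) a) + n)%N)).
  by rewrite sz; lia.
apply: off_path P _; apply: contraNN nre => pre; rewrite /realigns.
by rewrite -sz size_prefix //= -(prefix_takeE pre).
Qed.

Lemma straighten (x : U) : strand rho v s x -> exists2 x' : U, strand rho v s x' & taut v s x'.
Proof.
move=> st; have H n : exists2 x', strand rho v s x' & detours_in n x'.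
  elim: n => [|n [x' st' P']]; last exact: straighten_step P'.
  by exists x => // t a ts _; rewrite addn0; apply: (rad_arr pres); apply: (take_rad pres).
(* After [size s] passes every detour lands below the last layer. *)
have [x' st' P'] := H (size s); exists x' => // t a ts nd.
by apply: (strand_rad_zero pres st' _ (P' t a ts nd)); lia.
Qed.

End Straighten.

Lemma taut_mon (U : lmodType A) v s (x : U) r : taut v s x ->
  ~~ prefix r s -> mon v r *: x = 0.
Proof.
move=> tx; elim/last_ind: r => [|r a IH]; first by rewrite prefix0s.
rewrite mon_rcons -scalerA => nra.
have [rs|nrs] := boolP (prefix r s); last by rewrite IH // scaler0.
by rewrite {1}(prefix_takeE rs) tx -?(prefix_takeE rs) // size_prefix.
Qed.

(** Every path acts on x and y alike: initial segments of [s] give basis vectors, all others 0.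
    Hence the annihilators coincide. *)
Lemma taut_iso (U V : lmodType A) v s (x : U) (y : V) :
  strand rho v s x -> strand rho v s y -> taut v s x -> taut v s y -> module_iso U V.
Proof.
move=> stx sty tx ty; apply: cyclic_iso (strand_cyclic stx) (strand_cyclic sty) _ => a.
have [c [Ex Ey]] : exists c : nat -> K,
    a *: x = \sum_(t < (size s).+1) sc (c t) *: (mon v (take t s) *: x) /\
    a *: y = \sum_(t < (size s).+1) sc (c t) *: (mon v (take t s) *: y).
  elim/(alg_ind pres): a => [w r _||d a b [c [Ea Ea']] [c' [Eb Eb']]].
  - have [/andP[/eqP-> rs]|] := boolP ((w == v) && prefix r s).
      have rt : (size r < (size s).+1)%N by rewrite ltnS size_prefix.
      exists (fun t => (t == size r)%:R); split.
        rewrite (bigD1 (Ordinal rt)) //= eqxx sc1 scale1r -(prefix_takeE rs).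
        rewrite big1 ?addr0 // => i ir.
        by rewrite (_ : _ == _ = false) ?sc0 ?scale0r //; apply: negbTE.
      rewrite (bigD1 (Ordinal rt)) //= eqxx sc1 scale1r -(prefix_takeE rs).
      rewrite big1 ?addr0 // => i ir.
      by rewrite (_ : _ == _ = false) ?sc0 ?scale0r //; apply: negbTE.
    move=> off; exists (fun=> 0).
    split; rewrite big1 => [|i _]; rewrite ?sc0 ?scale0r //.
      have [E|ne] := eqVneq v w; last by rewrite -(strand_top stx) scalerA mon_idm_neq ?scale0r.
      by subst w; move: off; rewrite eqxx /= => off; apply: taut_mon tx _.
    have [E|ne] := eqVneq v w; last by rewrite -(strand_top sty) scalerA mon_idm_neq ?scale0r.
    by subst w; move: off; rewrite eqxx /= => off; apply: taut_mon ty _.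
  - by exists (fun=> 0); split; rewrite scale0r big1 // => i _; rewrite sc0 scale0r.
  exists (fun t => d * c t + c' t); split; rewrite scalerDl -scalerA.
    rewrite Ea Eb scaler_sumr -big_split /=; apply: eq_bigr => i _.
    by rewrite scD scM scalerDl !scalerA.
  rewrite Ea' Eb' scaler_sumr -big_split /=; apply: eq_bigr => i _.
  by rewrite scD scM scalerDl !scalerA.
rewrite Ex Ey; split=> /strand_coef_eq0.
  move=> /(_ pres stx) c0; rewrite big1 // => i _.
  by rewrite c0 ?sc0 ?scale0r // -ltnS.
move=> /(_ pres sty) c0; rewrite big1 // => i _.
by rewrite c0 ?sc0 ?scale0r // -ltnS.
Qed.

(** * Uniserial modules under rigidity *)

Hypothesis Hrigid : rigid (fun v s => mon v s != 0).

Lemma rigid_strand_iso (U V : lmodType A) v s (x : U) (y : V) :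
  strand rho v s x -> strand rho v s y -> module_iso U V.
Proof.
move=> /(straighten Hrigid)[x' stx tx] /(straighten Hrigid)[y' sty ty].
exact: taut_iso stx sty tx ty.
Qed.

Lemma rigid_finite : finite_uniserial_type A.
Proof.
have [m mI] := mon_long pres.
(* [None] is the type of the zero module, which counts as uniserial. *)
pose T : finType := option (vertex G * {k : 'I_m.+1 & k.-tuple (arrow G)}).
pose ty (i : T) (U : lmodType A) : Prop :=
  if i is Some vs then exists x : U, strand rho vs.1 (tagged vs.2) x
  else forall y : U, y = 0.
have tyE (U : lmodType A) : uniserial U -> exists i, ty i U.
  move=> uni; have [[y y0]|H] := pselect (exists y : U, y != 0); last first.
    by exists None => y; apply/eqP; apply: contraT => y0; case: H; exists y.
  have [v [s [x st]]] := strand_exists pres uni y0.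
  have sm : (size s < m.+1)%N.
    rewrite ltnS leqNgt; apply: contraNN (strand_end st) => /ltnW ms.
    by rewrite mI // scale0r.
  exists (Some (v, Tagged (fun k : 'I_m.+1 => k.-tuple (arrow G)) (i := Ordinal sm) (in_tuple s))).
  by exists x.
have tyI i (U V : lmodType A) : ty i U -> ty i V -> module_iso U V.
  case: i => [[v s]|] /=; last first.
    move=> U0 V0; apply: (cyclic_iso (x := 0) (x' := 0)) => [y|y|a].
    - by exists 0; rewrite scale0r.
    - by exists 0; rewrite scale0r.
    - by rewrite !scaler0.
  by move=> [x stx] [y sty]; apply: rigid_strand_iso stx sty.
pose M (i : 'I_#|T|) : lmodType A :=
  if pselect (exists U, ty (enum_val i) U) is left H then projT1 (cid H) else A^o.
exists #|T|, M => U /tyE[i tyU]; exists (enum_rank i); apply: (tyI _ _ _ tyU).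
rewrite /M; case: pselect => [H|[]]; last by exists U; rewrite enum_rankK.
by case: cid => V /=; rewrite enum_rankK.
Qed.

(** Rigidity for the mast [b] and its empty initial segment. *)
Lemma rigid_arrow_inj (a b : arrow G) : src a = src b -> tgt a = tgt b -> a = b.
Proof.
move=> sab tab.
have nza : mon (src b) [:: a] != 0 by rewrite -sab; apply: mon_arr_neq0.
case: (@Hrigid (src b) [:: b] [::] a isT isT (mon_arr_neq0 pres b) nza tab) => /=.
- by rewrite andbT => /eqP.
- by rewrite suffixE /= eqseq_cons andbT => /eqP.
Qed.

Lemma walk_map_inj v (s r : seq (arrow G)) : walk v s -> walk v r ->
  map (@tgt G) s = map (@tgt G) r -> s = r.
Proof.
elim: s v r => [|a s IH] v [|b r] //= /andP[/eqP av ws] /andP[/eqP bv wr] [ab sr].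
have E : a = b by apply: rigid_arrow_inj; rewrite // av.
by subst b; congr cons; apply: IH ws wr sr.
Qed.



(** Recovers the vertex of a composition factor from the idempotent that fixes a generator. *)
Lemma subquotient_generator (U S : lmodType A) v s (x : U) i :
    strand rho v s x -> (i <= size s)%N ->
    subquotient_iso (radical_power U i) (radical_power U i.+1) S ->
  exists z : S, [/\ z != 0, idm (walk_end v (take i s)) *: z = z &
    forall y : S, exists c, y = sc c *: z].
Proof.
move=> st si [f [fD fS fK]]; have sR := @rad_sub A U i.
have R0 : 0 \in radical_power U i by apply: submod0.
have Rx := take_rad pres v x si.
have f0 : f 0 = 0.
  have := fD 1 0 0 R0 R0; rewrite scaler0 addr0 scale1r => /eqP.
  by rewrite -subr_eq subrr eq_sym => /eqP.
have fZ a y : y \in radical_power U i -> f (a *: y) = a *: f y.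
  by move=> Ry; rewrite -[a *: y]addr0 fD // f0 addr0.
exists (f (mon v (take i s) *: x)); split.
- by rewrite fK //; exact: (strand_radN pres st si).
- by rewrite -fZ // take_homog.
move=> y; have [w Rw <-] := fS y; have [c Hc] := strand_step pres st si Rw.
exists c; rewrite -fZ // -[w in LHS](subrK (sc c *: (mon v (take i s) *: x))).
have Rw' := rad_decr pres Hc; rewrite -[X in f (X + _)]scale1r fD //; last exact: submodZ.
by move: Hc; rewrite -fK // => /eqP ->; rewrite scaler0 add0r.
Qed.

Lemma length_neq0 (U : lmodType A) n : composition_length U n.+1 -> exists y : U, y != 0.
Proof.
case=> M [_ _ sM maxM]; have [_ /existsNP[y /not_implyP[_ /negP ny]] _] := maxM 0 isT.
exists y; apply: contraNneq ny => ->; exact: submod0 (sM 1 isT).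
Qed.

Lemma map_tgt_nth (v : vertex G) (s : seq (arrow G)) t : (t < size s)%N ->
  nth v (map (@tgt G) s) t = walk_end v (take t.+1 s).
Proof.
case: s => // a s ts; rewrite (nth_map a) // (take_nth a) //.
by rewrite walk_end_rcons.
Qed.

(** The factors give the vertices of the mast, and without parallel arrows these determine the
    mast. *)
Lemma rigid_unique : uniserial_unique_by_series A.
Proof.
move=> l S _ U V uniU uniV [lenU SU] [lenV SV].
have [yU yU0] := length_neq0 lenU; have [yV yV0] := length_neq0 lenV.
have [v [s [x stx]]] := strand_exists pres uniU yU0.
have [w [r [y sty]]] := strand_exists pres uniV yV0.
have /eqP := strand_length_unique pres stx lenU; rewrite eqSS => /eqP ls.
have /eqP := strand_length_unique pres sty lenV; rewrite eqSS => /eqP lr.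
have E i : (i <= l)%N -> walk_end v (take i s) = walk_end w (take i r).
  move=> il; have il' : (i < l.+1)%N by [].
  have si : (i <= size s)%N by rewrite -ls.
  have ri : (i <= size r)%N by rewrite -lr.
  have [z [z0 vz zS]] := subquotient_generator stx si (SU (Ordinal il')).
  have [z' [z0' vz' _]] := subquotient_generator sty ri (SV (Ordinal il')).
  (* Nonzero vectors fixed by different vertex idempotents cannot be proportional. *)
  have [c cz] := zS z'; apply/eqP; apply: contraT => ne; case/eqP: z0'.
  rewrite -vz' cz (sc_comm pres) -vz [idm _ *: (_ *: _)]scalerA idmM eq_sym (negbTE ne).
  by rewrite scale0r scaler0.
have nz (W : lmodType A) u q (z : W) : strand rho u q z -> mon u q != 0.
  by move=> /strand_end; apply: contraNneq => ->; rewrite scale0r.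
have vw : v = w by have := E 0 isT; rewrite !take0.
subst w; have sr : s = r.
  apply: (walk_map_inj (mon_walk (nz _ _ _ _ stx)) (mon_walk (nz _ _ _ _ sty))).
  apply: (@eq_from_nth _ v) => [|t]; rewrite !size_map -ls -?lr // => tl.
  by rewrite !map_tgt_nth -?ls -?lr // E.
by subst r; apply: rigid_strand_iso stx sty.
Qed.

End Straightening.

(** * One-parameter families of uniserial modules *)

(* Paths act on row vectors from the right, so products are reversed. *)
Record antirep (K : fieldType) (G : quiver) (A : pzRingType)
    (rho : {rmorphism palg K G -> A}) (n : nat) := Antirep {
  repmx : palg K G -> 'M[K]_n;
  repmxDZ : forall c g h, repmx (c *: g + h) = c *: repmx g + repmx h;
  repmx1 : repmx 1 = 1%:M;
  repmxM : forall g h, repmx (g * h) = repmx h *m repmx g;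
  repmx_kill : forall g, rho g = 0 -> repmx g = 0;
  rep_pres : monomial_presentation rho
}.

(** Indexed by [D] so that each representation carries its own action on the row vectors. *)
Definition repmod (K : fieldType) (G : quiver) (A : pzRingType)
  (rho : {rmorphism palg K G -> A}) (n : nat) (D : antirep rho n) : Type := 'rV[K]_n.

Section RepresentationModule.
Variables (K : fieldType) (G : quiver) (A : pzRingType).
Variables (rho : {rmorphism palg K G -> A}) (n : nat) (D : antirep rho n).

Local Notation repmod := (repmod D).
HB.instance Definition _ := GRing.Zmodule.on repmod.

Definition rep_lift (a : A) : palg K G := projT1 (cid (presS (rep_pres D) a)).

Lemma rep_liftK a : rho (rep_lift a) = a.
Proof. by rewrite /rep_lift; case: cid. Qed.

Lemma repmxB g h : repmx D (g - h) = repmx D g - repmx D h.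
Proof. by rewrite addrC -scaleN1r repmxDZ scaleN1r addrC. Qed.

Lemma repmx_eq g h : rho g = rho h -> repmx D g = repmx D h.
Proof.
move=> gh; apply/eqP; rewrite -subr_eq0 -repmxB repmx_kill // rmorphB gh.
by rewrite subrr.
Qed.

Definition rep_scale (a : A) (x : repmod) : repmod :=
  (x : 'rV[K]_n) *m repmx D (rep_lift a).

Lemma rep_scaleE g (x : repmod) : rep_scale (rho g) x = (x : 'rV[K]_n) *m repmx D g.
Proof. by congr (_ *m _); apply: repmx_eq; rewrite rep_liftK. Qed.

Lemma rep_scaleA a b x : rep_scale a (rep_scale b x) = rep_scale (a * b) x.
Proof.
by rewrite -[a]rep_liftK -[b]rep_liftK -rmorphM !rep_scaleE repmxM mulmxA.
Qed.

Lemma rep_scale1 : left_id 1 rep_scale.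
Proof. by move=> x; rewrite -(rmorph1 rho) rep_scaleE repmx1 mulmx1. Qed.

Lemma rep_scaleDr : right_distributive rep_scale +%R.
Proof. by move=> a x y; exact: mulmxDl. Qed.

Lemma rep_scaleDl x : {morph rep_scale^~ x : a b / a + b}.
Proof.
move=> a b; rewrite -[a]rep_liftK -[b]rep_liftK -rmorphD !rep_scaleE.
by rewrite -[X in repmx D (X + _)]scale1r repmxDZ scale1r mulmxDr.
Qed.

HB.instance Definition _ := GRing.Zmodule_isLmodule.Build A repmod
  rep_scaleA rep_scale1 rep_scaleDr rep_scaleDl.

Lemma repmod_scaleE g (x : repmod) : rho g *: x = (x : 'rV[K]_n) *m repmx D g.
Proof. exact: rep_scaleE. Qed.

Lemma repmod_sc c (x : repmod) : sc rho c *: x = c *: (x : 'rV[K]_n).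
Proof.
rewrite sc.unlock repmod_scaleE.
have E : repmx D 0 = 0 by rewrite repmx_kill ?rmorph0.
have cE : c *: (1 : palg K G) + 0 = c *: (1 : palg K G) by exact: addr0.
by rewrite -cE repmxDZ E repmx1 addr0 -scalemxAr mulmx1.
Qed.

End RepresentationModule.

Section PathMatrices.
Variables (K : fieldType) (G : quiver) (A : pzRingType).
Variable rho : {rmorphism palg K G -> A}.
Hypothesis pres : monomial_presentation rho.
Variables (n : nat) (vt : 'I_n -> vertex G) (M : arrow G -> 'M[K]_n).
(** Sources are taken care of by the projection with which every [pathmx] begins. *)
Hypothesis Mtgt : forall b i j, M b i j != 0 -> vt j = tgt b.

Definition idmx_at (e : vertex G) : 'M[K]_n := diag_mx (\row_i (vt i == e)%:R).

Definition pathmx (w : vertex G) (r : seq (arrow G)) : 'M[K]_n :=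
  foldl (fun Y b => Y *m M b) (idmx_at w) r.

Lemma pathmx_rcons w r b : pathmx w (rcons r b) = pathmx w r *m M b.
Proof. by rewrite /pathmx foldl_rcons. Qed.

Lemma idmx_atM e f : idmx_at e *m idmx_at f = if e == f then idmx_at e else 0.
Proof.
rewrite /idmx_at mulmx_diag; apply/matrixP => i j; rewrite !mxE.
case: (e =P f) => [<-|ef]; rewrite !mxE.
  by case: (vt i == e); rewrite ?mulr1 ?mulr0.
by case: eqP => [->|_]; rewrite ?mul0r ?mul0rn //; case: eqP => // _; rewrite mulr0 mul0rn.
Qed.

Lemma mx_idmx_at b f : M b *m idmx_at f = if f == tgt b then M b else 0.
Proof.
rewrite /idmx_at mul_mx_diag; apply/matrixP => i j; rewrite !mxE.
have [E|/Mtgt ->] := eqVneq (M b i j) 0.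
  by rewrite E mul0r; case: ifP; rewrite ?mxE.
by rewrite eq_sym; case: eqP => _; rewrite ?mulr1 ?mulr0 ?mxE.
Qed.

Lemma pathmx_end w r f : pathmx w r *m idmx_at f = if f == walk_end w r then pathmx w r else 0.
Proof.
case/lastP: r => [|r b]; first by rewrite [LHS]idmx_atM eq_sym.
by rewrite pathmx_rcons -mulmxA mx_idmx_at walk_end_rcons; case: ifP; rewrite ?mulmx0.
Qed.

Lemma pathmx_cat w r1 r2 : pathmx w (r1 ++ r2) = pathmx w r1 *m pathmx (walk_end w r1) r2.
Proof.
elim/last_ind: r2 => [|r2 b IH]; first by rewrite cats0 [RHS]pathmx_end eqxx.
by rewrite -rcons_cat !pathmx_rcons IH mulmxA.
Qed.

Lemma pathmx_comp_neq w r w' r' : walk_end w r <> w' -> pathmx w r *m pathmx w' r' = 0.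
Proof.
move=> /eqP ne; elim/last_ind: r' => [|r' b IH].
  by rewrite [LHS]pathmx_end eq_sym (negbTE ne).
by rewrite pathmx_rcons mulmxA IH mul0mx.
Qed.

Definition pathrep (g : palg K G) : 'M[K]_n :=
  linext (fun q => pathmx (pstart q) (parrows q)) g.

Lemma pathrep_pbase p : pathrep (pbase K p) = pathmx (pstart p) (parrows p).
Proof. exact: linext_pbase. Qed.

Lemma pathrepDZ c g h : pathrep (c *: g + h) = c *: pathrep g + pathrep h.
Proof. exact: linearP. Qed.

Lemma pathrep0 : pathrep 0 = 0.
Proof. exact: linear0. Qed.

Lemma pathrep1 : pathrep 1 = 1%:M.
Proof.
rewrite [LHS]linear_sum (eq_bigr idmx_at) => [|e _]; last exact: pathrep_pbase.
apply/matrixP => i j; rewrite summxE (bigD1 (vt i)) //= big1 => [|e ie].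
  by rewrite addr0 !mxE eqxx.
by rewrite !mxE eq_sym (negbTE ie) mul0rn.
Qed.

Lemma pathrepM g h : pathrep (g * h) = pathrep h *m pathrep g.
Proof.
elim/palg_ind: g => [q||c x y Hx Hy]; first last.
- by rewrite [_ * h]palg_mulDZl !pathrepDZ Hx Hy mulmxDr scalemxAr.
- by rewrite mul0r pathrep0 mulmx0.
elim/palg_ind: h => [p||c x y Hx Hy]; first last.
- by rewrite [_ * (_ + _)]palg_mulDZr !pathrepDZ Hx Hy mulmxDl scalemxAl.
- by rewrite mulr0 pathrep0 mul0mx.
rewrite [_ * _]palg_mulbb !pathrep_pbase.
case: (pend p =P pstart q) => [pq|npq]; last first.
  by rewrite pcompN //= pathmx_comp_neq // pathrep0.
have [r rE] := pcompS pq; rewrite rE /= pathrep_pbase.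
by move/eqP/pcompP: rE => [_ -> ->]; rewrite pathmx_cat -pq.
Qed.

Hypothesis kill : forall w r, mon rho w r = 0 -> pathmx w r = 0.

Lemma pathrep_kill g : rho g = 0 -> pathrep g = 0.
Proof.
move=> g0; have H := presI pres g0; move: H; move: {g0} g.
apply: palg_supp_ind => [p||c x y Hx Hy].
- by rewrite rho_pbase pathrep_pbase; apply: kill.
- exact: pathrep0.
- by rewrite pathrepDZ Hx Hy scaler0 addr0.
Qed.

Definition path_antirep : antirep rho n :=
  Antirep pathrepDZ pathrep1 pathrepM pathrep_kill pres.

Lemma path_antirepE w r (x : repmod path_antirep) :
  mon rho w r *: x = (x : 'rV[K]_n) *m pathmx w r.
Proof.
have [E|nz] := eqVneq (mon rho w r) 0.
  by rewrite kill // E scale0r mulmx0.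
have [p [<- <- <-]] := mon_qpath nz.
by rewrite repmod_scaleE -pathrep_pbase.
Qed.

End PathMatrices.

Lemma prefix_rcons_nth (T : eqType) (r q : seq T) b :
  prefix (rcons r b) q = [&& prefix r q, (size r < size q)%N & nth b q (size r) == b].
Proof.
elim: q r => [|c q IH] [|d r] //=; first by rewrite prefix0s andbT eq_sym.
by rewrite IH ltnS andbA.
Qed.

(* Same as [size_prefix], but with [size] at the finite type of arrows. *)
Lemma arrow_size_prefix (G : quiver) (r q : seq (arrow G)) :
  prefix r q -> (size r <= size q)%N.
Proof. exact: size_prefix. Qed.

Lemma walk_nth_src (G : quiver) (v : vertex G) s b t : walk v s -> (t < size s)%N ->
  src (nth b s t) = walk_end v (take t s).
Proof.
elim: s v t => // a s IH v [|t] /= /andP[/eqP av ws] ts //.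
exact: (IH (tgt a)).
Qed.

Lemma walk_end_takeS (G : quiver) (v : vertex G) s b t : (t < size s)%N ->
  walk_end v (take t.+1 s) = tgt (nth b s t).
Proof. by move=> ts; rewrite (take_nth b ts) walk_end_rcons. Qed.

(** * The module with a prescribed mast and one scaled detour *)

Section Model.
Variables (K : fieldType) (G : quiver) (A : pzRingType).
Variable rho : {rmorphism palg K G -> A}.
Hypothesis pres : monomial_presentation rho.
Variables (v : vertex G) (s : seq (arrow G)) (i0 : nat) (a : arrow G).
Hypothesis nzs : mon rho v s != 0.
(** An implication, so that [i0] at least [size s] yields the module without a detour: a module with
    any nonzero path as mast, in particular a simple one. *)
Hypothesis extra : (i0 < size s)%N ->
  mon rho v (rcons (take i0 s) a) != 0 /\ tgt a = walk_end v s.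

Local Notation n := (size s).
Local Notation idm := (idm rho).
Local Notation arr := (arr rho).
Local Notation sc := (sc rho).
Local Notation mon := (mon rho).

Definition model_vertex (t : 'I_n.+1) : vertex G := walk_end v (take t s).

Lemma extra_src : (i0 < n)%N -> src a = walk_end v (take i0 s).
Proof.
by move=> /extra[/mon_walk]; rewrite -cats1 walk_cat /= andbT => /andP[_ /eqP].
Qed.

Section FixedScalar.
Variable k : K.

Definition jump b t := [&& b == a, t == i0 & (i0 < n)%N].

(* Row t is sent to row t + 1 by the t-th arrow of s; the second summand makes a
   send row i0 to k times the last row, and vanishes when i0 >= size s. *)
Definition model_mx (b : arrow G) : 'M[K]_n.+1 :=
  \matrix_(i, j) (((nth b s i == b) && (j == i.+1 :> nat))%:R +
                  k * (jump b i && (j == n :> nat))%:R).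

Lemma model_tgt b i j : model_mx b i j != 0 -> model_vertex j = tgt b.
Proof.
rewrite mxE /model_vertex; case: andP => [[/eqP nb /eqP ji] _|_].
  have ts : (i < n)%N by rewrite -ltnS -ji.
  by rewrite ji (walk_end_takeS v b ts) nb.
case: andP => [[/and3P[/eqP -> _ i0n] /eqP ->] _|_]; last by rewrite mulr0 addr0 eqxx.
by rewrite take_size; have [_ <-] := extra i0n.
Qed.

Local Notation path := (pathmx model_vertex model_mx).

Definition ev (t : nat) : 'rV[K]_n.+1 := \row_j (j == t :> nat)%:R.

Lemma ev_mulmx t (X : 'M[K]_n.+1) (tn : (t < n.+1)%N) : ev t *m X = row (Ordinal tn) X.
Proof.
apply/rowP => j; rewrite !mxE (bigD1 (Ordinal tn)) //= !mxE eqxx mul1r big1 ?addr0 // => i it.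
by rewrite mxE (_ : _ == t = false) ?mul0r //; apply: contraNF it => /eqP it; apply/eqP/val_inj.
Qed.

(** Absorbs a default value: in row [n], [nth b s n] is [b], but the row n + 1 it points to is
    zero. *)
Lemma ev_big t : (n < t)%N -> ev t = 0.
Proof.
move=> nt; apply/rowP => j; rewrite !mxE ltn_eqF //; apply: leq_trans nt.
exact: ltn_ord.
Qed.

Lemma ev_model t b : (t <= n)%N ->
  ev t *m model_mx b = (nth b s t == b)%:R *: ev t.+1 + (k * (jump b t)%:R) *: ev n.
Proof.
move=> tn; rewrite (ev_mulmx _ (tn : (t < n.+1)%N)); apply/rowP => j; rewrite !mxE /=.
by rewrite -!mulnb !natrM mulrA.
Qed.

Lemma ev_idmx t w : (t <= n)%N ->
  ev t *m idmx_at K model_vertex w = (walk_end v (take t s) == w)%:R *: ev t.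
Proof.
move=> tn; rewrite (ev_mulmx _ (tn : (t < n.+1)%N)); apply/rowP => j; rewrite !mxE /=.
by rewrite -[LHS]mulr_natr -val_eqE /= [j == t :> nat]eq_sym.
Qed.

(** The path that leads from row t through the jump. The jump ends in the last row, which no arrow
    leaves, so it can only be the last step. *)
Definition jumps t r := [&& (i0 < n)%N, (t <= i0)%N & r == rcons (drop t (take i0 s)) a].

Lemma jumps_rcons t r b : (t <= n)%N ->
  jumps t (rcons r b) = prefix r (drop t s) && jump b (t + size r)%N.
Proof.
move=> tn; apply/and3P/andP => [[i0n ti /eqP/rcons_inj[-> ->]]|[pr /and3P[/eqP-> /eqP E i0n]]].
  have si : size (take i0 s) = i0 by rewrite size_takel // ltnW.
  split; last by rewrite /jump eqxx i0n size_drop si subnKC // eqxx.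
  by rewrite -{2}(cat_take_drop i0 s) drop_cat size_takel ?(ltnW i0n) //;
    case: ltnP => [_|it]; rewrite ?prefix_prefix // drop_oversize ?prefix0s // si.
split=> //; first by rewrite -E leq_addr.
by rewrite -E addnC -take_drop; apply/eqP; congr rcons; apply: prefix_takeE.
Qed.

Lemma ev_path t w r : (t <= n)%N ->
  ev t *m path w r = (walk_end v (take t s) == w)%:R *:
    ((prefix r (drop t s))%:R *: ev (t + size r)%N + (k * (jumps t r)%:R) *: ev n).
Proof.
move=> tn; elim/last_ind: r => [|r b IH].
  rewrite ev_idmx // prefix0s addn0 scale1r /jumps.
  by case: (drop t (take i0 s)) => [|? ?]; rewrite !andbF mulr0 scale0r addr0.
rewrite pathmx_rcons mulmxA IH -scalemxAl mulmxDl -!scalemxAl; congr (_ *: _).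
rewrite (ev_model b (leqnn n)) (ev_big (ltnSn n)) scaler0 add0r.
have -> : jump b n = false by rewrite /jump; case: eqP => //= _; case: ltngtP.
rewrite mulr0 scale0r scaler0 addr0 jumps_rcons // prefix_rcons_nth.
case: (boolP (prefix r (drop t s))) => pr; last by rewrite !scale0r mulr0 scale0r addr0.
have rn : (t + size r <= n)%N.
  by have := arrow_size_prefix pr; rewrite size_drop; lia.
rewrite /= scale1r ev_model // nth_drop size_drop size_rcons addnS; congr (_ + _).
case: (ltnP (size r) (n - t)) => // nr; rewrite [ev _](ev_big) ?scaler0 //.
by lia.
Qed.

Lemma row_ev (y : 'rV[K]_n.+1) : y = \sum_(t < n.+1) y 0 t *: ev t.
Proof.
apply/rowP => j; rewrite summxE (bigD1 j) //= !mxE eqxx mulr1 big1 ?addr0 // => i ij.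
by rewrite !mxE (_ : _ == _ = false) ?mulr0 //; apply: contraNF ij => /eqP ij; apply/eqP/val_inj.
Qed.

(** A path acting nontrivially is a factor of [s] or of the detour path, and factors of nonzero
    paths are nonzero. *)
Lemma model_kill w r : mon w r = 0 -> path w r = 0.
Proof.
move=> z; suff H t : (t <= n)%N -> ev t *m path w r = 0.
  apply/row_matrixP => i; have in1 := ltn_ord i.
  by rewrite row0 -(H i) // ev_mulmx; congr (row _ _); apply: val_inj.
move=> tn; rewrite ev_path //; case: eqP => [E|_]; last by rewrite scale0r.
have -> : prefix r (drop t s) = false.
  apply: contra_eqF z => /prefixP[q E']; rewrite -E.
  by have := mon_drop t nzs; rewrite E'; apply: mon_catl.
have -> : jumps t r = false; last by rewrite scale0r mulr0 scale0r addr0 scaler0.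
apply: contra_eqF z => /and3P[i0n ti /eqP ->]; rewrite -E.
have [nza _] := extra i0n; rewrite -(take_takel s ti); apply: mon_catr.
by rewrite -rcons_cat cat_take_drop.
Qed.

Definition model : lmodType A := repmod (path_antirep pres model_tgt model_kill).

Lemma modelE w r (y : model) : mon w r *: y = (y : 'rV[K]_n.+1) *m path w r.
Proof. exact: path_antirepE. Qed.

Lemma model_sc c (y : model) : sc c *: y = c *: (y : 'rV[K]_n.+1).
Proof. exact: repmod_sc. Qed.

Hypothesis detour : (i0 < n)%N -> ~~ prefix (rcons (take i0 s) a) s.

Lemma jumps0_take t : jumps 0 (take t s) = false.
Proof.
apply: contraTF isT => /and3P[i0n _ /eqP]; rewrite drop0 => E.
by have := detour i0n; rewrite -E prefix_take.
Qed.

Lemma model_take t : (t <= n)%N -> mon v (take t s) *: (ev 0 : model) = ev t.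
Proof.
move=> tn; rewrite modelE ev_path // take0 eqxx scale1r drop0 prefix_take jumps0_take.
by rewrite scale1r mulr0 scale0r addr0 size_takel.
Qed.

Lemma ev_n_neq0 : ev n != 0.
Proof.
by apply/eqP => /rowP/(_ ord_max); rewrite !mxE eqxx => /eqP; rewrite oner_eq0.
Qed.

Lemma model_strand : strand rho v s (ev 0 : model).
Proof.
split=> [|y||w r y nr].
- by rewrite -mon_nil -(take0 s) model_take.
- exists (fun t => if insub t is Some i then (y : 'rV[K]_n.+1) 0 i else 0).
  rewrite [LHS](row_ev y); apply: eq_bigr => i _.
  by rewrite model_take ?model_sc ?valK // -ltnS ltn_ord.
- by have := model_take (leqnn n); rewrite take_size => ->; exact: ev_n_neq0.
rewrite modelE [y in LHS]row_ev mulmx_suml; apply: big1 => i _.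
have tn : (i <= n)%N by rewrite -ltnS ltn_ord.
rewrite -scalemxAl ev_path //.
have -> : prefix r (drop i s) = false.
  by apply: contraTF nr => /arrow_size_prefix; rewrite size_drop; lia.
have -> : jumps i r = false; last by rewrite scale0r mulr0 scale0r addr0 !scaler0.
apply: contraTF nr => /and3P[i0n ti /eqP ->].
by rewrite size_rcons size_drop size_takel ?(ltnW i0n) //; lia.
Qed.

Lemma model_extra b t : (t <= n)%N ->
  arr b *: (ev t : model) = (nth b s t == b)%:R *: ev t.+1 + (k * (jump b t)%:R) *: ev n
  :> 'rV[K]_n.+1.
Proof.
move=> tn; rewrite -(model_take tn) scalerA -mon_rcons modelE pathmx_rcons mulmxA.
by rewrite -modelE model_take // ev_model.
Qed.

Hypothesis i0n : (i0 < n)%N.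
Hypothesis nsuf : ~~ suffix (rcons (take i0 s) a) s.

(** From a row i > 0 the path [s] is too long, along the mast and through the jump alike. *)
Lemma model_last (y : model) : mon v s *: y = (y : 'rV[K]_n.+1) 0 0 *: ev n.
Proof.
rewrite modelE [y in LHS]row_ev mulmx_suml (bigD1 ord0) //= big1 => [|i i0'].
  have := model_take (leqnn n); rewrite take_size modelE => E.
  by rewrite addr0 -scalemxAl E.
have tn : (i <= n)%N by rewrite -ltnS ltn_ord.
have ipos : (0 < i)%N by rewrite lt0n; apply: contraNneq i0' => E; apply/eqP/val_inj.
rewrite -scalemxAl ev_path //.
have -> : prefix s (drop i s) = false.
  by apply: contraTF ipos => /arrow_size_prefix; rewrite size_drop; lia.
have -> : jumps i s = false; last by rewrite scale0r mulr0 scale0r addr0 !scaler0.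
apply: contraTF ipos => /and3P[_ ti /eqP /(congr1 (@size (arrow G)))].
by rewrite size_rcons size_drop size_takel ?(ltnW i0n) //; lia.
Qed.

(** Row 0 contributes only through the jump, as the path is no prefix of [s]. A row i > 0 reaches
    the last row along it only if it equals [drop i s], which [nsuf] excludes. *)
Lemma model_jump (y : model) :
  (mon v (rcons (take i0 s) a) *: y : 'rV[K]_n.+1) 0 ord_max = k * (y : 'rV[K]_n.+1) 0 0.
Proof.
have si : size (take i0 s) = i0 by rewrite size_takel // ltnW.
rewrite modelE [y in LHS]row_ev mulmx_suml summxE (bigD1 ord0) //= big1 => [|i i0'].
  rewrite -scalemxAl ev_path // take0 eqxx scale1r drop0 (negbTE (detour i0n)).
  rewrite scale0r add0r addr0 !mxE eqxx mulr1 /jumps i0n drop0 eqxx mulr1.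
  by rewrite mulrC.
have tn : (i <= n)%N by rewrite -ltnS ltn_ord.
have ipos : (0 < i)%N by rewrite lt0n; apply: contraNneq i0' => E; apply/eqP/val_inj.
rewrite -scalemxAl ev_path //.
have -> : jumps i (rcons (take i0 s) a) = false.
  apply: contraTF ipos => /and3P[_ ti /eqP /(congr1 (@size (arrow G)))].
  by rewrite !size_rcons size_drop si; lia.
rewrite mulr0 scale0r addr0 !mxE; case: (boolP (prefix _ _)) => [pr|]; last by rewrite mul0r !mulr0.
case: (walk_end v (take i s) =P v) => _; last by rewrite mul0r mulr0.
case: eqP => [E|_]; last by rewrite !mulr0.
case/negP: nsuf; rewrite (_ : rcons _ _ = drop i s) ?suffix_drop //.
rewrite {1}(prefix_takeE pr) take_oversize // size_drop.
by rewrite /= in E; rewrite leq_subLR -E.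
Qed.

End FixedScalar.

(* The last coordinates of a u y and s y are k y_0 and y_0, for every y. *)
Lemma model_noniso (k k' : K) : (i0 < n)%N -> ~~ prefix (rcons (take i0 s) a) s ->
  ~~ suffix (rcons (take i0 s) a) s -> module_iso (model k) (model k') -> k = k'.
Proof.
move=> i0n npre nsuf [f [g fK gK]].
have det : (i0 < n)%N -> ~~ prefix (rcons (take i0 s) a) s by [].
set y : model k' := f (ev 0 : model k).
(* The relation a u x = k s x of the generator passes to its image. *)
have E : mon v (rcons (take i0 s) a) *: y = sc k *: (mon v s *: y).
  rewrite -!linearZ /=; congr (f _).
  have := model_take k det (leqnn n); rewrite take_size => ->.
  rewrite model_sc mon_rcons -scalerA model_take // ?(ltnW i0n) //.
  rewrite model_extra // ?(ltnW i0n) // /jump !eqxx i0n mulr1.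
  have -> : nth a s i0 == a = false; last by rewrite scale0r add0r.
  apply: contraNF npre => /eqP na.
  by rewrite -{1}na -take_nth // prefix_take.
(* Otherwise s y = 0, and the inverse [g] would give s x = 0. *)
have y0 : (y : 'rV[K]_n.+1) 0 0 != 0.
  apply/eqP => y0; have := strand_end (model_strand k det).
  have -> : mon v s *: (ev 0 : model k) = g (mon v s *: y) by rewrite -linearZ fK.
  rewrite model_last // y0 scale0r => /eqP; apply.
  by rewrite -[RHS](fK 0) linear0.
have := congr1 (fun z : 'rV[K]_n.+1 => z 0 ord_max) E.
rewrite model_jump // model_sc model_last // !mxE eqxx mulr1 => /(mulIf y0).
by move=> ->.
Qed.

End Model.

Lemma infinite_uniq (K : choiceType) (n : nat) : infinite_set [set: K] ->
  exists s : seq K, uniq s /\ size s = n.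
Proof.
move=> inf; elim: n => [|n [s [us <-]]]; first by exists [::].
have [x xs] : exists x, x \notin s.
  apply: contra_notP inf => H; apply: (@sub_finite_set _ _ [set` s]); last exact: finite_seq.
  by move=> x _ /=; apply: contraT => xs; case: H; exists x.
by exists (x :: s); rewrite /= xs.
Qed.

Lemma infinite_poly0 (K : fieldType) (f : {poly K}) : infinite_set [set: K] ->
  (forall x, f.[x] = 0) -> f = 0.
Proof.
move=> inf f0; apply/eqP; apply: contraT => nz.
have [s [us ss]] := infinite_uniq (size f) inf.
have rs : all (root f) s by apply/allP => x _; apply/rootP.
by have := max_poly_roots nz rs us; rewrite ss ltnn.
Qed.

(** * Composition factors of strands *)

Section Subquotients.
Variables (K : fieldType) (G : quiver) (A : pzRingType).
Variable rho : {rmorphism palg K G -> A}.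
Hypothesis pres : monomial_presentation rho.
Local Notation idm := (idm rho).
Local Notation sc := (sc rho).
Local Notation mon := (mon rho).

(** A strand along the empty path is the simple module at its vertex. *)
Lemma point_span (S : lmodType A) e (z : S) : strand rho e [::] z -> forall y, exists c, y = sc c *: z.
Proof.
move=> st y; have [c ->] := strand_span st y; exists (c 0).
by rewrite big_ord_recl big_ord0 addr0 take0 mon_nil (strand_top st).
Qed.

Lemma point_neq0 (S : lmodType A) e (z : S) : strand rho e [::] z -> z != 0.
Proof. by move=> st; have := strand_end st; rewrite mon_nil (strand_top st). Qed.

Lemma point_simple (S : lmodType A) e (z : S) : strand rho e [::] z -> simple_module S.
Proof.
move=> st; split; first by exists z; apply: point_neq0 st.
move=> N sN; have [[y [Ny y0]]|H] := pselect (exists y, y \in N /\ y != 0).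
  right=> w; rewrite [RHS]inE; have [c cE] := point_span st y; have [d ->] := point_span st w.
  apply: submodZ => //; apply: (@sc_sub _ _ _ rho _ N c) => //; last by rewrite -cE.
  by apply: contraNneq y0 => c0; rewrite cE c0 sc0 scale0r.
left=> y; rewrite [RHS]inE; apply/idP/eqP => [Ny|->]; last exact: submod0.
by apply/eqP; apply: contraT => y0; case: H; exists y.
Qed.

(** The map reads off the coefficient in layer i. It is well defined as the basis vector there is
    not in the next layer, and linear because ring elements act on that vector and on z by the
    scalar of their common vertex. *)
Lemma strand_subquotient (U S : lmodType A) v s (x : U) (z : S) i :
    strand rho v s x -> (i <= size s)%N ->
    strand rho (walk_end v (take i s)) [::] z ->
  subquotient_iso (radical_power U i) (radical_power U i.+1) S.
Proof.
move=> st si stz; set e := walk_end v (take i s) in stz.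
have Rx := take_rad pres v x si; have nRx := strand_radN pres st si.
have ex := take_homog rho v s i x; have step := @strand_step _ _ _ _ pres _ _ _ _ st i ^~ si.
set xi := mon v (take i s) *: x in Rx nRx ex step.
have sR := @rad_sub A U i.+1.
have z0 := point_neq0 stz.
pose f (y : U) : S :=
  if pselect (exists c, y - sc c *: xi \in radical_power U i.+1) is left H
  then sc (projT1 (cid H)) *: z else 0.
have fE c y : y - sc c *: xi \in radical_power U i.+1 -> f y = sc c *: z.
  move=> Hc; rewrite /f; case: pselect => [H|[]]; last by exists c.
  case: cid => d /= Hd; have [->//|cd] := eqVneq d c.
  case/negP: nRx; apply: (@sc_sub _ _ _ rho _ _ (d - c)) => //; first by rewrite subr_eq0.
  rewrite scD scN scalerBl; have := submodB sR Hc Hd.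
  by rewrite opprB addrC addrA subrK.
exists f; split=> [a y w Ry Rw|y|y Ry].
- have [c Hc] := step _ Ry; have [d Hd] := step _ Rw.
  have [b [j [aE Jj]]] := alg_dec pres a.
  have Hx := homog_act pres b Jj Rx ex; rewrite -aE in Hx.
  have Hz := homog_act pres (n := 0) b Jj (isT : z \in radical_power S 0) (strand_top stz).
  rewrite -aE in Hz; have {}Hz := strand_rad_zero pres stz (ltnSn 0) Hz.
  rewrite (fE _ _ Hc) (fE _ _ Hd) (fE (c * b e + d)).
    by rewrite (sc_comm pres) (subr0_eq Hz) scalerA -scM -scalerDl -scD.
  have -> : a *: y + w - sc (c * b e + d) *: xi =
      a *: (y - sc c *: xi) + sc c *: (a *: xi - sc (b e) *: xi) + (w - sc d *: xi).
    rewrite !scalerBr (sc_comm pres c) scD scM scalerDl -scalerA.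
    by rewrite [X in _ = X + _]addrA subrK addrACA -opprD.
  by apply: submodD Hd => //; apply: submodD; do ?[apply: submodZ].
- have [c ->] := point_span stz y; exists (sc c *: xi).
    by apply: submodZ => //; exact: rad_sub.
  by apply: fE; rewrite subrr; apply: submod0.
have [c Hc] := step _ Ry; rewrite (fE _ _ Hc).
have [c0|c0] := eqVneq c 0.
  by rewrite c0 sc0 !scale0r subr0 in Hc *; rewrite eqxx Hc.
transitivity false.
  by apply: contraNF z0 => /eqP E; rewrite -(scZK rho z c0) E scaler0.
apply/esym; apply: contraNF nRx => Ry'; apply: (@sc_sub _ _ _ rho _ _ c) => //.
by have := submodB sR Ry' Hc; rewrite opprB addrC subrK.
Qed.

End Subquotients.

Section NotRigid.
Variables (K : fieldType) (G : quiver) (A : pzRingType).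
Variable rho : {rmorphism palg K G -> A}.
Hypothesis pres : monomial_presentation rho.
Variables (v : vertex G) (s : seq (arrow G)) (i0 : nat) (a : arrow G).
Hypotheses (i0n : (i0 < size s)%N) (nzs : mon rho v s != 0).
Hypotheses (nza : mon rho v (rcons (take i0 s) a) != 0) (ta : tgt a = walk_end v s).
Hypotheses (npre : ~~ prefix (rcons (take i0 s) a) s)
           (nsuf : ~~ suffix (rcons (take i0 s) a) s).

Local Notation mon := (mon rho).

Let model_k (k : K) : lmodType A := model pres nzs (fun=> conj nza ta) k.

Let stk (k : K) : strand rho v s (ev K s 0 : model_k k).
Proof. exact: model_strand. Qed.

Lemma not_rigid_not_finite : infinite_set [set: K] -> ~ finite_uniserial_type A.
Proof.
move=> inf [n [M HM]].
have /choice[h hP] : forall k, exists i, module_iso (model_k k) (M i).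
  by move=> k; apply: HM; apply: (strand_uniserial pres (stk k)).
have [q [uq sq]] := infinite_uniq n.+1 inf.
have hI : injective h.
  move=> k k' hk; have iso : module_iso (model_k k) (model_k k').
    apply: (module_iso_trans (hP k)); rewrite hk; apply: module_iso_sym; exact: hP.
  exact: (model_noniso i0n npre nsuf iso).
have := max_card (mem (map h q)).
by rewrite (card_uniqP _) ?(map_inj_uniq hI) // size_map sq card_ord ltnn.
Qed.

Let point_nz e : mon e [::] != 0 := idm_neq0 pres e.
Let point_extra e : (0 < size ([::] : seq (arrow G)))%N ->
  mon e (rcons (take 0 [::]) a) != 0 /\ tgt a = walk_end e [::].
Proof. by []. Qed.
Let point e : lmodType A := model pres (point_nz e) (@point_extra e) 0.

Let point_strand e : strand rho e [::] (ev K [::] 0 : point e).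
Proof. exact: model_strand. Qed.

(** The factors depend on the mast alone, so the parameters 0 and 1 share one series. *)
Lemma not_rigid_not_unique : ~ uniserial_unique_by_series A.
Proof.
move=> H; pose S (i : 'I_(size s).+1) : lmodType A := point (walk_end v (take i s)).
have series k : has_series (model_k k) S.
  split; first exact: (strand_length pres (stk k)).
  move=> i; apply: (strand_subquotient pres (stk k)); last exact: point_strand.
  by rewrite -ltnS.
have : module_iso (model_k 0) (model_k 1).
  apply: (H _ S) => [i||||]; rewrite /=.
  - exact: (point_simple (point_strand _)).
  - exact: (strand_uniserial pres (stk 0)).
  - exact: (strand_uniserial pres (stk 1)).
  - exact: series.
  - exact: series.
move=> /(model_noniso i0n npre nsuf) /eqP.
by rewrite eq_sym oner_eq0.
Qed.

End NotRigid.

(** * Slack variables *)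

Section Detours.
Variable G : quiver.
Implicit Types (p u w q : qpath G) (a : arrow G).

Lemma right_subpathE w p :
  (w \in right_subpaths p) = (pstart w == pstart p) && prefix (parrows w) (parrows p).
Proof.
apply/mapP/andP => [[n _ ->]|[/eqP w0 pre]]; first by rewrite eqxx prefix_take.
exists (plen w); last by apply: qpath_eq; rewrite // {1}(prefix_takeE pre).
by rewrite mem_iota add0n ltnS /plen; exact: size_prefix.
Qed.

Lemma ptake_right n p : ptake n p \in right_subpaths p.
Proof. by rewrite right_subpathE eqxx prefix_take. Qed.

Lemma right_subpath_refl p : p \in right_subpaths p.
Proof. by rewrite right_subpathE eqxx prefix_refl. Qed.

Lemma right_subpath_inj p u w : u \in right_subpaths p -> w \in right_subpaths p ->
  plen u = plen w -> u = w.
Proof.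
rewrite !right_subpathE => /andP[/eqP u0 pu] /andP[/eqP w0 pw] uw.
apply: qpath_eq; first by rewrite u0 w0.
by rewrite (prefix_takeE pu) (prefix_takeE pw); congr (take _ _).
Qed.

Lemma detourP p a u : reflect
  [/\ u \in right_subpaths p, src a = pend u,
      ~~ prefix (rcons (parrows u) a) (parrows p) &
      exists2 q, q \in right_subpaths p & bypass a u q] (detour p a u).
Proof.
apply: (iffP and3P) => [[pu]|[pu ua npre [q pq aq]]].
  case E: (pcomp (apath a) u) => [w|] // nw' /hasP[q pq aq].
  have {nw'}nw : w \notin right_subpaths p by exact: nw'.
  move/eqP/pcompP: E => [ua w0 ws]; split=> //; last by exists q.
  apply: contraNN nw => pre; rewrite right_subpathE w0 ws.
  by move: pu; rewrite right_subpathE => /andP[-> _] /=; rewrite cats1.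
split=> //; last by apply/hasP; exists q.
have [w E] := @pcompS _ (apath a) u (esym ua); rewrite E /=.
move/eqP/pcompP: E => [_ w0 ws]; rewrite right_subpathE negb_and ws cats1 npre.
by rewrite orbT.
Qed.

Lemma detour_index_ex p a u q : detour p a u -> q \in right_subpaths p ->
  bypass a u q -> exists r : detour_index p, [/\ darrow r = a, dsub r = u & dbypass r = q].
Proof.
move=> D pq b; have pu : u \in right_subpaths p by case/detourP: D.
pose d : arrow G * seq_sub (right_subpaths p) * seq_sub (right_subpaths p) :=
  (a, SeqSub pu, SeqSub pq).
have P : detour p d.1.1 (ssval d.1.2) && bypass d.1.1 (ssval d.1.2) (ssval d.2).
  by apply/andP.
by exists (Sub d P).
Qed.

Lemma detour_indexP p (r : detour_index p) :
  [/\ detour p (darrow r) (dsub r), dbypass r \in right_subpaths p &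
      bypass (darrow r) (dsub r) (dbypass r)].
Proof. by have /andP[D b] := valP r; split=> //; exact: ssvalP. Qed.

Lemma detour_index_inj p (r d : detour_index p) : darrow r = darrow d ->
  dsub r = dsub d -> dbypass r = dbypass d -> r = d.
Proof.
rewrite /darrow /dsub /dbypass => E1 E2 E3; apply: val_inj.
case: (val r) (val d) E1 E2 E3 => [[a u] q] [[b w] q'] /= -> /val_inj -> /val_inj ->.
by [].
Qed.

End Detours.

Section Slack.
Variables (K : fieldType) (G : quiver) (A : pzRingType).
Variable rho : {rmorphism palg K G -> A}.
Hypothesis pres : monomial_presentation rho.
Hypothesis infK : infinite_set [set: K].

Local Notation arr := (arr rho).
Local Notation sc := (sc rho).
Local Notation mon := (mon rho).

Lemma pbaseM_opt (p q : qpath G) : pbase K p * pbase K q = pbase_opt K (pcomp p q).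
Proof. exact: palg_mulbb. Qed.

Lemma pbase_opt_inj (p : qpath G) o : pbase K p = pbase_opt K o -> o = Some p.
Proof.
move=> /(congr1 (pcoef p)); rewrite pcoef_pbase eqxx pcoef_opt.
by case: eqP => // _ /eqP; rewrite oner_eq0.
Qed.

Lemma toquo_vanishing p (F : mpoly #|detour_index p| K) :
  toquo (vanishing_ideal rho p) F = 0 <->
  (forall k, Vp rho k -> meval (fun i => k (enum_val i)) F = 0).
Proof. by rewrite toquo_eq0; split=> [/asboolP|H] //; apply/asboolP. Qed.

Lemma coord_var_eq0 p (r : detour_index p) :
  (coord_var rho r = 0) <-> (forall k, Vp rho k -> k r = 0).
Proof.
rewrite toquo_vanishing; split=> H k /H; first by rewrite mevalXU enum_rankK.
by rewrite mevalXU enum_rankK.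
Qed.

(** Turns algebraic dependence in the coordinate ring into vanishing on the values of coordinate [r]
    over [Vp]. *)
Lemma coord_poly_eq0 p (r : detour_index p) (f : {poly K}) :
  (\sum_(i < size f) coord_const rho p f`_i * coord_var rho r ^+ i = 0) <->
  (forall k, Vp rho k -> f.[k r] = 0).
Proof.
have -> : \sum_(i < size f) coord_const rho p f`_i * coord_var rho r ^+ i =
    toquo (vanishing_ideal rho p)
      (\sum_(i < size f) mpolyC _ f`_i * mpolyX K (mnm1 (enum_rank r)) ^+ i).
  by rewrite rmorph_sum; apply: eq_bigr => i _; rewrite rmorphM rmorphXn.
have E k : meval (fun i => k (enum_val i))
    (\sum_(i < size f) mpolyC _ f`_i * mpolyX K (mnm1 (enum_rank r)) ^+ i) = f.[k r].
  rewrite rmorph_sum horner_coef; apply: eq_bigr => i _.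
  by rewrite rmorphM rmorphXn /= mevalC mevalXU enum_rankK.
by rewrite toquo_vanishing; split=> H k /H; rewrite E.
Qed.

Lemma transcendental_neq0 p (r : detour_index p) : transcendental (coord_var rho r) ->
  exists2 k, Vp rho k & k r != 0.
Proof.
move=> T; apply: contrapT => H.
have /T/eqP : \sum_(i < size ('X : {poly K})) coord_const rho p 'X`_i * coord_var rho r ^+ i = 0.
  apply/coord_poly_eq0 => k Vk; rewrite hornerX; apply/eqP; apply: contraT => kr.
  by case: H; exists k.
by rewrite polyX_eq0.
Qed.

Lemma mon_start v w (r : seq (arrow G)) a : mon v (rcons r a) != 0 ->
  mon w (rcons r a) != 0 -> v = w.
Proof.
move=> /mon_walk + /mon_walk.
by case: r => [|b r] /= /andP[/eqP<- _] /andP[/eqP<- _].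
Qed.

Lemma right_subpath_take (p q : qpath G) : q \in right_subpaths p ->
  rho (pbase K q) = mon (pstart p) (take (plen q) (parrows p)).
Proof.
rewrite right_subpathE => /andP[/eqP q0 pre].
by rewrite rho_pbase q0 {1}(prefix_takeE pre).
Qed.

Lemma right_subpath_nested (p u q : qpath G) : u \in right_subpaths p -> q \in right_subpaths p ->
  (plen u <= plen q)%N -> prefix (parrows u) (parrows q).
Proof.
rewrite !right_subpathE => /andP[_ pu] /andP[_ pq]; exact: prefix_nested pu pq.
Qed.

(** For a fixed detour the bypasses have distinct lengths, so applied to x they belong to the basis
    of the strand; [c] collects coefficients by length. *)
Lemma detour_coef (U : lmodType A) (p : qpath G) (x : U) (k : detour_index p -> K)
    (a : arrow G) (u : qpath G) (r : detour_index p) :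
    strand rho (pstart p) (parrows p) x -> darrow r = a -> dsub r = u ->
    \sum_(d : detour_index p | (darrow d == a) && (dsub d == u))
      rho (k d *: pbase K (dbypass d)) *: x = 0 ->
  k r = 0.
Proof.
move=> st ra ru E; set P : pred (detour_index p) := fun d => (darrow d == a) && (dsub d == u).
pose c (t : nat) := \sum_(d | P d) (if plen (dbypass d) == t then k d else 0).
have Pr : P r by rewrite /P ra ru !eqxx.
have lenP (d : detour_index p) : (plen (dbypass d) <= plen p)%N.
  have [_ + _] := detour_indexP d; rewrite right_subpathE => /andP[_ pre].
  exact: (size_prefix pre).
have -> : k r = c (plen (dbypass r)).
  rewrite /c (bigD1 r) //= eqxx big1 ?addr0 // => d /andP[/andP[/eqP da /eqP du] dr].
  case: eqP => // dq; case/eqP: dr; apply: detour_index_inj; rewrite ?da ?du //.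
  by have [_ pd _] := detour_indexP d; have [_ pr _] := detour_indexP r; exact: (right_subpath_inj pd pr dq).
apply: (strand_coef_eq0 pres st _ (lenP r)); rewrite -[RHS]E.
under eq_bigr => t _.
  rewrite /c (big_morph sc (scD rho) (sc0 rho)) scaler_suml; over.
rewrite exchange_big /=; apply: eq_bigr => d _.
have tn : (plen (dbypass d) < (size (parrows p)).+1)%N by rewrite ltnS; exact: lenP.
rewrite (bigD1 (Ordinal tn)) //= eqxx big1 ?addr0 => [|t nt].
  have [_ pd _] := detour_indexP d.
  by rewrite rhoZ -scalerA (right_subpath_take pd).
rewrite ifN ?sc0 ?scale0r //; apply: contraNN nt => /eqP nt.
exact/eqP/val_inj.
Qed.

(** At a point of [Vp] with nonzero coordinate r the path a u is nonzero in the algebra. Rigidity is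
    applied to the bypass q, not to [p]: as (a,u) is a detour, a u is a final segment of q, and what
    precedes it is the closed segment w. *)
Lemma rigid_slack : rigid (fun v s => mon v s != 0) -> slack_condition rho.
Proof.
move=> Hrigid p _ _ a u _ r ra ru [_ /transcendental_neq0[k [U [uni mU [x top eqs]]] kr]].
have st := top_strand pres uni mU top.
have [D pq b] := detour_indexP r; rewrite ra ru in D b.
set q := dbypass r in pq b *.
have [pu au npre _] := detourP _ _ _ D; have /andP[uq /eqP qa] := b.
have [/eqP u0 us] := andP (etrans (esym (right_subpathE u p)) pu).
have [/eqP q0 qs] := andP (etrans (esym (right_subpathE q p)) pq).
have nzp : mon (pstart p) (parrows p) != 0.
  by apply: contraNneq (strand_end st) => ->; rewrite scale0r.
have nza : mon (pstart p) (rcons (parrows u) a) != 0.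
  apply: contraNneq kr => E; apply/eqP/(detour_coef st ra ru).
  rewrite -eqs // (rho_pbase rho u) u0 scalerA.
  have -> : rho (pbase K (apath a)) = arr a by rewrite arr.unlock.
  by rewrite -mon_rcons E scale0r.
have := Hrigid (pstart p) (parrows q) (parrows u) a.
case=> [|||||pre|/suffixP[W qW]].
- exact: (right_subpath_nested pu pq (ltnW uq)).
- exact: uq.
- by rewrite (prefix_takeE qs); apply: mon_take.
- exact: nza.
- by rewrite -qa -q0.
- by case/negP: npre; apply: (prefix_trans pre qs).
have Ws : prefix W (parrows p).
  by apply: prefix_trans qs; rewrite qW prefix_prefix.
have wE : parrows (ptake (size W) p) = W by rewrite [RHS](prefix_takeE Ws).
have wend : walk_end (pstart p) W = pstart p.
  apply: mon_start _ nza; apply: mon_catr; rewrite -qW (prefix_takeE qs).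
  exact: mon_take.
exists (ptake (size W) p); split=> //; first exact: ptake_right.
  by rewrite /pend wE.
have [y yE] := @pcompS _ (apath a) u (esym au).
rewrite [pbase K (apath a) * _]pbaseM_opt yE [RHS]pbaseM_opt.
suff -> : pcomp y (ptake (size W) p) = Some q by [].
move/eqP/pcompP: yE => [_ y0 ys]; apply/eqP/pcompP; split.
- by rewrite /pend wE wend y0 u0.
- by rewrite q0.
- by rewrite wE ys cats1.
Qed.

Section NotSlack.
Variables (v : vertex G) (s : seq (arrow G)) (i0 : nat) (a : arrow G).
Hypotheses (i0n : (i0 < size s)%N) (nzs : mon v s != 0).
Hypotheses (nza : mon v (rcons (take i0 s) a) != 0) (ta : tgt a = walk_end v s).
Hypotheses (npre : ~~ prefix (rcons (take i0 s) a) s)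
           (nsuf : ~~ suffix (rcons (take i0 s) a) s).

Let model_k (k : K) : lmodType A := model pres nzs (fun=> conj nza ta) k.

Let stk (k : K) : strand rho v s (ev K s 0 : model_k k).
Proof. exact: model_strand. Qed.

Let p : qpath G := @QPath G (v, s) (mon_walk nzs).
Let u : qpath G := ptake i0 p.

Let Dau : detour p a u.
Proof.
apply/detourP; split=> //.
- exact: ptake_right.
- by apply: (extra_src (fun=> conj nza ta)).
exists p; first exact: right_subpath_refl.
rewrite /bypass ta eqxx andbT /plen /parrows /= size_takel //; exact: ltnW.
Qed.

Let point (r : detour_index p) (k : K) (d : detour_index p) : K :=
  if d == r then k else 0.

(** The model with parameter k realizes this point; (a,u) is its only detour that can act
    nontrivially. *)
Let point_Vp r k : darrow r = a -> dsub r = u -> dbypass r = p -> Vp rho (point r k).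
Proof.
move=> ra ru rp; exists (model_k k); have uni := strand_uniserial pres (stk k).
split=> //.
  split; first exact: (strand_length pres (stk k)).
  by exists (ev K s 0); rewrite rho_pbase; exact: (strand_end (stk k)).
exists (ev K s 0).
  split.
    have := strand_radN pres (stk k) (leq0n _); rewrite take0 mon_nil.
    by rewrite (strand_top (stk k)).
  by exists v; have := strand_top (stk k); rewrite idm.unlock => ->.
move=> b w D; have [pw bw nb [q pq /andP[wq _]]] := detourP _ _ _ D.
have [/eqP w0 ws] := andP (etrans (esym (right_subpathE w p)) pw).
have wn : (plen w < size s)%N.
  have [_ pre] := andP (etrans (esym (right_subpathE q p)) pq).
  exact: (leq_trans wq (size_prefix pre)).
rewrite (right_subpath_take pw).
have -> : rho (pbase K (apath b)) = arr b by rewrite arr.unlock.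
have npre0 : (i0 < size s)%N -> ~~ prefix (rcons (take i0 s) a) s by [].
rewrite (model_take pres nzs (fun=> conj nza ta) k npre0 (ltnW wn)).
rewrite [LHS](model_extra pres nzs (fun=> conj nza ta) k npre0 b (ltnW wn)).
have -> : nth b s (plen w) == b = false.
  apply: contraNF nb => /eqP E; rewrite (prefix_takeE ws) -[b in rcons _ b]E.
  by rewrite -take_nth // prefix_take.
rewrite scale0r add0r /jump i0n andbT.
have [/andP[/eqP bE /eqP wE]|] := boolP ((b == a) && (plen w == i0)).
  have wu : w = u.
    apply: (right_subpath_inj pw (ptake_right _ _)).
    by rewrite wE /plen size_takel // ltnW.
  rewrite mulr1 (bigD1 r) /=; last by rewrite ra ru bE wu !eqxx.
  rewrite /point eqxx big1 => [|d /andP[_ /negbTE ->]]; last first.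
    by rewrite scale0r rmorph0 scale0r.
  rewrite addr0 rhoZ rp rho_pbase -scalerA [mon _ _ *: _](_ : _ = ev K s (size s)).
    by rewrite model_sc.
  have := model_take pres nzs (fun=> conj nza ta) k npre0 (leqnn _).
  by rewrite take_size.
move=> nab; rewrite mulr0 scale0r big1 // => d /andP[/eqP da /eqP dw].
rewrite /point; case: eqP => [E|_]; last by rewrite scale0r rmorph0 scale0r.
case/negP: nab; rewrite -da -dw E ra ru eqxx /plen size_takel ?eqxx //; exact: ltnW.
Qed.

(** Coordinate r takes every value in the infinite field, so it is slack; a factorization p = a u w
    would make a u a final segment of the mast. *)
Lemma not_rigid_not_slack : ~ slack_condition rho.
Proof.
move=> H; have [r [ra ru rp]] : exists r : detour_index p,
    [/\ darrow r = a, dsub r = u & dbypass r = p].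
  apply: detour_index_ex => //; first exact: right_subpath_refl.
  rewrite /bypass ta eqxx andbT /plen /parrows /= size_takel //; exact: ltnW.
have var0 : coord_var rho r != 0.
  apply/eqP => /coord_var_eq0 /(_ _ (point_Vp 1 ra ru rp)) /eqP.
  by rewrite /point eqxx oner_eq0.
have hal : halyard rho p a u by split=> //; exists r.
have slk : slack_variable rho r.
  split; first by rewrite ra ru.
  move=> f /coord_poly_eq0 f0; apply: infinite_poly0 => // k.
  by have := f0 _ (point_Vp k ra ru rp); rewrite /point eqxx.
have mp : mast rho p.
  exists (model_k 0); split; first exact: (strand_uniserial pres (stk 0)).
  split; first exact: (strand_length pres (stk 0)).
  by exists (ev K s 0); rewrite rho_pbase; exact: (strand_end (stk 0)).
have p0 : (0 < plen p)%N by apply: leq_ltn_trans i0n.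
have [] := H p mp p0 a u _ r ra ru slk; first by split=> //; exists r.
have [_ au _ _] := detourP _ _ _ Dau.
move=> w [_ _ _]; have [y yE] := @pcompS _ (apath a) u (esym au).
rewrite [pbase K (apath a) * _]pbaseM_opt yE pbaseM_opt rp => /pbase_opt_inj.
move=> /eqP/pcompP[_ _ E]; case/negP: nsuf.
move/eqP/pcompP: yE => [_ _ ys]; move: E; rewrite ys cats1 => E.
by apply/suffixP; exists (parrows w); rewrite -E.
Qed.

End NotSlack.

End Slack.

(** * The vertex condition and duality *)

Lemma walk_start (G : quiver) (v w : vertex G) r : r != [::] -> walk v r -> walk w r -> v = w.
Proof. by case: r => [//|b r] _ /= /andP[/eqP<- _] /andP[/eqP<- _]. Qed.

(* The mirror image of rigidity follows by extending the common initial segment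
   of a :: u and s1 ++ u one arrow at a time. *)
Lemma rigid_left (G : quiver) (nz : vertex G -> seq (arrow G) -> bool) :
    (forall v s1 s2, nz v (s1 ++ s2) -> nz v s1) -> rigid nz ->
  forall v s1 u a, (0 < size s1)%N -> nz v (s1 ++ u) -> nz v (a :: u) ->
    tgt a = walk_end v s1 ->
  prefix (a :: u) (s1 ++ u) \/ suffix (a :: u) (s1 ++ u).
Proof.
move=> nzl Hr v s1 u a s1pos nzs nza ta.
suff H n : (n <= (size u).+1)%N ->
    prefix (take n (a :: u)) (s1 ++ u) \/ suffix (a :: u) (s1 ++ u).
  by have := H _ (leqnn _); rewrite (@take_oversize _ _ (a :: u)).
elim: n => [|n IH] nu; first by left; rewrite take0 prefix0s.
have [pre|] := IH (ltnW nu); last by right.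
have E := @take_nth _ a n (a :: u) nu; set b := nth _ _ _ in E.
have su : size (take n u) = n by rewrite size_takel.
have pre' : prefix (s1 ++ take n u) (s1 ++ u) by rewrite prefix_catr // eqxx prefix_take.
have sw : size (take n (a :: u)) = n by rewrite size_takel //= ltnW.
rewrite E; case: (Hr v (s1 ++ take n u) (take n (a :: u)) b).
- by apply: prefix_nested pre pre' _; rewrite sw size_cat su leq_addl.
- by rewrite sw size_cat su -[X in (X < _)%N]add0n ltn_add2r.
- by apply: (nzl _ _ (drop n u)); rewrite -catA cat_take_drop.
- by apply: (nzl _ _ (drop n.+1 (a :: u))); rewrite -E cat_take_drop.
- by rewrite walk_end_cat -ta -(walk_end_rcons v (take n (a :: u)) b) -E.
- by left; apply: prefix_trans pre'.
(* That [a :: take n u] is a suffix of [s1 ++ take n u] only says that [s1] ends with [a], which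
   settles the suffix case for all of [u]. *)
rewrite -E /= -cat1s suffix_catl // eqxx /= => suf; right.
by rewrite -cat1s suffix_catl // eqxx.
Qed.

(** Write s = u ++ q. Reversed, the two paths are [rev q ++ rev u] and [a :: rev u], the situation
    of [rigid_left]. *)
Lemma rigid_op (G : quiver) (nz : vertex G -> seq (arrow G) -> bool)
    (nz' : vertex (opquiver G) -> seq (arrow (opquiver G)) -> bool) :
    (forall v s1 s2, nz v (s1 ++ s2) -> nz v s1) ->
    (forall v s, nz v s -> walk v s) ->
    (forall v s, nz' v s -> @walk (opquiver G) v s) ->
    (forall v s, nz' v s -> nz (@walk_end (opquiver G) v s) (rev s)) ->
  rigid nz -> rigid nz'.
Proof.
move=> nzl nzw nzw' nzop Hr v s u a pre us nzs nza ta.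
have := nzop _ _ nzs; rewrite -ta => nzS.
have := nzop _ _ nza; rewrite walk_end_rcons rev_rcons => nzA.
have [q sE] := prefixP pre.
have q0 : (0 < size q)%N by move: us; rewrite sE size_cat -[X in (X < _)%N]addn0 ltn_add2l.
move: (nzS); rewrite sE rev_cat => nzS'.
have tga : @tgt G a = @walk_end G (@tgt (opquiver G) a) (rev q).
  have [u0|u0] := eqVneq u [::].
    have [_] := walk_rev (nzw' _ _ nzs); rewrite -ta sE u0 cat0s => ->.
    by have := nzw' _ _ nza; rewrite u0 /= andbT => /eqP.
  apply: (@walk_start G _ _ (rev u)).
  - by rewrite -size_eq0 size_rev size_eq0.
  - by have /= /andP[_] := nzw _ _ nzA.
  - by have := nzw _ _ nzS'; rewrite walk_cat => /andP[].
have q0' : (0 < size (rev q))%N by rewrite size_rev.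
have [H|H] := rigid_left nzl Hr (s1 := rev q) (u := rev u) (a := a) q0' nzS' nzA tga.
- by right; rewrite /suffix rev_rcons rev_cat.
- by left; rewrite -suffix_rev rev_rcons rev_cat.
Qed.

Section Factors.
Variables (K : fieldType) (G : quiver).

(** Condition (N) is phrased in the path algebra; this and [pbase_factor_last] bring it back to
    arrows. *)
Lemma pbase_factor_first (p : qpath G) a c :
  pbase K p = c * pbase K (apath a) -> exists r, parrows p = a :: r.
Proof.
move=> E; have /eqP := pcoef_pbase K p p; rewrite eqxx E => nz.
apply: contrapT => H; have : pcoef p (c * pbase K (apath a)) = 0; last first.
  by move=> z; move: nz; rewrite z eq_sym oner_eq0.
elim/palg_ind: c {E nz} => [q||c x y Hx Hy].
- rewrite [_ * _]palg_mulbb pcoef_opt; case: pcompP => // -[_ _ E].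
  by case: H; exists (parrows q).
- by rewrite mul0r pcoef0.
- by rewrite [_ * _]palg_mulDZl pcoefDZ Hx Hy mulr0 addr0.
Qed.

Lemma pbase_factor_last (p : qpath G) a c :
  pbase K p = pbase K (apath a) * c -> exists r, parrows p = rcons r a.
Proof.
move=> E; have /eqP := pcoef_pbase K p p; rewrite eqxx E => nz.
apply: contrapT => H; have : pcoef p (pbase K (apath a) * c) = 0; last first.
  by move=> z; move: nz; rewrite z eq_sym oner_eq0.
elim/palg_ind: c {E nz} => [q||c x y Hx Hy].
- rewrite [_ * _]palg_mulbb pcoef_opt; case: pcompP => // -[_ _ E].
  by case: H; exists (parrows q); rewrite E cats1.
- by rewrite mulr0 pcoef0.
- by rewrite [_ * _]palg_mulDZr pcoefDZ Hx Hy mulr0 addr0.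
Qed.

Lemma pverts_nth (p : qpath G) t : (t <= plen p)%N ->
  nth (pstart p) (pverts p) t = walk_end (pstart p) (take t (parrows p)).
Proof. by case: t => [|t] tp; [rewrite take0 | apply: map_tgt_nth]. Qed.

End Factors.

Section VertexCondition.
Variables (K : fieldType) (G : quiver) (A : pzRingType).
Variable rho : {rmorphism palg K G -> A}.
Hypothesis pres : monomial_presentation rho.
Local Notation mon := (mon rho).
Local Notation nz := (fun v s => mon v s != 0).

Lemma mast_neq0 p : mast rho p -> mon (pstart p) (parrows p) != 0.
Proof.
move=> [U [_ [_ [x]]]]; rewrite rho_pbase; apply: contraNneq => ->.
by rewrite scale0r.
Qed.

(** The model without a detour: [i0] is the length of the path. *)
Lemma neq0_mast (a : arrow G) p : mon (pstart p) (parrows p) != 0 -> mast rho p.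
Proof.
move=> nzp; have ext : (size (parrows p) < size (parrows p))%N ->
    mon (pstart p) (rcons (take (size (parrows p)) (parrows p)) a) != 0 /\
    tgt a = walk_end (pstart p) (parrows p) by rewrite ltnn.
have st : strand rho (pstart p) (parrows p) (ev K (parrows p) 0 : model pres nzp ext 0).
  by apply: model_strand; rewrite ltnn.
exists (model pres nzp ext 0); split; first exact: (strand_uniserial pres st).
split; first exact: (strand_length pres st).
by exists (ev K (parrows p) 0); rewrite rho_pbase; exact: (strand_end st).
Qed.

Lemma condition_N_arrow_inj (a b : arrow G) : condition_N rho ->
  src a = src b -> tgt a = tgt b -> a = b.
Proof.
move=> cN sab tab.
have mb : mast rho (apath b) by apply: (neq0_mast a); exact: mon_arr_neq0.
have [[c /pbase_factor_first[r]]|[c /pbase_factor_last[r]]] :=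
  cN a (apath b) (esym sab) (esym tab) mb isT.
  by case.
by case: r => [[]|? []].
Qed.

(** (N) applies to [a] and the part of [s] after u, which are parallel. If that part starts with
    [a], then u a is a prefix. If it ends with [a], the vertex condition makes the vertices of u
    reappear just before the final [a], and without parallel arrows so do its arrows. *)
Lemma vertex_rigid : vertex_condition rho -> rigid nz.
Proof.
move=> [cN cV] v s u a pre us nzs nza ta.
have par := condition_N_arrow_inj cN.
have uE := prefix_takeE pre; set i := size u in us uE.
have ua : src a = walk_end v u.
  by move/mon_walk: nza; rewrite -cats1 walk_cat /= andbT => /andP[_ /eqP].
have [p' [p'v p's p'nz]] := mon_qpath (mon_drop i nzs).
have p'N : mast rho p'.
  by apply: (neq0_mast a); rewrite p'v p's; apply: mon_drop.
have p'a : pstart p' = src a by rewrite p'v ua uE.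
have p'ta : pend p' = tgt a by rewrite /pend p'v p's -walk_end_cat cat_take_drop.
have p'0 : (0 < plen p')%N by rewrite /plen p's size_drop subn_gt0.
have [[c /pbase_factor_first[r]]|[c /pbase_factor_last[r]]] := cN a p' p'a p'ta p'N p'0.
  rewrite p's => E; left; rewrite -(cat_take_drop i s) -uE E -cats1.
  by rewrite -(cat1s a r) catA prefix_prefix.
rewrite p's => E; have sE : s = rcons (u ++ r) a by rewrite -(cat_take_drop i s) -uE E rcons_cat.
have [r0|r0] := posnP (size r).
  by left; rewrite sE (size0nil r0) cats0 prefix_refl.
(* If the arrow after u ends where [a] does, the two are parallel, hence equal. *)
have [tb|tb] := eqVneq (tgt (nth a s i)) (tgt a).
  left; have <- : nth a s i = a.
    by apply: par => //; rewrite (walk_nth_src a (mon_walk nzs) us) -uE.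
  by rewrite {1}uE -take_nth // prefix_take.
right; set j := size (u ++ r); have sj : size s = j.+1 by rewrite sE size_rcons.
have ij : (i < j)%N by rewrite /j size_cat -[X in (X < _)%N]addn0 ltn_add2l.
have [p [pv ps pnz]] := mon_qpath nzs; have [q [qv qs qnz]] := mon_qpath nza.
have eE t : (t <= j.+1)%N -> nth (pstart p) (pverts p) t = walk_end v (take t s).
  by move=> tj; rewrite pverts_nth ?pv ?ps // /plen ps sj.
have sja : src a = walk_end v (take j s).
  have js : (j < size s)%N by rewrite sj.
  by rewrite -(walk_nth_src a (mon_walk nzs) js) sE nth_rcons ltnn eqxx.
have Ev k : (k <= i)%N -> walk_end v (take (j - i + k) s) = walk_end v (take k s).
  move=> ki; rewrite -!eE; try lia.
  apply: (cV p _ i j) => //.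
  - by rewrite pnz.
  - by rewrite ij /plen ps sj /=.
  - by rewrite !eE //; [rewrite -sja ua uE | lia].
  - rewrite !eE //; last lia.
    by rewrite -sj take_size -ta (walk_end_takeS v a us).
  exists q; split; first by rewrite qnz.
  rewrite eE // -sj take_size -ta /pverts qv qs map_rcons -rcons_cons; congr rcons.
  apply: (@eq_from_nth _ v) => [|t]; first by rewrite size_map size_iota /= size_map.
  move=> ti; have {}ti : (t < i.+1)%N by move: ti; rewrite /= size_map.
  rewrite [RHS](nth_map 0%N) ?size_iota // nth_iota // add0n eE; last lia.
  case: t ti => [|t] ti; first by rewrite take0.
  by rewrite /= map_tgt_nth // {1}uE take_takel.
rewrite sE suffix_rcons eqxx /= suffixE -/j -/i; apply/eqP.
have ui : size u = i by [].
apply: (@eq_from_nth _ a) => [|t]; rewrite size_drop -/j ?subKn ?(ltnW ij) // => ti.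
have tj : (j - i + t < j)%N by lia.
have ts : (t < size s)%N by lia.
have tjs : (j - i + t < size s)%N by lia.
have -> : nth a u t = nth a s t by rewrite {1}uE nth_take.
rewrite nth_drop; have -> : nth a (u ++ r) (j - i + t) = nth a s (j - i + t).
  by rewrite sE nth_rcons -/j tj.
apply: par; first by rewrite !(walk_nth_src a (mon_walk nzs)) // Ev // ltnW.
by rewrite -!(walk_end_takeS v) // -addnS Ev.
Qed.

(** (N) is rigidity for the empty initial segment. For the rest, let [a] be the arrow of [s] at
    position j: q must be [take i s] followed by [a]. It is no prefix since e(i+1) and e(j+1)
    differ, and as a suffix of [take j.+1 s] it makes the vertices repeat. *)
Lemma rigid_vertex : rigid nz -> vertex_condition rho.
Proof.
move=> Hr; split.
  move=> a p pa ta mp p0; have nzp := mast_neq0 mp.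
  have nza : mon (pstart p) [:: a] != 0 by rewrite pa; exact: mon_arr_neq0.
  case: (Hr (pstart p) (parrows p) [::] a (prefix0s _) p0 nzp nza (esym ta)).
    move=> pre; left; have : apath a \in right_subpaths p by rewrite right_subpathE pa eqxx.
    move=> /right_subpathP[r E]; exists (pbase K r).
    by rewrite pbaseM_opt E.
  move=> /suffixP[r rE]; right; exists (pbase K (ptake (size r) p)).
  have /right_subpathP[y E] := ptake_right (size r) p.
  suff <- : y = apath a by rewrite pbaseM_opt E.
  move/eqP/pcompP: E => [_ _]; rewrite {2}/parrows /= -/(parrows p) rE take_size_cat // => /eqP.
  rewrite eqseq_cat // eqxx /= => /eqP E; apply: qpath_eq; rewrite -?E //.
  by have := qpath_walk y; rewrite -E /= andbT => /eqP.
move=> p pnz e i j /andP[ij jp] eij neq [q [qnz qv]] k ki.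
have par := rigid_arrow_inj pres Hr.
rewrite rho_pbase in pnz; rewrite rho_pbase in qnz.
have {}jp : (j < size (parrows p))%N by exact: jp.
move: qnz qv; set v := pstart p in pnz e eij neq *; set s := parrows p in pnz jp *.
have eE t : (t <= size s)%N -> e t = walk_end v (take t s) by exact: pverts_nth.
have [a0 _] : exists a0 : arrow G, True by move: jp; case: (s) => // a0; exists a0.
pose a := nth a0 s j.
have ws := mon_walk pnz; have is' : (i <= size s)%N := ltnW (ltn_trans ij jp).
have wj : src a = walk_end v (take i s).
  by rewrite (walk_nth_src a0 ws jp) -!eE // ?(ltnW jp) //; lia.
have tja : tgt a = walk_end v (take j.+1 s) by rewrite (walk_end_takeS v a0 jp).
move=> qnz qv; have q0 : pstart q = v by case: qv.
have qs : parrows q = rcons (take i s) a.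
  apply: (walk_map_inj pres Hr (v := v)).
  - by rewrite -q0 qpath_walk.
  - rewrite -cats1 walk_cat /= wj eqxx !andbT; exact: (mon_walk (mon_take i pnz)).
  have : pverts q = rcons (v :: map (@tgt G) (take i s)) (tgt a).
    rewrite qv eE // -tja; congr rcons.
    apply: (@eq_from_nth _ v) => [|t]; first by rewrite size_map size_iota /= size_map size_takel //; lia.
    rewrite size_map size_iota => ti; rewrite (nth_map 0%N) ?size_iota // nth_iota // add0n eE; last lia.
    case: t ti => [|t] ti; first by rewrite take0.
    by rewrite /= map_tgt_nth ?take_takel // size_takel //; lia.
  by rewrite /pverts q0 rcons_cons map_rcons => -[].
rewrite q0 qs in qnz.
have js : (j <= size s)%N by apply: ltnW.
case: (Hr v (take j.+1 s) (take i s) a).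
- by rewrite -(@take_takel _ i j.+1) ?prefix_take //; lia.
- by rewrite (size_takel is') (size_takel jp) ltnS ltnW.
- exact: mon_take.
- exact: qnz.
- exact: tja.
- move=> pre; case/eqP: neq; rewrite !eE //; last lia.
  have : prefix (rcons (take i s) a) s by apply: prefix_trans pre _; apply: prefix_take.
  move/prefix_takeE; rewrite size_rcons (size_takel is') => <-.
  by rewrite walk_end_rcons.
rewrite (take_nth a0 jp) suffix_rcons eqxx /= => /suffixP[W WE].
have sW : size W = (j - i)%N.
  have := congr1 size WE; rewrite size_cat (size_takel is') (size_takel js) => ->.
  by rewrite addnK.
(* For i = 0 the equality of e(i) and e(j) closes [W]; otherwise the first arrow of [take i s]
   does. *)
have vW : walk_end v W = v.
  have [i0|ipos] := posnP i.
    move: WE; rewrite i0 take0 cats0 => <-; rewrite -eE // -eij i0.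
    by [].
  apply: (walk_start (r := take i s)).
  - by rewrite -size_eq0 (size_takel is') -lt0n.
  - have := mon_walk (mon_take j pnz); rewrite WE walk_cat => /andP[].
    by [].
  exact: (mon_walk (mon_take i pnz)).
rewrite !eE; try lia.
have -> : take (j - i + k) s = W ++ take k s.
  rewrite -(@take_takel _ (j - i + k) j); last lia.
  by rewrite WE take_cat sW ltnNge leq_addr /= addKn take_takel.
by rewrite walk_end_cat vW.
Qed.

End VertexCondition.

(** * Each condition is equivalent to rigidity *)

Section Equivalences.
Variables (K : fieldType) (G : quiver) (A : pzRingType).
Variable rho : {rmorphism palg K G -> A}.
Hypothesis pres : monomial_presentation rho.
Hypothesis infK : infinite_set [set: K].
Local Notation rigid_rho := (rigid (fun v s => mon rho v s != 0)).

Lemma rigid_contra (P : Prop) :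
    (forall v s i0 a, (i0 < size s)%N -> mon rho v s != 0 ->
       mon rho v (rcons (take i0 s) a) != 0 -> tgt a = walk_end v s ->
       ~~ prefix (rcons (take i0 s) a) s -> ~~ suffix (rcons (take i0 s) a) s -> ~ P) ->
  P -> rigid_rho.
Proof.
move=> H HP v s u a pre us nzs nza ta.
have [|npre] := boolP (prefix (rcons u a) s); first by left.
have [|nsuf] := boolP (suffix (rcons u a) s); first by right.
by case: (H v s (size u) a); rewrite -?(prefix_takeE pre).
Qed.

Lemma finite_rigid : finite_uniserial_type A <-> rigid_rho.
Proof.
split; last exact: (rigid_finite pres).
by apply: rigid_contra => v s i0 a i0n nzs nza ta np ns; exact: (not_rigid_not_finite pres i0n nzs nza ta np ns infK).
Qed.

Lemma unique_rigid : uniserial_unique_by_series A <-> rigid_rho.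
Proof.
split; last exact: (rigid_unique pres).
by apply: rigid_contra => v s i0 a i0n nzs nza ta np ns; exact: (not_rigid_not_unique pres i0n nzs nza ta np ns).
Qed.

Lemma slack_rigid : slack_condition rho <-> rigid_rho.
Proof.
split; last exact: (rigid_slack pres).
by apply: rigid_contra => v s i0 a i0n nzs nza ta np ns; exact: (not_rigid_not_slack pres infK i0n nzs nza ta np ns).
Qed.

Lemma vertex_condition_rigid : vertex_condition rho <-> rigid_rho.
Proof. by split; [exact: vertex_rigid | exact: rigid_vertex]. Qed.

End Equivalences.

Section OppositeRigid.
Variables (K : fieldType) (G : quiver) (I : ideal (palg K G)).

Lemma mon_op v s : mon (toquo_op I) v s != 0 ->
  mon (toquo I) (@walk_end (opquiver G) v s) (rev s) != 0.
Proof.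
move=> nz; have [p [pv ps E]] := mon_qpath nz; subst v s; rewrite -E in nz.
by rewrite -(rho_pbase (toquo I) (unop p)) /= -palg_unop_pbase.
Qed.

Lemma mon_op_rev v s : mon (toquo I) v s != 0 ->
  mon (toquo_op I) (walk_end v s) (rev s) != 0.
Proof.
move=> nz; have [p [pv ps E]] := mon_qpath nz; subst v s; rewrite -E in nz.
have [q qp] := unop_surj p.
have -> : walk_end (pstart p) (parrows p) = pstart q by rewrite -(pend_unop q) qp.
have -> : rev (parrows p) = parrows q by rewrite -qp /parrows /= revK.
by rewrite -rho_pbase /= /toquo_op palg_unop_pbase qp.
Qed.

Lemma rigid_toquo_op : rigid (fun v s => mon (toquo I) v s != 0) <->
  rigid (fun v s => mon (toquo_op I) v s != 0).
Proof.
split.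
  apply: rigid_op.
  - by move=> v s1 s2; apply: mon_catl.
  - by move=> v s; apply: mon_walk.
  - by move=> v s; apply: mon_walk.
  - exact: mon_op.
(* The converse is the same lemma over the opposite quiver, whose opposite is [G] again. *)
apply: (@rigid_op (opquiver G)).
- by move=> v s1 s2; apply: mon_catl.
- by move=> v s; apply: mon_walk.
- move=> v s; exact: mon_walk.
- exact: mon_op_rev.
Qed.

End OppositeRigid.

Theorem theorem6p3 (K : fieldType) (K_infinite : infinite_set [set: K])
    (G : quiver) (I : ideal (palg K G))
    (I_admissible : admissible I) (I_monomial : generated_by_paths I) :
  [/\ [<-> finite_uniserial_type (quo I);
           uniserial_unique_by_series (quo I);
           slack_condition (toquo I);
           vertex_condition (toquo I)],
      finite_uniserial_type (quo I) <-> finite_uniserial_type (quo I)^c,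
      uniserial_unique_by_series (quo I) <-> uniserial_unique_by_series (quo I)^c,
      slack_condition (toquo I) <-> slack_condition (toquo_op I) &
      vertex_condition (toquo I) <-> vertex_condition (toquo_op I)].
Proof.
have pL := toquo_presentation I_admissible I_monomial.
have pR := toquo_op_presentation I_admissible I_monomial.
have [f u s w] := And4 (finite_rigid pL K_infinite) (unique_rigid pL)
  (slack_rigid pL K_infinite) (vertex_condition_rigid pL).
have [f' u' s' w'] := And4 (finite_rigid pR K_infinite) (unique_rigid pR)
  (slack_rigid pR K_infinite) (vertex_condition_rigid pR).
have d := rigid_toquo_op I.
split; last 4 first.
- by rewrite f f'.
- by rewrite u u'.
- by rewrite s s'.
- by rewrite w w'.
tfae.
- by move/f/u.
- by move/u/s.
- by move/s/w.
- by move/w/f.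
Qed.
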